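(* Let $\mathscr{M}=\{m_n\}_{n\in\mathbb{N}_0}$ be a weight sequence and let $\alpha$ be a real number. The operator $P_\alpha(D_1,D_2)=D_1-\alpha D_2$ on $\mathbb{T}^2$ is globally $\mathscr{M}$-hypoelliptic if and only if $\alpha$ is irrational and is not Liouville $\mathscr{M}$-exponential.
   Context: $\mathbb{N}=\{1,2,\dots\}$, $\mathbb{N}_0=\mathbb{N}\cup\{0\}$, $\mathbb{T}^2=\mathbb{R}^2/2\pi\mathbb{Z}^2$. A weight sequence is a sequence $\mathscr{M}=\{m_n\}_{n\in\mathbb{N}_0}$ of positive reals with: $m_0=m_1=1$; $m_n^2\le m_{n-1}m_{n+1}$ for all $n\in\mathbb{N}$; and there is $H>1$ with $m_{j+k}\le H^{j+k}m_jm_k$ for all $j,k\in\mathbb{N}_0$. $\mathcal{E}_{\mathscr{M}}(\mathbb{T}^2)$ is the space of $f\in C^\infty(\mathbb{T}^2)$ (complex-valued) for which there are $C,h>0$ with $|D^\gamma f(x)|\le C h^{|\gamma|}m_{|\gamma|}|\gamma|!$ for all $x\in\mathbb{T}^2$, $\gamma\in\mathbb{N}_0^2$, where $D_j=-i\partial_{x_j}$. For $h>0$, $\mathcal{E}_{\mathscr{M},h}(\mathbb{T}^2)$ is the Banach space of those $f$ with $\|f\|_{\mathscr{M},h}:=\sup_{x,\gamma}\frac{|D^\gamma f(x)|}{h^{|\gamma|}m_{|\gamma|}|\gamma|!}<\infty$. $\mathcal{E}_{\mathscr{M}}(\mathbb{T}^2)$ carries the locally convex inductive limit topology of the spaces $\mathcal{E}_{\mathscr{M},h_n}(\mathbb{T}^2)$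 for any strictly increasing positive sequence $h_n\to+\infty$ (the topology does not depend on the choice). $\mathscr{D}'_{\mathscr{M}}(\mathbb{T}^2)$ is the topological dual of $\mathcal{E}_{\mathscr{M}}(\mathbb{T}^2)$; $\mathcal{E}_{\mathscr{M}}(\mathbb{T}^2)$ is regarded as a subspace of it via $\langle f,\varphi\rangle=\int_{\mathbb{T}^2}f\varphi\,dx$, and differential operators act by duality. An operator $P$ is globally $\mathscr{M}$-hypoelliptic if $u\in\mathscr{D}'_{\mathscr{M}}(\mathbb{T}^2)$ and $Pu\in\mathcal{E}_{\mathscr{M}}(\mathbb{T}^2)$ imply $u\in\mathcal{E}_{\mathscr{M}}(\mathbb{T}^2)$. A number $\alpha\in\mathbb{R}\setminus\mathbb{Q}$ is Liouville $\mathscr{M}$-exponential if there is $\varepsilon>0$ such that the inequality $|\xi-\alpha\eta|<\inf_{n\in\mathbb{N}_0}\left(\frac{m_n\cdot n!}{\varepsilon^n(1+|\eta|)^n}\right)$ has infinitely many solutions $(\xi,\eta)\in\mathbb{Z}\times\mathbb{Z}$. *)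

(* Defs.v *)
From Stdlib Require Import Reals ZArith QArith Qreals.
From Stdlib Require Finite_sets.
From Coquelicot Require Import Coquelicot.

Open Scope R_scope.

Record weight_sequence (m : nat -> R) : Prop := {
  ws_pos : forall n, 0 < m n;
  ws_0 : m 0%nat = 1;
  ws_1 : m 1%nat = 1;
  ws_log_convex : forall n, (1 <= n)%nat ->
    (m n) ^ 2 <= m (n - 1)%nat * m (n + 1)%nat;
  ws_moderate_growth : exists H : R, 1 < H /\
    forall j k : nat, m (j + k)%nat <= H ^ (j + k) * m j * m k }.

(* Functions on the torus R^2 / 2 pi Z^2 are functions on R^2 that are
   2 pi-periodic in each variable. *)
Definition Fn := R * R -> C.

Definition periodic (f : Fn) : Prop :=
  forall x y : R, f (x + 2 * PI, y) = f (x, y) /\ f (x, y + 2 * PI) = f (x, y).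

Definition ex_partial1 (f : Fn) (p : R * R) : Prop :=
  ex_derive (fun t : R => Re (f (t, snd p))) (fst p) /\
  ex_derive (fun t : R => Im (f (t, snd p))) (fst p).

Definition ex_partial2 (f : Fn) (p : R * R) : Prop :=
  ex_derive (fun t : R => Re (f (fst p, t))) (snd p) /\
  ex_derive (fun t : R => Im (f (fst p, t))) (snd p).

Definition partial1 (f : Fn) : Fn := fun p =>
  (Derive (fun t : R => Re (f (t, snd p))) (fst p),
   Derive (fun t : R => Im (f (t, snd p))) (fst p)).

Definition partial2 (f : Fn) : Fn := fun p =>
  (Derive (fun t : R => Re (f (fst p, t))) (snd p),
   Derive (fun t : R => Im (f (fst p, t))) (snd p)).

Definition continuous_Fn (f : Fn) : Prop := forall p : R * R, continuous f p.

Fixpoint Ck (k : nat) (f : Fn) : Prop :=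
  match k with
  | O => continuous_Fn f
  | S k' => continuous_Fn f /\
            (forall p, ex_partial1 f p /\ ex_partial2 f p) /\
            Ck k' (partial1 f) /\ Ck k' (partial2 f)
  end.

Definition smooth_torus (f : Fn) : Prop := periodic f /\ forall k, Ck k f.

Definition D1 (f : Fn) : Fn := fun p => (- Ci * partial1 f p)%C.
Definition D2 (f : Fn) : Fn := fun p => (- Ci * partial2 f p)%C.

Definition Dmulti (g : nat * nat) (f : Fn) : Fn :=
  Nat.iter (fst g) D1 (Nat.iter (snd g) D2 f).

Definition order (g : nat * nat) : nat := (fst g + snd g)%nat.

Definition EM (m : nat -> R) (f : Fn) : Prop :=
  smooth_torus f /\
  exists c h : R, 0 < c /\ 0 < h /\
    forall (x : R * R) (g : nat * nat),
      Cmod (Dmulti g f x) <= c * h ^ order g * m (order g) * INR (fact (order g)).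

Definition norm_Mh (m : nat -> R) (h : R) (f : Fn) : Rbar :=
  Lub_Rbar (fun r : R => exists (x : R * R) (g : nat * nat),
    r = Cmod (Dmulti g f x) / (h ^ order g * m (order g) * INR (fact (order g)))).

Definition EMh (m : nat -> R) (h : R) (f : Fn) : Prop :=
  smooth_torus f /\ Rbar_lt (norm_Mh m h f) p_infty.

Definition lin_comb (a : C) (f : Fn) (b : C) (g : Fn) : Fn :=
  fun p => (a * f p + b * g p)%C.

Definition absolutely_convex (V : Fn -> Prop) : Prop :=
  forall (f g : Fn) (a b : C), V f -> V g -> Cmod a + Cmod b <= 1 ->
    V (lin_comb a f b g).

Definition admissible_steps (h : nat -> R) : Prop :=
  (forall n, 0 < h n) /\ (forall n, h n < h (S n)) /\ is_lim_seq h p_infty.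

(* The standard base of neighbourhoods of 0 of the locally convex inductive
   limit of the spaces EMh m (h n): the absolutely convex subsets of EM m whose
   trace on each step is a neighbourhood of 0 in that step. *)
Definition basic_nbhs0 (m : nat -> R) (h : nat -> R) (V : Fn -> Prop) : Prop :=
  (forall f, V f -> EM m f) /\
  absolutely_convex V /\
  forall n, exists delta : R, 0 < delta /\
    forall f, EMh m (h n) f -> Rbar_lt (norm_Mh m (h n) f) delta -> V f.

Definition open_EM (m : nat -> R) (h : nat -> R) (U : Fn -> Prop) : Prop :=
  (forall f, U f -> EM m f) /\
  forall f, U f -> exists V, basic_nbhs0 m h V /\
    forall g, V g -> U (fun p => (f p + g p)%C).

(* Functionals on EM m are total functions on Fn; their values outside EM m
   are irrelevant, every condition below being restricted to EM m. *)
Definition Functional := Fn -> C.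

Definition linear_EM (m : nat -> R) (u : Functional) : Prop :=
  forall (f g : Fn) (a b : C), EM m f -> EM m g ->
    u (lin_comb a f b g) = (a * u f + b * u g)%C.

Definition continuous_EM (m : nat -> R) (h : nat -> R) (u : Functional) : Prop :=
  forall W : C -> Prop, open W -> open_EM m h (fun f => EM m f /\ W (u f)).

Definition ultradistribution (m : nat -> R) (h : nat -> R) (u : Functional)
  : Prop := linear_EM m u /\ continuous_EM m h u.

Definition torus_integral (f : Fn) : C :=
  RInt (V := C_R_CompleteNormedModule)
    (fun x : R => RInt (V := C_R_CompleteNormedModule)
       (fun y : R => f (x, y)) 0 (2 * PI)) 0 (2 * PI).

Definition embed (f : Fn) : Functional :=
  fun phi => torus_integral (fun p => (f p * phi p)%C).

Definition functional_in_EM (m : nat -> R) (u : Functional) : Prop :=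
  exists f, EM m f /\ forall phi, EM m phi -> u phi = embed f phi.

(* <D_j u, phi> = - <u, D_j phi> *)
Definition dual_D1 (u : Functional) : Functional := fun phi => (- u (D1 phi))%C.
Definition dual_D2 (u : Functional) : Functional := fun phi => (- u (D2 phi))%C.

Definition P_op (alpha : R) (u : Functional) : Functional :=
  fun phi => (dual_D1 u phi - RtoC alpha * dual_D2 u phi)%C.

Definition globally_hypoelliptic (m : nat -> R) (h : nat -> R)
    (P : Functional -> Functional) : Prop :=
  forall u, ultradistribution m h u ->
    functional_in_EM m (P u) -> functional_in_EM m u.

Definition irrational (alpha : R) : Prop := forall q : Q, alpha <> Q2R q.

Definition liouville_bound (m : nat -> R) (eps : R) (eta : Z) : Rbar :=
  Glb_Rbar (fun r : R => exists n : nat,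
    r = m n * INR (fact n) / (eps ^ n * (1 + Rabs (IZR eta)) ^ n)).

Definition Liouville_exponential (m : nat -> R) (alpha : R) : Prop :=
  irrational alpha /\
  exists eps : R, 0 < eps /\
    ~ Finite_sets.Finite (Z * Z) (fun p : Z * Z =>
        Rbar_lt (Rabs (IZR (fst p) - alpha * IZR (snd p)))
                (liouville_bound m eps (snd p))).

(* Main.v *)
From Stdlib Require Import Reals Lra Lia ZArith QArith Qreals Cantor.
From Stdlib Require Import FunctionalExtensionality PropExtensionality ClassicalEpsilon.
From Stdlib Require Finite_sets.
From Coquelicot Require Import Coquelicot.
Require Import Defs.
Open Scope R_scope.

(** Everything is read off Fourier coefficients. On the character of frequency
    [k = (k1, k2)] the operator acts as multiplication by the symbol
    [k1 - alpha * k2], so solving the equation means dividing coefficients by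
    the symbol.

    Membership in the class is a decay condition on coefficients: [f] belongs to
    it iff [|coef f k| * |k| ^ n <= K * A ^ n * m n * n!] for all [n]. One
    direction is integration by parts ([coef_decay]), the other is termwise
    differentiation ([EM_trig]); moderate growth of [m] provides the few extra
    powers of [|k|] that make the series converge. Moreover the Fourier series
    of a test function converges to it in some step of the inductive limit, so
    an ultradistribution is determined by its values on characters
    ([ultradistribution_series]). This rests on the uniqueness of Fourier
    coefficients of continuous functions ([Fourier_uniqueness]), proved with
    powers of a trigonometric polynomial that concentrate at a point.

    Sufficiency. If [alpha] is irrational and not exponential Liouville, the
    symbol vanishes only at the origin, and for each [eps] it is bounded below
    by the infimum in the Liouville condition off a finite set. Since [eps] is
    arbitrary, moderate growth shows that division by the symbol preserves the
    decay condition ([symbol_division]); the quotients are the coefficients of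
    a function of the class that represents the given ultradistribution.

    Necessity. Let [S] be a set of frequencies on which the symbol is bounded by
    the infimum for one [eps]. The formal sum of the characters over [S] is an
    ultradistribution, and the operator maps it into the class, because the
    symbol itself decays along [S]. By hypoellipticity the sum is a function of
    the class; its coefficients are one on [S], so [S] is bounded
    ([hypoelliptic_bounded]). For rational [alpha] the zeros of the symbol form
    an unbounded [S]; for exponential Liouville [alpha] the solutions of the
    Liouville inequality form an infinite one. *)

(** * Integration of continuous real functions over the period square *)

Definition cont (g : R * R -> R) : Prop := forall p, continuous g p.

Definition RInt2 (g : R * R -> R) : R :=
  RInt (fun x => RInt (fun y => g (x, y)) 0 (2 * PI)) 0 (2 * PI).

Lemma two_pi_pos : 0 < 2 * PI.
Proof. generalize PI_RGT_0; lra. Qed.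

Lemma cont_lin (a b : R) (g h : R * R -> R) :
  cont g -> cont h -> cont (fun p => a * g p + b * h p).
Proof.
  intros Hg Hh p.
  apply (continuous_plus (fun p => a * g p) (fun p => b * h p)).
  - apply (continuous_scal_r (V := R_NormedModule) a g p), Hg.
  - apply (continuous_scal_r (V := R_NormedModule) b h p), Hh.
Qed.

Lemma cont_mult (g h : R * R -> R) :
  cont g -> cont h -> cont (fun p => g p * h p).
Proof. intros Hg Hh p; apply (continuous_mult g h p); auto. Qed.

Lemma cont_const (a : R) : cont (fun _ => a).
Proof. intros p; apply continuous_const. Qed.

Lemma cont_pow (g : R * R -> R) (n : nat) : cont g -> cont (fun p => g p ^ n).
Proof.
  intros Hg; induction n as [|n IH]; simpl.
  - apply cont_const.
  - apply (cont_mult g (fun p => g p ^ n)); auto.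
Qed.

Lemma cont_section2 (g : R * R -> R) (x y : R) :
  cont g -> continuous (fun y => g (x, y)) y.
Proof.
  intros Hg.
  apply (continuous_comp_2 (fun _ => x) (fun y => y) (fun a b => g (a, b))).
  - apply continuous_const.
  - apply continuous_id.
  - eapply continuous_ext; [|apply Hg]. intros [a b]; reflexivity.
Qed.

Lemma cont_2d (g : R * R -> R) (x y : R) :
  cont g -> continuity_2d_pt (fun x y => g (x, y)) x y.
Proof.
  intros Hg. apply continuity_2d_pt_filterlim.
  eapply filterlim_ext; [|apply (Hg (x, y))]. intros [a b]; reflexivity.
Qed.

Lemma ex_RInt_section (g : R * R -> R) (x a b : R) :
  cont g -> ex_RInt (fun y => g (x, y)) a b.
Proof.
  intros Hg. apply (ex_RInt_continuous (V := R_CompleteNormedModule)).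
  intros z _. now apply cont_section2.
Qed.

(** Uniform continuity on a compact strip makes the integrand vary uniformly
    little with the parameter. *)
Lemma continuous_RInt_param (g : R * R -> R) (x : R) :
  cont g -> continuous (fun x => RInt (fun y => g (x, y)) 0 (2 * PI)) x.
Proof.
  intros Hg. pose proof two_pi_pos as Hpi.
  apply continuity_pt_filterlim.
  intros e He.
  assert (He' : 0 < e / (2 * (2 * PI))) by (apply Rdiv_lt_0_compat; lra).
  destruct (uniform_continuity_2d_1d' (fun x y => g (x, y)) 0 (2 * PI) x
    (fun y _ => cont_2d g x y Hg) (mkposreal _ He')) as [d Hd].
  exists d; split; [apply cond_pos|].
  intros z [_ Hz]. simpl in *. unfold R_dist in *.
  apply Rabs_def2 in Hz.
  replace (RInt (fun y => g (z, y)) 0 (2 * PI)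
           - RInt (fun y => g (x, y)) 0 (2 * PI))
    with (RInt (fun y => g (z, y) - g (x, y)) 0 (2 * PI)).
  2: { apply (RInt_minus (V := R_CompleteNormedModule)
          (fun y => g (z, y)) (fun y => g (x, y))); now apply ex_RInt_section. }
  apply Rle_lt_trans with ((2 * PI - 0) * (e / (2 * (2 * PI)))).
  2: { replace ((2 * PI - 0) * (e / (2 * (2 * PI)))) with (e / 2)
         by (field; lra). lra. }
  apply abs_RInt_le_const; [lra| |].
  - apply (ex_RInt_minus (V := R_CompleteNormedModule)
      (fun y => g (z, y)) (fun y => g (x, y))); now apply ex_RInt_section.
  - intros t Ht. apply Rlt_le.
    pose proof (cond_pos d) as Hd0.
    apply (Hd t x t z); try lra.
    replace (t - t) with 0 by ring. rewrite Rabs_R0. exact Hd0.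
Qed.

Lemma ex_RInt_outer (g : R * R -> R) (a b : R) :
  cont g -> ex_RInt (fun x => RInt (fun y => g (x, y)) 0 (2 * PI)) a b.
Proof.
  intros Hg. apply (ex_RInt_continuous (V := R_CompleteNormedModule)).
  intros z _. now apply continuous_RInt_param.
Qed.

Lemma RInt2_ext (g h : R * R -> R) : (forall p, g p = h p) -> RInt2 g = RInt2 h.
Proof.
  intros H. unfold RInt2. apply RInt_ext; intros x _; apply RInt_ext; intros y _.
  apply H.
Qed.

Lemma RInt_lin (f g : R -> R) (a b u v : R) :
  ex_RInt f u v -> ex_RInt g u v ->
  RInt (fun t => a * f t + b * g t) u v = a * RInt f u v + b * RInt g u v.
Proof.
  intros Hf Hg.
  pose proof (RInt_plus (V := R_CompleteNormedModule) (fun t => a * f t)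
    (fun t => b * g t) u v
    (ex_RInt_scal (V := R_NormedModule) f u v a Hf)
    (ex_RInt_scal (V := R_NormedModule) g u v b Hg)) as E.
  pose proof (RInt_scal (V := R_CompleteNormedModule) f u v a Hf) as E1.
  pose proof (RInt_scal (V := R_CompleteNormedModule) g u v b Hg) as E2.
  unfold plus, scal in *; simpl in *; unfold mult in *; simpl in *.
  rewrite E1, E2 in E. exact E.
Qed.

Lemma RInt2_lin (a b : R) (g h : R * R -> R) :
  cont g -> cont h -> RInt2 (fun p => a * g p + b * h p) = a * RInt2 g + b * RInt2 h.
Proof.
  intros Hg Hh. unfold RInt2.
  rewrite <- RInt_lin by now apply ex_RInt_outer.
  apply RInt_ext; intros x _. apply RInt_lin; now apply ex_RInt_section.
Qed.

Lemma RInt2_const (a : R) : RInt2 (fun _ => a) = (2 * PI) ^ 2 * a.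
Proof.
  unfold RInt2. rewrite 2!RInt_const. unfold scal; simpl; unfold mult; simpl. ring.
Qed.

Lemma RInt2_le (g h : R * R -> R) :
  cont g -> cont h -> (forall p, g p <= h p) -> RInt2 g <= RInt2 h.
Proof.
  intros Hg Hh H. pose proof two_pi_pos as Hpi. unfold RInt2.
  apply RInt_le; [lra|now apply ex_RInt_outer|now apply ex_RInt_outer|].
  intros x _. apply RInt_le; [lra|now apply ex_RInt_section|
    now apply ex_RInt_section|]. intros y _; apply H.
Qed.

Lemma RInt2_abs (g : R * R -> R) (M : R) :
  cont g -> (forall p, Rabs (g p) <= M) -> Rabs (RInt2 g) <= (2 * PI) ^ 2 * M.
Proof.
  intros Hg H. apply Rabs_le. split.
  - replace (- ((2 * PI) ^ 2 * M)) with ((2 * PI) ^ 2 * (- M)) by ring.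
    rewrite <- RInt2_const. apply RInt2_le; auto using cont_const.
    intros p; specialize (H p); apply Rabs_le_between in H; lra.
  - rewrite <- RInt2_const. apply RInt2_le; auto using cont_const.
    intros p; specialize (H p); apply Rabs_le_between in H; lra.
Qed.

(** An integral over a period of the derivative of a periodic function
    vanishes; in the outer variable this needs differentiation under the inner
    integral sign. *)
Lemma RInt2_derive1 (g g' : R * R -> R) :
  (forall x y, is_derive (fun t => g (t, y)) x (g' (x, y))) ->
  (forall x y, g (x + 2 * PI, y) = g (x, y)) ->
  cont g -> cont g' -> RInt2 g' = 0.
Proof.
  intros Hd Hp Hg Hg'. unfold RInt2.
  assert (HD : forall x, is_derive (fun x => RInt (fun y => g (x, y)) 0 (2 * PI)) x
      (RInt (fun y => g' (x, y)) 0 (2 * PI))).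
  { intros x.
    replace (RInt (fun y => g' (x, y)) 0 (2 * PI)) with
      (RInt (fun t => Derive (fun u => g (u, t)) x) 0 (2 * PI)).
    2: { apply RInt_ext; intros y _. now apply is_derive_unique. }
    apply (is_derive_RInt_param (fun x y => g (x, y))).
    - exists (mkposreal 1 Rlt_0_1). intros z _ t _. eexists; apply Hd.
    - intros t _. apply continuity_2d_pt_ext with (fun u v => g' (u, v)).
      intros u v; symmetry; now apply is_derive_unique.
      now apply cont_2d.
    - exists (mkposreal 1 Rlt_0_1). intros z _. now apply ex_RInt_section. }
  rewrite (RInt_ext _ (Derive (fun x => RInt (fun y => g (x, y)) 0 (2 * PI)))).
  2: { intros x _. symmetry. now apply is_derive_unique. }
  rewrite RInt_Derive.
  - rewrite (RInt_ext (fun y => g (2 * PI, y)) (fun y => g (0, y))).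
    + apply Rminus_diag_eq; reflexivity.
    + intros y _. rewrite <- (Hp 0 y). f_equal. f_equal. ring.
  - intros x _; eexists; apply HD.
  - intros x _. eapply continuous_ext.
    intros z; symmetry; apply is_derive_unique, HD.
    now apply continuous_RInt_param.
Qed.

Lemma RInt2_derive2 (g g' : R * R -> R) :
  (forall x y, is_derive (fun t => g (x, t)) y (g' (x, y))) ->
  (forall x y, g (x, y + 2 * PI) = g (x, y)) ->
  cont g' -> RInt2 g' = 0.
Proof.
  intros Hd Hp Hg'. unfold RInt2.
  rewrite (RInt_ext _ (fun _ => 0)).
  - rewrite RInt_const. unfold scal; simpl; unfold mult; simpl. ring.
  - intros x _.
    rewrite (RInt_ext _ (Derive (fun y => g (x, y)))).
    2: { intros y _. symmetry. now apply is_derive_unique. }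
    rewrite RInt_Derive.
    + apply Rminus_diag_eq. rewrite <- (Hp x 0). f_equal. f_equal. ring.
    + intros y _; eexists; apply Hd.
    + intros y _. eapply continuous_ext.
      intros z; symmetry; apply is_derive_unique, Hd.
      now apply cont_section2.
Qed.

Lemma RInt_lower (f : R -> R) (a b v : R) :
  (forall x, continuous f x) -> (forall x, 0 <= f x) ->
  0 <= a <= b -> b <= 2 * PI -> (forall x, a <= x <= b -> v <= f x) ->
  (b - a) * v <= RInt f 0 (2 * PI).
Proof.
  intros Hc H0 Ha Hb Hv.
  assert (Hex : forall u w, ex_RInt f u w).
  { intros u w. apply (ex_RInt_continuous (V := R_CompleteNormedModule)); auto. }
  rewrite <- (RInt_Chasles f 0 a (2 * PI)), <- (RInt_Chasles f a b (2 * PI)); auto.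
  unfold plus; simpl.
  assert (0 <= RInt f 0 a) by (apply RInt_ge_0; auto; lra).
  assert (0 <= RInt f b (2 * PI)) by (apply RInt_ge_0; auto; lra).
  assert ((b - a) * v <= RInt f a b).
  { replace ((b - a) * v) with (RInt (fun _ => v) a b).
    - apply RInt_le; auto. lra. apply ex_RInt_const.
      intros x Hx; apply Hv; lra.
    - rewrite RInt_const. reflexivity. }
  lra.
Qed.

(** Only the part over a subrectangle is kept; this is how a peak of a
    nonnegative function is seen by its integral. *)
Lemma RInt2_lower (g : R * R -> R) (a b c d v : R) :
  cont g -> (forall p, 0 <= g p) -> 0 <= v ->
  0 <= a <= b -> b <= 2 * PI -> 0 <= c <= d -> d <= 2 * PI ->
  (forall x y, a <= x <= b -> c <= y <= d -> v <= g (x, y)) ->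
  (b - a) * ((d - c) * v) <= RInt2 g.
Proof.
  intros Hg H0 Hv0 Ha Hb Hc Hd Hv. pose proof two_pi_pos as Hpi.
  unfold RInt2. apply RInt_lower; auto.
  - intros x; now apply continuous_RInt_param.
  - intros x. apply RInt_ge_0; [lra|now apply ex_RInt_section|auto].
  - intros x Hx. apply RInt_lower; auto.
    intros y; now apply cont_section2.
Qed.

(** * Complex-valued functions on the torus and their partial derivatives *)

Lemma C_ext (z w : C) : Re z = Re w -> Im z = Im w -> z = w.
Proof. destruct z, w; simpl; intros; f_equal; auto. Qed.

Lemma Rabs_Re_le (z : C) : Rabs (Re z) <= Cmod z.
Proof. eapply Rle_trans; [apply Rmax_l|apply (Rmax_Cmod z)]. Qed.
Lemma Rabs_Im_le (z : C) : Rabs (Im z) <= Cmod z.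
Proof. eapply Rle_trans; [apply Rmax_r|apply (Rmax_Cmod z)]. Qed.

Lemma Cmod_le_sum (z : C) : Cmod z <= Rabs (Re z) + Rabs (Im z).
Proof.
  replace z with (RtoC (Re z) + Ci * RtoC (Im z))%C at 1.
  - eapply Rle_trans; [apply Cmod_triangle|].
    rewrite Cmod_mult, Cmod_Ci, !Cmod_R. lra.
  - apply C_ext; simpl; ring.
Qed.

Lemma continuous_Fn_ReIm (f : Fn) :
  continuous_Fn f <-> cont (fun p => Re (f p)) /\ cont (fun p => Im (f p)).
Proof.
  split.
  - intros H; split; intros p.
    + apply (continuous_comp f Re p (H p)). destruct (f p); apply continuous_fst.
    + apply (continuous_comp f Im p (H p)). destruct (f p); apply continuous_snd.
  - intros [H1 H2] p P [e He].
    assert (B1 := H1 p (ball (Re (f p)) e) (ex_intro _ e (fun y h => h))).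
    assert (B2 := H2 p (ball (Im (f p)) e) (ex_intro _ e (fun y h => h))).
    unfold filtermap in *.
    generalize (filter_and _ _ B1 B2). apply filter_imp.
    intros q [Q1 Q2]. apply He. split; assumption.
Qed.

Lemma continuous_Fn_lin (f g : Fn) (a b : C) :
  continuous_Fn f -> continuous_Fn g -> continuous_Fn (lin_comb a f b g).
Proof.
  rewrite !continuous_Fn_ReIm. intros [F1 F2] [G1 G2]. split.
  - assert (H := cont_lin 1 1 _ _ (cont_lin (Re a) (- Im a) _ _ F1 F2)
        (cont_lin (Re b) (- Im b) _ _ G1 G2)).
    intros p. eapply continuous_ext; [|apply H].
    intros q; unfold lin_comb, Re, Im; simpl; ring.
  - assert (H := cont_lin 1 1 _ _ (cont_lin (Im a) (Re a) _ _ F1 F2)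
        (cont_lin (Im b) (Re b) _ _ G1 G2)).
    intros p. eapply continuous_ext; [|apply H].
    intros q; unfold lin_comb, Re, Im; simpl; ring.
Qed.

Lemma continuous_Fn_mult (f g : Fn) :
  continuous_Fn f -> continuous_Fn g -> continuous_Fn (fun p => f p * g p)%C.
Proof.
  rewrite !continuous_Fn_ReIm. intros [F1 F2] [G1 G2]. split.
  - assert (H := cont_lin 1 (-1) _ _ (cont_mult _ _ F1 G1) (cont_mult _ _ F2 G2)).
    intros p. eapply continuous_ext; [|apply H].
    intros q; unfold Re, Im; simpl; ring.
  - assert (H := cont_lin 1 1 _ _ (cont_mult _ _ F1 G2) (cont_mult _ _ F2 G1)).
    intros p. eapply continuous_ext; [|apply H].
    intros q; unfold Re, Im; simpl; ring.
Qed.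

Lemma torus_integral_ReIm (f : Fn) : continuous_Fn f ->
  torus_integral f = (RInt2 (fun p => Re (f p)), RInt2 (fun p => Im (f p))).
Proof.
  intros Hf. destruct (proj1 (continuous_Fn_ReIm f) Hf) as [H1 H2].
  unfold torus_integral.
  apply (is_RInt_unique (V := C_R_CompleteNormedModule)).
  apply (is_RInt_ext (fun x => (RInt (fun y => Re (f (x, y))) 0 (2 * PI),
                               RInt (fun y => Im (f (x, y))) 0 (2 * PI)))).
  - intros x _. symmetry. apply (is_RInt_unique (V := C_R_CompleteNormedModule)).
    apply (is_RInt_fct_extend_pair (U := R_NormedModule) (V := R_NormedModule)
       (fun y => f (x, y)));
      apply (RInt_correct (V := R_CompleteNormedModule)).
    + apply (ex_RInt_section (fun p => Re (f p))); assumption.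
    + apply (ex_RInt_section (fun p => Im (f p))); assumption.
  - apply (is_RInt_fct_extend_pair (U := R_NormedModule) (V := R_NormedModule));
      apply (RInt_correct (V := R_CompleteNormedModule)).
    + apply (ex_RInt_outer (fun p => Re (f p))); assumption.
    + apply (ex_RInt_outer (fun p => Im (f p))); assumption.
Qed.

Lemma torus_integral_lin (f g : Fn) (a b : C) :
  continuous_Fn f -> continuous_Fn g ->
  torus_integral (lin_comb a f b g)
  = (a * torus_integral f + b * torus_integral g)%C.
Proof.
  intros Hf Hg.
  rewrite !torus_integral_ReIm; auto using continuous_Fn_lin.
  apply continuous_Fn_ReIm in Hf; apply continuous_Fn_ReIm in Hg.
  destruct Hf as [F1 F2], Hg as [G1 G2]. apply C_ext; simpl.
  - rewrite (RInt2_ext _ (fun p => 1 * (fst a * Re (f p) + (- snd a) * Im (f p))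
        + 1 * (fst b * Re (g p) + (- snd b) * Im (g p)))).
    + rewrite !RInt2_lin; auto using cont_lin. ring.
    + intros p; unfold lin_comb; simpl. unfold Re, Im; ring.
  - rewrite (RInt2_ext _ (fun p => 1 * (snd a * Re (f p) + fst a * Im (f p))
        + 1 * (snd b * Re (g p) + fst b * Im (g p)))).
    + rewrite !RInt2_lin; auto using cont_lin. ring.
    + intros p; unfold lin_comb; simpl. unfold Re, Im; ring.
Qed.

(** The factor two pays for estimating real and imaginary parts separately. *)
Lemma torus_integral_bound (f : Fn) (M : R) :
  continuous_Fn f -> (forall p, Cmod (f p) <= M) ->
  Cmod (torus_integral f) <= 2 * (2 * PI) ^ 2 * M.
Proof.
  intros Hf HM. rewrite torus_integral_ReIm by assumption.
  apply continuous_Fn_ReIm in Hf. destruct Hf as [F1 F2].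
  eapply Rle_trans; [apply Cmod_le_sum|]. simpl.
  assert (Rabs (RInt2 (fun p => Re (f p))) <= (2 * PI) ^ 2 * M).
  { apply RInt2_abs; auto. intros p; eapply Rle_trans; [apply Rabs_Re_le|apply HM]. }
  assert (Rabs (RInt2 (fun p => Im (f p))) <= (2 * PI) ^ 2 * M).
  { apply RInt2_abs; auto. intros p; eapply Rle_trans; [apply Rabs_Im_le|apply HM]. }
  simpl in *. lra.
Qed.

(** The two coordinate directions are treated at once, [true] standing for the
    first variable and [false] for the second. *)
Definition prj {A : Type} (b : bool) (p : A * A) : A := if b then fst p else snd p.

Definition slice (b : bool) (f : Fn) (p : R * R) : R -> C :=
  fun t => if b then f (t, snd p) else f (fst p, t).

Definition partial (b : bool) (f : Fn) : Fn := if b then partial1 f else partial2 f.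
Definition Ddir (b : bool) (f : Fn) : Fn := if b then D1 f else D2 f.

(** A relational form of the partial derivative: sums, products and series
    can be differentiated without side conditions on existence. *)
Definition has_partial (b : bool) (f : Fn) (p : R * R) (l : C) : Prop :=
  is_derive (fun t => Re (slice b f p t)) (prj b p) (Re l) /\
  is_derive (fun t => Im (slice b f p t)) (prj b p) (Im l).

Lemma slice_prj (b : bool) (f : Fn) (p : R * R) : slice b f p (prj b p) = f p.
Proof. destruct b, p; reflexivity. Qed.

Lemma partial_unique (b : bool) (f : Fn) (p : R * R) (l : C) :
  has_partial b f p l -> partial b f p = l.
Proof.
  intros [H1 H2]. apply is_derive_unique in H1, H2.
  destruct b; apply C_ext; assumption.
Qed.

Lemma partial_eq (b : bool) (f F : Fn) :
  (forall p, has_partial b f p (F p)) -> partial b f = F.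
Proof.
  intros H. apply functional_extensionality; intros p. now apply partial_unique.
Qed.

(** To climb one order of smoothness it is enough to exhibit candidates for
    the two partial derivatives. *)
Lemma Ck_step (k : nat) (f : Fn) (F : bool -> Fn) :
  continuous_Fn f -> (forall b p, has_partial b f p (F b p)) ->
  (forall b, Ck k (F b)) -> Ck (S k) f.
Proof.
  intros Hc H HF. simpl. split; [assumption|]. split; [|split].
  - intros p. destruct (H true p) as [A1 A2], (H false p) as [B1 B2].
    repeat split; eexists; eassumption.
  - change (partial1 f) with (partial true f).
    rewrite (partial_eq true f (F true)); auto.
  - change (partial2 f) with (partial false f).
    rewrite (partial_eq false f (F false)); auto.
Qed.

Lemma Ck_has_partial (k : nat) (f : Fn) : Ck (S k) f ->
  forall b p, has_partial b f p (partial b f p).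
Proof.
  intros (_ & H & _) b p. destruct (H p) as [[A1 A2] [B1 B2]].
  destruct b; split; apply Derive_correct; assumption.
Qed.

Lemma Ck_partial (k : nat) (f : Fn) (b : bool) : Ck (S k) f -> Ck k (partial b f).
Proof. intros (_ & _ & H1 & H2). destruct b; assumption. Qed.

Lemma Ck_continuous (k : nat) (f : Fn) : Ck k f -> continuous_Fn f.
Proof. destruct k; simpl; [auto|intros [H _]; auto]. Qed.

Lemma has_partial_lin (d : bool) (f g : Fn) (a b : C) (p : R * R) (l m : C) :
  has_partial d f p l -> has_partial d g p m ->
  has_partial d (lin_comb a f b g) p (a * l + b * m)%C.
Proof.
  intros [F1 F2] [G1 G2]. split.
  - apply (is_derive_ext (fun t => (Re a * Re (slice d f p t) + (- Im a) * Im (slice d f p t))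
       + (Re b * Re (slice d g p t) + (- Im b) * Im (slice d g p t)))).
    { intros t; destruct d; unfold lin_comb, slice, Re, Im; simpl; ring. }
    replace (Re (a * l + b * m)) with ((Re a * Re l + (- Im a) * Im l)
       + (Re b * Re m + (- Im b) * Im m)) by (unfold Re, Im; simpl; ring).
    repeat apply @is_derive_plus; apply is_derive_scal; assumption.
  - apply (is_derive_ext (fun t => (Im a * Re (slice d f p t) + Re a * Im (slice d f p t))
       + (Im b * Re (slice d g p t) + Re b * Im (slice d g p t)))).
    { intros t; destruct d; unfold lin_comb, slice, Re, Im; simpl; ring. }
    replace (Im (a * l + b * m)) with ((Im a * Re l + Re a * Im l)
       + (Im b * Re m + Re b * Im m)) by (unfold Re, Im; simpl; ring).
    repeat apply @is_derive_plus; apply is_derive_scal; assumption.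
Qed.

Lemma has_partial_mult (d : bool) (f g : Fn) (p : R * R) (l m : C) :
  has_partial d f p l -> has_partial d g p m ->
  has_partial d (fun p => f p * g p)%C p (l * g p + f p * m)%C.
Proof.
  intros [F1 F2] [G1 G2].
  assert (M : forall u v : R -> R, forall t u' v', is_derive u t u' ->
     is_derive v t v' -> is_derive (fun t => u t * v t) t (u' * v t + u t * v')).
  { intros u v t u' v' Hu Hv. apply (is_derive_mult u v t u' v' Hu Hv).
    intros; apply Rmult_comm. }
  split.
  - apply (is_derive_ext (fun t => Re (slice d f p t) * Re (slice d g p t)
       - Im (slice d f p t) * Im (slice d g p t))).
    { intros t; destruct d; reflexivity. }
    pose proof (is_derive_minus _ _ _ _ _ (M _ _ _ _ _ F1 G1) (M _ _ _ _ _ F2 G2)) as E.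
    cbv beta in E. rewrite !slice_prj in E.
    replace (Re (l * g p + f p * m)) with (minus (Re l * Re (g p) + Re (f p) * Re m)
       (Im l * Im (g p) + Im (f p) * Im m)); [exact E|].
    unfold minus, plus, opp; simpl; unfold Re, Im; ring.
  - apply (is_derive_ext (fun t => Re (slice d f p t) * Im (slice d g p t)
       + Im (slice d f p t) * Re (slice d g p t))).
    { intros t; destruct d; reflexivity. }
    pose proof (is_derive_plus _ _ _ _ _ (M _ _ _ _ _ F1 G2) (M _ _ _ _ _ F2 G1)) as E.
    cbv beta in E. rewrite !slice_prj in E.
    replace (Im (l * g p + f p * m)) with (plus (Re l * Im (g p) + Re (f p) * Im m)
       (Im l * Re (g p) + Im (f p) * Re m)); [exact E|].
    unfold plus; simpl; unfold Re, Im; ring.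
Qed.

Lemma Ck_lin (k : nat) : forall (f g : Fn) (a b : C),
  Ck k f -> Ck k g -> Ck k (lin_comb a f b g).
Proof.
  induction k as [|k IH]; intros f g a b Hf Hg.
  - now apply continuous_Fn_lin.
  - apply (Ck_step k _ (fun d => lin_comb a (partial d f) b (partial d g))).
    + apply continuous_Fn_lin; eapply Ck_continuous; eassumption.
    + intros d p. apply has_partial_lin; eapply Ck_has_partial; eassumption.
    + intros d. apply IH; now apply Ck_partial.
Qed.

Lemma Derive_shift (g : R -> R) (x T : R) :
  Derive g (x + T) = Derive (fun t => g (t + T)) x.
Proof.
  unfold Derive. f_equal. apply Lim_ext. intros h.
  replace (x + T + h) with (x + h + T) by ring. reflexivity.
Qed.

Lemma periodic_partial (d : bool) (f : Fn) : periodic f -> periodic (partial d f).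
Proof.
  intros H x y.
  assert (E1 : forall y, (fun t => f (t + 2 * PI, y)) = (fun t => f (t, y))).
  { intros y'; apply functional_extensionality; intros t; apply (H t y'). }
  assert (E2 : forall x, (fun t => f (x, t + 2 * PI)) = (fun t => f (x, t))).
  { intros x'; apply functional_extensionality; intros t; apply (H x' t). }
  assert (E1' : (fun t => f (x + 2 * PI, t)) = (fun t => f (x, t))).
  { apply functional_extensionality; intros t; apply (H x t). }
  assert (E2' : (fun t => f (t, y + 2 * PI)) = (fun t => f (t, y))).
  { apply functional_extensionality; intros t; apply (H t y). }
  destruct d; simpl; unfold partial1, partial2; simpl; split.
  - rewrite (Derive_shift (fun t => Re (f (t, y)))),
      (Derive_shift (fun t => Im (f (t, y)))).
    specialize (E1 y).
    f_equal; f_equal; apply functional_extensionality; intros t;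
      now rewrite (proj1 (H t y)).
  - f_equal; apply Derive_ext; intros t; now rewrite (proj2 (H t y)).
  - f_equal; apply Derive_ext; intros t; now rewrite (proj1 (H x t)).
  - rewrite (Derive_shift (fun t => Re (f (x, t)))),
      (Derive_shift (fun t => Im (f (x, t)))).
    f_equal; f_equal; apply functional_extensionality; intros t;
      now rewrite (proj2 (H x t)).
Qed.

Lemma periodic_lin (f g : Fn) (a b : C) :
  periodic f -> periodic g -> periodic (lin_comb a f b g).
Proof.
  intros Hf Hg x y. unfold lin_comb.
  destruct (Hf x y) as [-> ->], (Hg x y) as [-> ->]. auto.
Qed.

Lemma smooth_lin (f g : Fn) (a b : C) :
  smooth_torus f -> smooth_torus g -> smooth_torus (lin_comb a f b g).
Proof.
  intros [Pf Hf] [Pg Hg]; split; [now apply periodic_lin|].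
  intros k; now apply Ck_lin.
Qed.

Lemma smooth_continuous (f : Fn) : smooth_torus f -> continuous_Fn f.
Proof. intros [_ H]; apply (H 0%nat). Qed.

Lemma smooth_has_partial (f : Fn) (b : bool) (p : R * R) :
  smooth_torus f -> has_partial b f p (partial b f p).
Proof. intros [_ H]; apply (Ck_has_partial 0), (H 1%nat). Qed.

Lemma smooth_partial (f : Fn) (b : bool) :
  smooth_torus f -> smooth_torus (partial b f).
Proof.
  intros [Pf Hf]; split; [now apply periodic_partial|].
  intros k; apply Ck_partial, Hf.
Qed.

Lemma Ddir_partial (b : bool) (f : Fn) (p : R * R) : Ddir b f p = (- Ci * partial b f p)%C.
Proof. destruct b; reflexivity. Qed.

Lemma Ddir_as_lin (b : bool) (f : Fn) :
  Ddir b f = lin_comb (- Ci) (partial b f) 0 (partial b f).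
Proof.
  apply functional_extensionality; intros p. rewrite Ddir_partial.
  unfold lin_comb. ring.
Qed.

Lemma smooth_Ddir (f : Fn) (b : bool) : smooth_torus f -> smooth_torus (Ddir b f).
Proof.
  intros H. rewrite Ddir_as_lin. now apply smooth_lin; apply smooth_partial.
Qed.

(** Derivatives of exponentials come out as [Ci] times something, and the
    factor [- Ci] of the operator removes the unit. *)
Lemma Ddir_eq (b : bool) (f F : Fn) :
  (forall p, has_partial b f p (Ci * F p)%C) -> Ddir b f = F.
Proof.
  intros H. apply functional_extensionality; intros p.
  rewrite Ddir_partial, (partial_unique _ _ _ _ (H p)).
  rewrite Cmult_assoc. replace (- Ci * Ci)%C with (RtoC 1).
  - ring.
  - apply C_ext; simpl; ring.
Qed.

Lemma Ddir_lin (d : bool) (f g : Fn) (a b : C) : smooth_torus f -> smooth_torus g ->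
  Ddir d (lin_comb a f b g) = lin_comb a (Ddir d f) b (Ddir d g).
Proof.
  intros Hf Hg. apply functional_extensionality; intros p.
  rewrite Ddir_partial, (partial_unique d _ p (a * partial d f p + b * partial d g p)).
  - unfold lin_comb. rewrite !Ddir_partial. ring.
  - apply has_partial_lin; now apply smooth_has_partial.
Qed.

Lemma smooth_iter_Ddir (b : bool) (n : nat) (f : Fn) :
  smooth_torus f -> smooth_torus (Nat.iter n (Ddir b) f).
Proof. intros H; induction n; simpl; auto using smooth_Ddir. Qed.

Lemma iter_Ddir_lin (d : bool) (n : nat) (f g : Fn) (a b : C) :
  smooth_torus f -> smooth_torus g ->
  Nat.iter n (Ddir d) (lin_comb a f b g)
  = lin_comb a (Nat.iter n (Ddir d) f) b (Nat.iter n (Ddir d) g).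
Proof.
  intros Hf Hg; induction n as [|n IH]; simpl; auto.
  rewrite IH. apply Ddir_lin; now apply smooth_iter_Ddir.
Qed.

Lemma Dmulti_iter (g : nat * nat) (f : Fn) :
  Dmulti g f = Nat.iter (fst g) (Ddir true) (Nat.iter (snd g) (Ddir false) f).
Proof. reflexivity. Qed.

Lemma Dmulti_lin (m : nat * nat) (f g : Fn) (a b : C) :
  smooth_torus f -> smooth_torus g ->
  Dmulti m (lin_comb a f b g) = lin_comb a (Dmulti m f) b (Dmulti m g).
Proof.
  intros Hf Hg. rewrite !Dmulti_iter, !iter_Ddir_lin; auto using smooth_iter_Ddir.
Qed.

(** On the torus a periodic function has no boundary terms. *)
Lemma torus_integral_partial (b : bool) (f F : Fn) :
  periodic f -> continuous_Fn f -> continuous_Fn F ->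
  (forall p, has_partial b f p (F p)) -> torus_integral F = 0.
Proof.
  intros Hp Hf HF H. rewrite torus_integral_ReIm by assumption.
  apply continuous_Fn_ReIm in Hf; apply continuous_Fn_ReIm in HF.
  destruct Hf as [F1 F2], HF as [G1 G2].
  destruct b; apply C_ext; simpl.
  - apply (RInt2_derive1 (fun p => Re (f p))); auto.
    + intros x y; apply (H (x, y)).
    + intros x y; f_equal; apply Hp.
  - apply (RInt2_derive1 (fun p => Im (f p))); auto.
    + intros x y; apply (H (x, y)).
    + intros x y; f_equal; apply Hp.
  - apply (RInt2_derive2 (fun p => Re (f p))); auto.
    + intros x y; apply (H (x, y)).
    + intros x y; f_equal; apply Hp.
  - apply (RInt2_derive2 (fun p => Im (f p))); auto.
    + intros x y; apply (H (x, y)).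
    + intros x y; f_equal; apply Hp.
Qed.

(** * Absolutely convergent complex series *)

Definition CSeries (a : nat -> C) : C :=
  (Series (fun j => Re (a j)), Series (fun j => Im (a j))).

Definition abs_summable (a : nat -> C) : Prop := ex_series (fun j => Cmod (a j)).

(** Removing initial terms, instead of truncating, keeps the remainder of a
    trigonometric series a trigonometric series of the same shape. *)
Definition tail {A : Type} (z : A) (n : nat) (a : nat -> A) : nat -> A :=
  fun j => if Nat.ltb j n then z else a j.

Lemma ex_series_bound (a b : nat -> R) :
  (forall j, Rabs (a j) <= b j) -> ex_series b -> ex_series a.
Proof. intros H; apply (ex_series_le (V := R_CompleteNormedModule)); exact H. Qed.

Lemma ex_series_scal_l (c : R) (a : nat -> R) :
  ex_series a -> ex_series (fun j => c * a j).
Proof. apply (ex_series_scal (V := R_NormedModule) c a). Qed.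

Lemma ex_series_add (a b : nat -> R) :
  ex_series a -> ex_series b -> ex_series (fun j => a j + b j).
Proof. apply (ex_series_plus (V := R_NormedModule) a b). Qed.

Lemma Series_bound (a b : nat -> R) :
  (forall j, Rabs (a j) <= b j) -> ex_series b -> Rabs (Series a) <= Series b.
Proof.
  intros H Hb.
  assert (Ha : ex_series (fun j => Rabs (a j))).
  { apply (ex_series_bound _ b); auto. intros j; rewrite Rabs_Rabsolu; auto. }
  eapply Rle_trans; [now apply Series_Rabs|].
  apply Series_le; auto. intros j; split; auto using Rabs_pos.
Qed.

Lemma Series_lin (x y : R) (a b : nat -> R) : ex_series a -> ex_series b ->
  Series (fun j => x * a j + y * b j) = x * Series a + y * Series b.
Proof.
  intros Ha Hb. rewrite Series_plus by now apply ex_series_scal_l.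
  now rewrite !Series_scal_l.
Qed.

Lemma abs_summable_Re (a : nat -> C) :
  abs_summable a -> ex_series (fun j => Re (a j)).
Proof. apply ex_series_bound; intros; apply Rabs_Re_le. Qed.

Lemma abs_summable_Im (a : nat -> C) :
  abs_summable a -> ex_series (fun j => Im (a j)).
Proof. apply ex_series_bound; intros; apply Rabs_Im_le. Qed.

(** The factor two pays for estimating real and imaginary parts separately. *)
Lemma CSeries_bound (a : nat -> C) (b : nat -> R) :
  (forall j, Cmod (a j) <= b j) -> ex_series b -> Cmod (CSeries a) <= 2 * Series b.
Proof.
  intros H Hb. eapply Rle_trans; [apply Cmod_le_sum|]. simpl.
  assert (Rabs (Series (fun j => Re (a j))) <= Series b).
  { apply Series_bound; auto.
    intros j; eapply Rle_trans; [apply Rabs_Re_le|apply H]. }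
  assert (Rabs (Series (fun j => Im (a j))) <= Series b).
  { apply Series_bound; auto.
    intros j; eapply Rle_trans; [apply Rabs_Im_le|apply H]. }
  lra.
Qed.

Lemma CSeries_ext (a b : nat -> C) : (forall j, a j = b j) -> CSeries a = CSeries b.
Proof. intros H; unfold CSeries; f_equal; apply Series_ext; intros j; now rewrite H. Qed.

Lemma abs_summable_bound (a : nat -> C) (b : nat -> R) :
  (forall j, Cmod (a j) <= b j) -> ex_series b -> abs_summable a.
Proof.
  intros H; apply ex_series_bound. intros j.
  rewrite Rabs_pos_eq by apply Cmod_ge_0. apply H.
Qed.

Lemma CSeries_lin (x y : C) (a b : nat -> C) :
  abs_summable a -> abs_summable b ->
  CSeries (fun j => x * a j + y * b j)%C = (x * CSeries a + y * CSeries b)%C.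
Proof.
  intros Ha Hb.
  pose proof (abs_summable_Re a Ha). pose proof (abs_summable_Im a Ha).
  pose proof (abs_summable_Re b Hb). pose proof (abs_summable_Im b Hb).
  apply C_ext.
  - transitivity (Series (fun j => 1 * (Re x * Re (a j) + - Im x * Im (a j))
       + 1 * (Re y * Re (b j) + - Im y * Im (b j)))).
    + apply Series_ext; intros j; unfold Re, Im; simpl; ring.
    + rewrite !Series_lin; auto; try (apply ex_series_add; now apply ex_series_scal_l).
      unfold CSeries, Re, Im; simpl. ring.
  - transitivity (Series (fun j => 1 * (Im x * Re (a j) + Re x * Im (a j))
       + 1 * (Im y * Re (b j) + Re y * Im (b j)))).
    + apply Series_ext; intros j; unfold Re, Im; simpl; ring.
    + rewrite !Series_lin; auto; try (apply ex_series_add; now apply ex_series_scal_l).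
      unfold CSeries, Re, Im; simpl. ring.
Qed.

Lemma CSeries_scal (x : C) (a : nat -> C) :
  abs_summable a -> CSeries (fun j => x * a j)%C = (x * CSeries a)%C.
Proof.
  intros Ha. transitivity (CSeries (fun j => x * a j + 0 * a j)%C).
  - apply CSeries_ext; intros j; ring.
  - rewrite CSeries_lin by assumption. ring.
Qed.

Lemma ex_series_tail (a : nat -> R) (n : nat) : ex_series a -> ex_series (tail 0 n a).
Proof.
  revert a; induction n as [|n IH]; intros a Ha.
  - exact Ha.
  - apply ex_series_incr_1. apply (ex_series_ext (tail 0 n (fun j => a (S j)))).
    + reflexivity.
    + apply IH. now apply (ex_series_incr_1 a).
Qed.

Lemma Series_tail_step (n : nat) : forall a : nat -> R, ex_series a ->
  Series (tail 0 n a) = a n + Series (tail 0 (S n) a).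
Proof.
  induction n as [|n IH]; intros a Ha.
  - rewrite (Series_incr_1 (tail 0 0 a)) by now apply ex_series_tail.
    rewrite (Series_incr_1 (tail 0 1 a)) by now apply ex_series_tail.
    unfold tail at 1 3; simpl. f_equal.
    rewrite Rplus_0_l. reflexivity.
  - rewrite (Series_incr_1 (tail 0 (S n) a)) by now apply ex_series_tail.
    rewrite (Series_incr_1 (tail 0 (S (S n)) a)) by now apply ex_series_tail.
    unfold tail at 1 3; simpl. rewrite !Rplus_0_l.
    apply (IH (fun j => a (S j))). now apply (ex_series_incr_1 a).
Qed.

Lemma Series_tail_lim (a : nat -> R) :
  ex_series a -> is_lim_seq (fun n => Series (tail 0 n a)) 0.
Proof.
  intros Ha. apply is_lim_seq_incr_1.
  apply (is_lim_seq_ext (fun n => Series a - sum_n a n)).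
  - intros n; induction n as [|n IH].
    + rewrite sum_O. change (Series a) with (Series (tail 0 0 a)).
      rewrite (Series_tail_step 0) by assumption. ring.
    + rewrite sum_Sn. unfold plus; simpl.
      rewrite (Series_tail_step (S n)) in IH by assumption. lra.
  - replace (Finite 0) with (Finite (Series a - Series a)) by (f_equal; ring).
    apply is_lim_seq_minus'; [apply is_lim_seq_const|].
    now apply Series_correct.
Qed.

Lemma tail_comp {A B : Type} (f : A -> B) (z : A) (w : B) (n : nat) (a : nat -> A) (j : nat) :
  f z = w -> f (tail z n a j) = tail w n (fun j => f (a j)) j.
Proof. intros H. unfold tail; destruct (Nat.ltb j n); auto. Qed.

Lemma abs_summable_tail (a : nat -> C) (n : nat) :
  abs_summable a -> abs_summable (tail (RtoC 0) n a).
Proof.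
  intros Ha. apply (abs_summable_bound _ (tail 0 n (fun j => Cmod (a j)))).
  - intros j. rewrite (tail_comp Cmod _ 0); [apply Rle_refl|apply Cmod_0].
  - now apply ex_series_tail.
Qed.

Lemma CSeries_tail_step (a : nat -> C) (n : nat) : abs_summable a ->
  CSeries (tail (RtoC 0) n a) = (a n + CSeries (tail (RtoC 0) (S n) a))%C.
Proof.
  intros Ha.
  assert (E : forall n, CSeries (tail (RtoC 0) n a)
    = (Series (tail 0 n (fun j => Re (a j))), Series (tail 0 n (fun j => Im (a j))))).
  { intros k; unfold CSeries; f_equal; apply Series_ext; intros j.
    - now apply (tail_comp Re).
    - now apply (tail_comp Im). }
  rewrite !E. apply C_ext; simpl; apply Series_tail_step.
  - now apply abs_summable_Re.
  - now apply abs_summable_Im.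
Qed.

(** The difference between [L n] and the [n]-th remainder of the series does
    not depend on [n], and it tends to zero. *)
Lemma CSeries_telescope (t : nat -> C) (L : nat -> C) (r : nat -> R) :
  abs_summable t ->
  (forall n, L n = (t n + L (S n))%C) ->
  (forall n, Cmod (L n) <= r n) -> is_lim_seq r 0 ->
  L 0%nat = CSeries t.
Proof.
  intros Ht HL Hr Hlim.
  assert (E : forall n, (L 0%nat - CSeries t)%C
     = (L n - CSeries (tail (RtoC 0) n t))%C).
  { induction n as [|n IH]; [reflexivity|].
    rewrite IH, HL, (CSeries_tail_step t n) by assumption. ring. }
  apply Ceq_minus, Cmod_eq_0.
  apply Rle_antisym; [|apply Cmod_ge_0].
  assert (H : Rbar_le (Cmod (L 0%nat - CSeries t)) (0 + 2 * 0)).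
  { apply (is_lim_seq_le (fun _ => Cmod (L 0%nat - CSeries t))
      (fun n => r n + 2 * Series (tail 0 n (fun j => Cmod (t j))))).
    - intros n. rewrite (E n).
      eapply Rle_trans; [apply Cmod_triangle|]. rewrite Cmod_opp.
      apply Rplus_le_compat; [apply Hr|].
      apply CSeries_bound; [|now apply ex_series_tail].
      intros j. rewrite (tail_comp Cmod _ 0); [apply Rle_refl|apply Cmod_0].
    - apply is_lim_seq_const.
    - apply is_lim_seq_plus'; [exact Hlim|].
      apply (is_lim_seq_scal_l _ 2 0). now apply Series_tail_lim. }
  simpl in H. lra.
Qed.

(** Comparison with twice the telescoping series of [1 / (j + 1) - 1 / (j +
    2)]. *)
Lemma ex_series_inv_sq : ex_series (fun j => / (INR j + 1) ^ 2).
Proof.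
  apply (ex_series_bound _ (fun j => 2 * (/ (INR j + 1) - / (INR (S j) + 1)))).
  - intros j. pose proof (pos_INR j). rewrite S_INR.
    assert (0 < (INR j + 1) ^ 2) by (apply pow_lt; lra).
    rewrite Rabs_pos_eq by (left; now apply Rinv_0_lt_compat).
    replace (/ (INR j + 1) - / (INR j + 1 + 1)) with
      (/ ((INR j + 1) * (INR j + 1 + 1))) by (field; lra).
    replace (2 * / ((INR j + 1) * (INR j + 1 + 1))) with
      (/ ((INR j + 1) * (INR j + 1 + 1) / 2)) by (field; lra).
    apply Rinv_le_contravar; nra.
  - apply ex_series_scal_l. exists 1. unfold is_series.
    change (is_lim_seq (sum_n (fun j => / (INR j + 1) - / (INR (S j) + 1))) 1).
    apply (is_lim_seq_ext (fun n => 1 - / (INR (S n) + 1))).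
    + intros n; induction n as [|n IH].
      * rewrite sum_O. simpl. field.
      * rewrite sum_Sn, <- IH. unfold plus; simpl. ring.
    + replace (Finite 1) with (Finite (1 - 0)) by (f_equal; ring).
      apply is_lim_seq_minus'; [apply is_lim_seq_const|].
      apply (is_lim_seq_inv (fun n => INR (S n) + 1) p_infty); [|easy].
      apply (is_lim_seq_plus _ _ p_infty 1).
      * apply (is_lim_seq_incr_1 INR), is_lim_seq_INR.
      * apply is_lim_seq_const.
      * reflexivity.
Qed.

(** A quadratic bound on the remainder, unlike the convergence of difference
    quotients, can be summed over the terms of a series. *)
Lemma is_derive_quadratic (f : R -> R) (t l M : R) :
  (forall s, Rabs (f (t + s) - f t - s * l) <= M * s ^ 2) -> is_derive f t l.
Proof.
  intros H. apply is_derive_Reals. intros e He.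
  assert (HM : 0 <= M).
  { specialize (H 1). pose proof (Rabs_pos (f (t + 1) - f t - 1 * l)). lra. }
  assert (Hd : 0 < e / (M + 1)) by (apply Rdiv_lt_0_compat; lra).
  exists (mkposreal _ Hd). intros s Hs0 Hs. simpl in Hs.
  replace ((f (t + s) - f t) / s - l) with ((f (t + s) - f t - s * l) / s)
    by (field; assumption).
  assert (Ps : 0 < Rabs s) by now apply Rabs_pos_lt.
  rewrite Rabs_div by assumption.
  apply Rmult_lt_reg_r with (Rabs s); [assumption|].
  unfold Rdiv; rewrite Rmult_assoc, Rinv_l, Rmult_1_r by lra.
  eapply Rle_lt_trans; [apply H|].
  rewrite <- (pow2_abs s).
  apply Rmult_lt_compat_r with (r := M + 1) in Hs; [|lra].
  unfold Rdiv in Hs; rewrite Rmult_assoc, Rinv_l, Rmult_1_r in Hs by lra.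
  nra.
Qed.

Lemma is_derive_Series (f f' : R -> nat -> R) (M : nat -> R) (t : R) :
  (forall t, ex_series (f t)) -> ex_series (f' t) -> ex_series M ->
  (forall s j, Rabs (f (t + s) j - f t j - s * f' t j) <= M j * s ^ 2) ->
  is_derive (fun t => Series (f t)) t (Series (f' t)).
Proof.
  intros Hf Hf' HM H. apply (is_derive_quadratic _ _ _ (Series M)).
  intros s.
  replace (Series (f (t + s)) - Series (f t) - s * Series (f' t))
    with (Series (fun j => f (t + s) j - f t j - s * f' t j)).
  - rewrite <- Series_scal_r. apply Series_bound; [apply H|].
    apply (ex_series_ext (fun j => s ^ 2 * M j)).
    + intros j; apply Rmult_comm.
    + now apply ex_series_scal_l.
  - transitivity (Series (fun j => 1 * (1 * f (t + s) j + (-1) * f t j) + (- s) * f' t j)).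
    + apply Series_ext; intros j; ring.
    + rewrite !Series_lin; auto; try (apply ex_series_add; now apply ex_series_scal_l).
      ring.
Qed.

(** * Characters of the torus and trigonometric series *)

Definition phase (k : Z * Z) (p : R * R) : R :=
  IZR (fst k) * fst p + IZR (snd k) * snd p.

Definition expi (k : Z * Z) : Fn := fun p => (cos (phase k p), sin (phase k p)).

Definition kadd (k l : Z * Z) : Z * Z := (fst k + fst l, snd k + snd l)%Z.
Definition kopp (k : Z * Z) : Z * Z := (- fst k, - snd k)%Z.

Definition knorm (k : Z * Z) : R := Rmax (Rabs (IZR (fst k))) (Rabs (IZR (snd k))).

Lemma knorm_pos (k : Z * Z) : 0 <= knorm k.
Proof. eapply Rle_trans; [apply Rabs_pos|apply Rmax_l]. Qed.

Lemma prj_le_knorm (b : bool) (k : Z * Z) : Rabs (IZR (prj b k)) <= knorm k.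
Proof. destruct b; [apply Rmax_l|apply Rmax_r]. Qed.

Lemma knorm_prj (k : Z * Z) : exists b, knorm k = Rabs (IZR (prj b k)).
Proof.
  unfold knorm, Rmax. destruct Rle_dec; [exists false|exists true]; reflexivity.
Qed.

Lemma knorm_opp (k : Z * Z) : knorm (kopp k) = knorm k.
Proof. unfold knorm, kopp; simpl. now rewrite !opp_IZR, !Rabs_Ropp. Qed.

Lemma kopp_kopp (k : Z * Z) : kopp (kopp k) = k.
Proof. destruct k as [k1 k2]; unfold kopp; simpl; f_equal; lia. Qed.

Lemma Cmod_expi (k : Z * Z) (p : R * R) : Cmod (expi k p) = 1.
Proof.
  unfold expi, Cmod; simpl. rewrite !Rmult_1_r.
  replace (cos (phase k p) * cos (phase k p) + sin (phase k p) * sin (phase k p))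
    with 1 by (generalize (sin2_cos2 (phase k p)); unfold Rsqr; lra).
  apply sqrt_1.
Qed.

Lemma expi_add (k l : Z * Z) (p : R * R) : (expi k p * expi l p)%C = expi (kadd k l) p.
Proof.
  unfold expi. replace (phase (kadd k l) p) with (phase k p + phase l p).
  - apply C_ext; unfold Re, Im; simpl; [rewrite cos_plus|rewrite sin_plus]; ring.
  - unfold phase, kadd; simpl. rewrite !plus_IZR. ring.
Qed.

Lemma expi_0 (p : R * R) : expi (0, 0)%Z p = 1.
Proof.
  unfold expi. replace (phase _ p) with 0 by (unfold phase; simpl; ring).
  rewrite cos_0, sin_0. reflexivity.
Qed.

Lemma sincos_period (k : Z) (x : R) :
  cos (x + IZR k * (2 * PI)) = cos x /\ sin (x + IZR k * (2 * PI)) = sin x.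
Proof.
  assert (H : forall n : nat, forall x, cos (x + INR n * (2 * PI)) = cos x /\
            sin (x + INR n * (2 * PI)) = sin x).
  { intros n y. replace (y + INR n * (2 * PI)) with (y + 2 * INR n * PI) by ring.
    split; [apply cos_period|apply sin_period]. }
  destruct (Z.le_ge_cases 0 k) as [Hk|Hk].
  - rewrite <- (Z2Nat.id k), <- INR_IZR_INZ by assumption. apply H.
  - destruct (H (Z.to_nat (- k)) (x + IZR k * (2 * PI))) as [A B].
    assert (E : x + IZR k * (2 * PI) + INR (Z.to_nat (- k)) * (2 * PI) = x).
    { rewrite INR_IZR_INZ, Z2Nat.id, opp_IZR by lia. ring. }
    rewrite E in A, B. auto.
Qed.

Lemma periodic_expi (k : Z * Z) : periodic (expi k).
Proof.
  intros x y. unfold expi. split.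
  - replace (phase k (x + 2 * PI, y)) with (phase k (x, y) + IZR (fst k) * (2 * PI))
      by (unfold phase; simpl; ring).
    destruct (sincos_period (fst k) (phase k (x, y))) as [-> ->]. reflexivity.
  - replace (phase k (x, y + 2 * PI)) with (phase k (x, y) + IZR (snd k) * (2 * PI))
      by (unfold phase; simpl; ring).
    destruct (sincos_period (snd k) (phase k (x, y))) as [-> ->]. reflexivity.
Qed.

Lemma Rabs_sin_le (x : R) : Rabs (sin x) <= Rabs x.
Proof.
  pose proof (bounded_variation sin cos 1 0 x) as H.
  rewrite sin_0, !Rminus_0_r, Rmult_1_l in H. apply H.
  intros t _. split; [apply is_derive_sin|].
  apply Rabs_le; generalize (COS_bound t); lra.
Qed.

Lemma Rabs_cos1_le (x : R) : Rabs (cos x - 1) <= Rabs x.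
Proof.
  pose proof (bounded_variation cos (fun t => - sin t) 1 0 x) as H.
  rewrite cos_0, !Rminus_0_r, Rmult_1_l in H. apply H.
  intros t _. split; [apply is_derive_cos|].
  apply Rabs_le; generalize (SIN_bound t); lra.
Qed.

Lemma Rabs_cos1_sq (x : R) : Rabs (cos x - 1) <= x ^ 2.
Proof.
  pose proof (bounded_variation cos (fun t => - sin t) (Rabs x) 0 x) as H.
  rewrite cos_0, !Rminus_0_r in H. rewrite <- pow2_abs. simpl; rewrite Rmult_1_r.
  apply H. intros t Ht. rewrite Rminus_0_r in Ht. split; [apply is_derive_cos|].
  rewrite Rabs_Ropp. eapply Rle_trans; [apply Rabs_sin_le|exact Ht].
Qed.

Lemma Rabs_sin_sq (x : R) : Rabs (sin x - x) <= x ^ 2.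
Proof.
  pose proof (bounded_variation (fun t => sin t - t) (fun t => cos t - 1) (Rabs x) 0 x) as H.
  cbv beta in H. rewrite sin_0, !Rminus_0_r in H. rewrite <- pow2_abs. simpl; rewrite Rmult_1_r.
  apply H. intros t Ht. rewrite Rminus_0_r in Ht. split.
  - apply (is_derive_minus sin (fun t => t)); [apply is_derive_sin|].
    apply (is_derive_id (K := R_AbsRing)).
  - eapply Rle_trans; [apply Rabs_cos1_le|exact Ht].
Qed.

Definition shift (b : bool) (s : R) (p : R * R) : R * R :=
  if b then (fst p + s, snd p) else (fst p, snd p + s).

Lemma phase_shift (b : bool) (k : Z * Z) (s : R) (p : R * R) :
  phase k (shift b s p) = phase k p + IZR (prj b k) * s.
Proof. destruct b; unfold phase, shift; simpl; ring. Qed.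

Lemma expi_shift (b : bool) (k : Z * Z) (s : R) (p : R * R) :
  expi k (shift b s p)
  = (expi k p * (cos (IZR (prj b k) * s), sin (IZR (prj b k) * s)))%C.
Proof.
  unfold expi. rewrite phase_shift.
  apply C_ext; unfold Re, Im; simpl; [rewrite cos_plus|rewrite sin_plus]; ring.
Qed.

(** Shifting the argument multiplies the character by [exp (i x s)], so the
    remainder is that of [exp] at the origin. *)
Lemma expi_taylor (b : bool) (k : Z * Z) (s : R) (p : R * R) :
  Cmod (expi k (shift b s p) - expi k p - RtoC s * (Ci * IZR (prj b k) * expi k p))
  <= 2 * (IZR (prj b k)) ^ 2 * s ^ 2.
Proof.
  rewrite expi_shift. set (x := IZR (prj b k)).
  replace (expi k p * (cos (x * s), sin (x * s)) - expi k p - RtoC s * (Ci * x * expi k p))%C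
    with (expi k p * ((cos (x * s) - 1)%R, (sin (x * s) - x * s)%R))%C.
  - rewrite Cmod_mult, Cmod_expi, Rmult_1_l.
    eapply Rle_trans; [apply Cmod_le_sum|]. simpl Re; simpl Im.
    pose proof (Rabs_cos1_sq (x * s)). pose proof (Rabs_sin_sq (x * s)).
    rewrite Rpow_mult_distr in *. lra.
  - apply C_ext; unfold Re, Im; simpl; ring.
Qed.

Lemma expi_lipschitz (k : Z * Z) (p q : R * R) :
  Cmod (expi k q - expi k p) <= 2 * (knorm k * (Rabs (fst q - fst p) + Rabs (snd q - snd p))).
Proof.
  set (d := phase k q - phase k p).
  replace (expi k q - expi k p)%C with (expi k p * ((cos d - 1)%R, sin d))%C.
  - rewrite Cmod_mult, Cmod_expi, Rmult_1_l.
    eapply Rle_trans; [apply Cmod_le_sum|]. simpl Re; simpl Im.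
    pose proof (Rabs_cos1_le d). pose proof (Rabs_sin_le d).
    assert (Rabs d <= knorm k * (Rabs (fst q - fst p) + Rabs (snd q - snd p))).
    { replace d with (IZR (fst k) * (fst q - fst p) + IZR (snd k) * (snd q - snd p))
        by (unfold d, phase; ring).
      eapply Rle_trans; [apply Rabs_triang|]. rewrite !Rabs_mult.
      rewrite Rmult_plus_distr_l.
      apply Rplus_le_compat; apply Rmult_le_compat_r; try apply Rabs_pos.
      - apply (prj_le_knorm true).
      - apply (prj_le_knorm false). }
    lra.
  - assert (E : phase k q = phase k p + d) by (unfold d; ring).
    unfold expi; rewrite E.
    apply C_ext; unfold Re, Im; simpl; [rewrite cos_plus|rewrite sin_plus]; ring.
Qed.

(** The frequencies are an arbitrary sequence [q], so that the same facts
    serve an enumeration of the lattice and its reflection. *)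
Definition trig (q : nat -> Z * Z) (c : nat -> C) : Fn :=
  fun p => CSeries (fun j => c j * expi (q j) p)%C.

Definition rapid (q : nat -> Z * Z) (c : nat -> C) : Prop :=
  forall n : nat, ex_series (fun j => Cmod (c j) * (1 + knorm (q j)) ^ n).

(** What one derivative in direction [b] does to the coefficients of a
    series. *)
Definition mul_freq (b : bool) (q : nat -> Z * Z) (c : nat -> C) : nat -> C :=
  fun j => (RtoC (IZR (prj b (q j))) * c j)%C.

Lemma rapid_summable (q : nat -> Z * Z) (c : nat -> C) : rapid q c -> abs_summable c.
Proof.
  intros H. apply (ex_series_ext (fun j => Cmod (c j) * (1 + knorm (q j)) ^ 0)).
  - intros j; simpl; apply Rmult_1_r.
  - apply H.
Qed.

Lemma summable_trig (q : nat -> Z * Z) (c : nat -> C) (p : R * R) :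
  abs_summable c -> abs_summable (fun j => c j * expi (q j) p)%C.
Proof.
  apply abs_summable_bound. intros j. rewrite Cmod_mult, Cmod_expi. lra.
Qed.

Lemma rapid_mul_freq (b : bool) (q : nat -> Z * Z) (c : nat -> C) :
  rapid q c -> rapid q (mul_freq b q c).
Proof.
  intros H n.
  apply (ex_series_bound _ (fun j => Cmod (c j) * (1 + knorm (q j)) ^ (S n))); [|apply H].
  intros j. unfold mul_freq. rewrite Cmod_mult, Cmod_R.
  pose proof (prj_le_knorm b (q j)). pose proof (knorm_pos (q j)).
  pose proof (Cmod_ge_0 (c j)). pose proof (Rabs_pos (IZR (prj b (q j)))).
  assert (0 <= (1 + knorm (q j)) ^ n) by (apply pow_le; lra).
  rewrite Rabs_pos_eq.
  - simpl. replace (Cmod (c j) * ((1 + knorm (q j)) * (1 + knorm (q j)) ^ n))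
      with ((1 + knorm (q j)) * Cmod (c j) * (1 + knorm (q j)) ^ n) by ring.
    apply Rmult_le_compat_r; auto. apply Rmult_le_compat_r; lra.
  - repeat apply Rmult_le_pos; auto.
Qed.

Lemma rapid_scal (a : C) (q : nat -> Z * Z) (c : nat -> C) :
  rapid q c -> rapid q (fun j => a * c j)%C.
Proof.
  intros H n. apply (ex_series_ext (fun j => Cmod a * (Cmod (c j) * (1 + knorm (q j)) ^ n))).
  - intros j. rewrite Cmod_mult. symmetry. apply Rmult_assoc.
  - apply ex_series_scal_l, H.
Qed.

Lemma rapid_tail (q : nat -> Z * Z) (c : nat -> C) (n : nat) :
  rapid q c -> rapid q (tail (RtoC 0) n c).
Proof.
  intros H m. eapply ex_series_bound; [|apply (H m)].
  intros j. pose proof (knorm_pos (q j)). pose proof (Cmod_ge_0 (c j)).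
  assert (0 <= (1 + knorm (q j)) ^ m) by (apply pow_le; lra).
  unfold tail; destruct (Nat.ltb j n).
  - rewrite Cmod_0, Rmult_0_l, Rabs_R0. now apply Rmult_le_pos.
  - rewrite Rabs_pos_eq; [apply Rle_refl|now apply Rmult_le_pos].
Qed.

(** A rapidly decaying series is Lipschitz, because each character is, with
    constant proportional to its frequency. *)
Lemma continuous_trig (q : nat -> Z * Z) (c : nat -> C) :
  rapid q c -> continuous_Fn (trig q c).
Proof.
  intros H. pose proof (rapid_summable _ _ H) as H0.
  set (K := Series (fun j => Cmod (c j) * (1 + knorm (q j)) ^ 1)).
  assert (HL : forall p p', Cmod (trig q c p' - trig q c p)
     <= 4 * K * (Rabs (fst p' - fst p) + Rabs (snd p' - snd p))).
  { intros p p'. set (d := Rabs (fst p' - fst p) + Rabs (snd p' - snd p)).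
    assert (Hd : 0 <= d) by (unfold d; generalize (Rabs_pos (fst p' - fst p))
       (Rabs_pos (snd p' - snd p)); lra).
    unfold trig.
    replace (CSeries (fun j => c j * expi (q j) p') - CSeries (fun j => c j * expi (q j) p))%C
     with (CSeries (fun j => 1 * (c j * expi (q j) p') + (- (1)) * (c j * expi (q j) p)))%C.
    2: { rewrite CSeries_lin by now apply summable_trig. ring. }
    replace (4 * K * d) with (2 * Series (fun j => 2 * d * (Cmod (c j) * (1 + knorm (q j)) ^ 1))).
    2: { rewrite Series_scal_l. fold K. ring. }
    apply CSeries_bound; [|now apply ex_series_scal_l].
    intros j.
    replace (1 * (c j * expi (q j) p') + (- (1)) * (c j * expi (q j) p))%C
      with (c j * (expi (q j) p' - expi (q j) p))%C by ring.
    rewrite Cmod_mult.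
    pose proof (expi_lipschitz (q j) p p') as Hl. fold d in Hl.
    pose proof (knorm_pos (q j)). pose proof (Cmod_ge_0 (c j)).
    replace (2 * d * (Cmod (c j) * (1 + knorm (q j)) ^ 1)) with
      (Cmod (c j) * (2 * ((1 + knorm (q j)) * d))) by (simpl; ring).
    apply Rmult_le_compat_l; auto. nra. }
  assert (HK : 0 <= K).
  { pose proof (HL (0, 0) (1, 0)) as A. simpl in A.
    pose proof (Cmod_ge_0 (trig q c (1, 0) - trig q c (0, 0))).
    replace (1 - 0) with 1 in A by ring. rewrite Rminus_0_r, Rabs_R0, Rabs_R1 in A. lra. }
  assert (Hlip : forall F : C -> R, (forall z w, Rabs (F z - F w) <= Cmod (z - w)) ->
     cont (fun p => F (trig q c p))).
  { intros F HF p P [eps HP].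
    assert (Hd : 0 < eps / (8 * K + 1)).
    { apply Rdiv_lt_0_compat; [apply cond_pos|lra]. }
    exists (mkposreal _ Hd). intros p' [B1 B2]. simpl in B1, B2.
    apply HP. simpl. unfold AbsRing_ball, abs, minus, plus, opp in *; simpl in *.
    eapply Rle_lt_trans; [apply HF|].
    eapply Rle_lt_trans; [apply HL|].
    unfold Rminus in *.
    set (dd := eps / (8 * K + 1)) in *.
    assert (Hdd : dd * (8 * K + 1) = eps) by (unfold dd; field; lra).
    pose proof (Rmult_le_compat_l K _ _ HK (Rlt_le _ _ B1)).
    pose proof (Rmult_le_compat_l K _ _ HK (Rlt_le _ _ B2)).
    assert (0 < dd) by exact Hd.
    unfold abs, minus, plus, opp in *; simpl in *. lra. }
  apply continuous_Fn_ReIm; split; apply Hlip; intros z w.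
  - eapply Rle_trans; [|apply (Rabs_Re_le (z - w))]. apply Rle_refl.
  - eapply Rle_trans; [|apply (Rabs_Im_le (z - w))]. apply Rle_refl.
Qed.

Lemma slice_shift (b : bool) (f : Fn) (p : R * R) (t : R) :
  slice b f p t = f (shift b (t - prj b p) p).
Proof. destruct b, p; unfold slice, shift; simpl; do 2 f_equal; ring. Qed.

Lemma shift_shift (b : bool) (p : R * R) (t s : R) :
  shift b s (shift b t p) = shift b (t + s) p.
Proof. destruct b, p; unfold shift; simpl; f_equal; ring. Qed.

Lemma shift_0 (b : bool) (p : R * R) (t : R) : shift b (prj b p - prj b p) p = p.
Proof. destruct b, p; unfold shift; simpl; f_equal; ring. Qed.

(** Taylor remainders of the characters add up to a quadratic remainder with
    summable constants, hence termwise differentiation is legitimate. *)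
Lemma has_partial_trig (b : bool) (q : nat -> Z * Z) (c : nat -> C) (p : R * R) :
  rapid q c -> has_partial b (trig q c) p (Ci * trig q (mul_freq b q c) p)%C.
Proof.
  intros H. pose proof (rapid_summable _ _ H) as H0.
  pose proof (rapid_mul_freq b _ _ H) as H1.
  pose proof (rapid_summable _ _ H1) as H1s.
  set (g := fun j (p : R * R) => (c j * expi (q j) p)%C).
  set (g' := fun j (p : R * R) => (Ci * (mul_freq b q c j * expi (q j) p))%C).
  assert (Hg' : abs_summable (fun j => g' j p)).
  { unfold g'. apply (abs_summable_bound _ (fun j => Cmod (mul_freq b q c j))); auto.
    intros j. rewrite !Cmod_mult, Cmod_Ci, Cmod_expi. lra. }
  assert (HM : ex_series (fun j => 2 * (Cmod (c j) * (1 + knorm (q j)) ^ 2))).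
  { apply ex_series_scal_l, H. }
  assert (HT : forall j s t, Cmod (g j (shift b (t + s) p) - g j (shift b t p)
      - RtoC s * g' j (shift b t p))
      <= 2 * (Cmod (c j) * (1 + knorm (q j)) ^ 2) * s ^ 2).
  { intros j s t. unfold g, g', mul_freq. rewrite <- shift_shift.
    set (p' := shift b t p).
    match goal with |- Cmod ?z <= _ => replace z with (c j *
       (expi (q j) (shift b s p') - expi (q j) p' - RtoC s * (Ci * IZR (prj b (q j)) * expi (q j) p')))%C
       by ring end.
    rewrite Cmod_mult.
    replace (2 * (Cmod (c j) * (1 + knorm (q j)) ^ 2) * s ^ 2)
      with (Cmod (c j) * (2 * (1 + knorm (q j)) ^ 2 * s ^ 2)) by ring.
    apply Rmult_le_compat_l; [apply Cmod_ge_0|].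
    eapply Rle_trans; [apply expi_taylor|].
    apply Rmult_le_compat_r; [apply pow2_ge_0|].
    apply Rmult_le_compat_l; [lra|].
    rewrite <- pow2_abs. apply pow_incr. split; [apply Rabs_pos|].
    pose proof (prj_le_knorm b (q j)). lra. }
  assert (E : (Ci * trig q (mul_freq b q c) p)%C = CSeries (fun j => g' j p)).
  { unfold g', trig. rewrite CSeries_scal; auto. now apply summable_trig. }
  rewrite E.
  assert (G : forall F : C -> R,
    (forall z w, F (z - w)%C = F z - F w) ->
    (forall (s : R) z, F (RtoC s * z)%C = s * F z) ->
    (forall z, Rabs (F z) <= Cmod z) ->
    is_derive (fun t => Series (fun j => F (g j (shift b (t - prj b p) p)))) (prj b p)
       (Series (fun j => F (g' j p)))).
  { intros F Fm Fs Fb.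
    apply (is_derive_Series (fun t j => F (g j (shift b (t - prj b p) p)))
        (fun t j => F (g' j (shift b (t - prj b p) p)))
        (fun j => 2 * (Cmod (c j) * (1 + knorm (q j)) ^ 2)) (prj b p)) in HM as HD.
    - rewrite shift_0 in HD by exact 0. exact HD.
    - intros t. eapply ex_series_bound; [intros j; apply Fb|].
      now apply summable_trig.
    - eapply ex_series_bound; [intros j; apply Fb|].
      rewrite shift_0 by exact 0. exact Hg'.
    - intros s j. rewrite <- Fs, <- !Fm. eapply Rle_trans; [apply Fb|].
      replace (prj b p + s - prj b p) with ((prj b p - prj b p) + s) by ring.
      apply HT. }
  split.
  - apply (is_derive_ext (fun t => Series (fun j => Re (g j (shift b (t - prj b p) p))))).
    + intros t. rewrite slice_shift. reflexivity.
    + apply (G Re).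
      * reflexivity.
      * intros; apply re_scal_l.
      * apply Rabs_Re_le.
  - apply (is_derive_ext (fun t => Series (fun j => Im (g j (shift b (t - prj b p) p))))).
    + intros t. rewrite slice_shift. reflexivity.
    + apply (G Im).
      * reflexivity.
      * intros; apply im_scal_l.
      * apply Rabs_Im_le.
Qed.

Lemma periodic_trig (q : nat -> Z * Z) (c : nat -> C) : periodic (trig q c).
Proof.
  intros x y. split; apply CSeries_ext; intros j; f_equal; apply periodic_expi.
Qed.

Lemma trig_scal (a : C) (q : nat -> Z * Z) (c : nat -> C) (p : R * R) :
  abs_summable c -> trig q (fun j => a * c j)%C p = (a * trig q c p)%C.
Proof.
  intros H. unfold trig. rewrite <- CSeries_scal by now apply summable_trig.
  apply CSeries_ext; intros j; ring.
Qed.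

(** Derivatives of the series are series of the same kind, so smoothness
    follows by induction on the order. *)
Lemma Ck_trig (k : nat) : forall (q : nat -> Z * Z) (c : nat -> C),
  rapid q c -> Ck k (trig q c).
Proof.
  induction k as [|k IH]; intros q c H.
  - now apply continuous_trig.
  - apply (Ck_step k _ (fun b => trig q (fun j => Ci * mul_freq b q c j)%C)).
    + now apply continuous_trig.
    + intros b p. rewrite trig_scal by now apply (rapid_summable q), rapid_mul_freq.
      now apply has_partial_trig.
    + intros b. now apply IH, rapid_scal, rapid_mul_freq.
Qed.

Lemma smooth_trig (q : nat -> Z * Z) (c : nat -> C) :
  rapid q c -> smooth_torus (trig q c).
Proof. intros H; split; [apply periodic_trig|]. intros k; now apply Ck_trig. Qed.

Lemma Ddir_trig (b : bool) (q : nat -> Z * Z) (c : nat -> C) :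
  rapid q c -> Ddir b (trig q c) = trig q (mul_freq b q c).
Proof. intros H. apply Ddir_eq. intros p. now apply has_partial_trig. Qed.

Lemma iter_Ddir_trig (b : bool) (q : nat -> Z * Z) (c : nat -> C) (n : nat) :
  rapid q c -> Nat.iter n (Ddir b) (trig q c) = trig q (Nat.iter n (mul_freq b q) c)
    /\ rapid q (Nat.iter n (mul_freq b q) c).
Proof.
  intros H. induction n as [|n [IH1 IH2]]; simpl; auto.
  rewrite IH1. split; [now apply Ddir_trig|now apply rapid_mul_freq].
Qed.

Lemma Cmod_iter_mul_freq (b : bool) (q : nat -> Z * Z) (c : nat -> C) (n j : nat) :
  Cmod (Nat.iter n (mul_freq b q) c j) <= Cmod (c j) * knorm (q j) ^ n.
Proof.
  induction n as [|n IH]; simpl; [lra|].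
  unfold mul_freq at 1. rewrite Cmod_mult, Cmod_R.
  pose proof (prj_le_knorm b (q j)). pose proof (Rabs_pos (IZR (prj b (q j)))).
  pose proof (Cmod_ge_0 (Nat.iter n (mul_freq b q) c j)).
  replace (Cmod (c j) * (knorm (q j) * knorm (q j) ^ n))
    with (knorm (q j) * (Cmod (c j) * knorm (q j) ^ n)) by ring.
  apply Rmult_le_compat; auto.
Qed.

Lemma Dmulti_trig_bound (g : nat * nat) (q : nat -> Z * Z) (c : nat -> C)
    (b : nat -> R) (p : R * R) :
  rapid q c -> ex_series b ->
  (forall j, Cmod (c j) * knorm (q j) ^ order g <= b j) ->
  Cmod (Dmulti g (trig q c) p) <= 2 * Series b.
Proof.
  intros H Hb Hle. rewrite Dmulti_iter.
  destruct (iter_Ddir_trig false q c (snd g) H) as [E2 H2]. rewrite E2.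
  destruct (iter_Ddir_trig true q _ (fst g) H2) as [E1 H1]. rewrite E1.
  apply CSeries_bound; auto. intros j. rewrite Cmod_mult, Cmod_expi, Rmult_1_r.
  eapply Rle_trans; [apply Cmod_iter_mul_freq|].
  eapply Rle_trans; [apply Rmult_le_compat_r; [apply pow_le, knorm_pos|
    apply Cmod_iter_mul_freq]|].
  eapply Rle_trans; [|apply Hle]. unfold order. rewrite pow_add. right; ring.
Qed.

Lemma trig_tail_step (q : nat -> Z * Z) (c : nat -> C) (n : nat) : abs_summable c ->
  trig q (tail (RtoC 0) n c)
  = lin_comb (c n) (expi (q n)) 1 (trig q (tail (RtoC 0) (S n) c)).
Proof.
  intros H. apply functional_extensionality; intros p. unfold lin_comb, trig.
  assert (E : forall n, CSeries (fun j => tail (RtoC 0) n c j * expi (q j) p)%C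
     = CSeries (tail (RtoC 0) n (fun j => c j * expi (q j) p)%C)).
  { intros m; apply CSeries_ext; intros j; unfold tail.
    destruct (Nat.ltb j m); ring. }
  rewrite !E, CSeries_tail_step by now apply summable_trig. ring.
Qed.

Lemma trig_bound (q : nat -> Z * Z) (c : nat -> C) (p : R * R) :
  abs_summable c -> Cmod (trig q c p) <= 2 * Series (fun j => Cmod (c j)).
Proof.
  intros H. apply CSeries_bound; auto.
  intros j; rewrite Cmod_mult, Cmod_expi; lra.
Qed.

Lemma has_partial_expi (b : bool) (k : Z * Z) (p : R * R) :
  has_partial b (expi k) p (Ci * (RtoC (IZR (prj b k)) * expi k p))%C.
Proof.
  pose proof (fun s => expi_taylor b k s p) as HT.
  split.
  - apply (is_derive_quadratic _ _ _ (2 * IZR (prj b k) ^ 2)). intros s.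
    rewrite !slice_shift, shift_0 by exact 0.
    replace (prj b p + s - prj b p) with s by ring.
    eapply Rle_trans; [|apply (HT s)]. eapply Rle_trans; [|apply Rabs_Re_le].
    right; f_equal. unfold Re; simpl; ring.
  - apply (is_derive_quadratic _ _ _ (2 * IZR (prj b k) ^ 2)). intros s.
    rewrite !slice_shift, shift_0 by exact 0.
    replace (prj b p + s - prj b p) with s by ring.
    eapply Rle_trans; [|apply (HT s)]. eapply Rle_trans; [|apply Rabs_Im_le].
    right; f_equal. unfold Im; simpl; ring.
Qed.

Lemma continuous_expi (k : Z * Z) : continuous_Fn (expi k).
Proof.
  assert (Hph : cont (phase k)).
  { apply (cont_lin (IZR (fst k)) (IZR (snd k)) fst snd);
      intros [x y]; [apply continuous_fst|apply continuous_snd]. }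
  apply continuous_Fn_ReIm; split; intros p.
  - apply (continuous_comp (phase k) cos p (Hph p)), continuous_cos.
  - apply (continuous_comp (phase k) sin p (Hph p)), continuous_sin.
Qed.

(** * Uniqueness of Fourier coefficients *)

Lemma period_Z (g : R -> R) (T : R) : (forall x, g (x + T) = g x) ->
  forall (k : Z) x, g (x + IZR k * T) = g x.
Proof.
  intros H.
  assert (Hn : forall (n : nat) x, g (x + INR n * T) = g x).
  { induction n as [|n IH]; intros x.
    - simpl; f_equal; ring.
    - rewrite S_INR. replace (x + (INR n + 1) * T) with (x + INR n * T + T) by ring.
      now rewrite H. }
  intros k x. destruct (Z.le_ge_cases 0 k) as [Hk|Hk].
  - rewrite <- (Z2Nat.id k), <- INR_IZR_INZ by assumption. apply Hn.
  - rewrite <- (Hn (Z.to_nat (- k)) (x + IZR k * T)). f_equal.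
    rewrite INR_IZR_INZ, Z2Nat.id, opp_IZR by lia. ring.
Qed.

Lemma reduce_period (x : R) : exists k : Z, 0 <= x + IZR k * (2 * PI) <= 2 * PI.
Proof.
  pose proof two_pi_pos as Hpi.
  destruct (archimed (x / (2 * PI))) as [A B].
  exists (1 - up (x / (2 * PI)))%Z. rewrite minus_IZR.
  set (u := IZR (up (x / (2 * PI)))) in *.
  assert (E : x / (2 * PI) * (2 * PI) = x) by (field; lra).
  set (v := x / (2 * PI)) in *.
  rewrite <- E. nra.
Qed.

(** Being close to [1] for the cosine means being close to a multiple of the
    period; the interval is folded at [PI], where the cosine stops
    decreasing. *)
Lemma cos_near (d t : R) : 0 < d < PI -> cos d < cos t ->
  exists k : Z, Rabs (t + IZR k * (2 * PI)) < d.
Proof.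
  intros Hd H. destruct (reduce_period t) as [k Hk].
  rewrite <- (proj1 (sincos_period k t)) in H.
  set (s := t + IZR k * (2 * PI)) in *.
  destruct (Rle_dec s PI) as [Hs|Hs].
  - exists k. fold s. rewrite Rabs_pos_eq by lra.
    destruct (Rlt_le_dec s d); [assumption|].
    assert (cos s <= cos d) by (apply cos_decr_1; lra). lra.
  - exists (k - 1)%Z. rewrite minus_IZR.
    replace (t + (IZR k - 1) * (2 * PI)) with (- (2 * PI - s)) by (unfold s; ring).
    rewrite Rabs_Ropp, Rabs_pos_eq by lra.
    destruct (Rlt_le_dec (2 * PI - s) d); [assumption|].
    assert (E : cos (2 * PI - s) = cos s).
    { rewrite <- (cos_neg (2 * PI - s)).
      replace (- (2 * PI - s)) with (s + IZR (-1) * (2 * PI)) by (simpl; ring).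
      apply sincos_period. }
    assert (cos (2 * PI - s) <= cos d) by (apply cos_decr_1; lra). lra.
Qed.

(** A trigonometric polynomial with peak [1 + h / 2] at [(x0, y0)], whose
    absolute value is at most one as soon as one of the cosines is at most [1
    - h]. Its powers concentrate at the peak. *)
Definition kernel (x0 y0 h : R) (p : R * R) : R :=
  1 + (cos (fst p - x0) + cos (snd p - y0) - 2 + h) / 2.

Lemma cont_cos_phase (k : Z * Z) (a : R) : cont (fun p => cos (phase k p + a)).
Proof.
  intros p. apply (continuous_comp (fun p => phase k p + a) cos p); [|apply continuous_cos].
  assert (Hph : cont (phase k)).
  { apply (cont_lin (IZR (fst k)) (IZR (snd k)) fst snd);
      intros [x y]; [apply continuous_fst|apply continuous_snd]. }
  apply (continuous_plus (phase k) (fun _ => a)); [apply Hph|apply continuous_const].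
Qed.

Lemma cont_kernel (x0 y0 h : R) : cont (kernel x0 y0 h).
Proof.
  pose proof (cont_lin 1 (/2) _ _ (cont_const (h / 2))
   (cont_lin 1 1 _ _ (cont_cos_phase (1, 0)%Z (- x0)) (cont_cos_phase (0, 1)%Z (- y0)))) as H.
  intros p. eapply continuous_ext; [|apply H].
  intros [x y]. unfold kernel, phase; simpl.
  replace (1 * x + 0 * y + - x0) with (x - x0) by ring.
  replace (0 * x + 1 * y + - y0) with (y - y0) by ring. field.
Qed.

(** A function orthogonal to all characters stays so after multiplication by
    the kernel: the product of the kernel with a cosine of a phase is a
    combination of cosines of neighbouring phases. *)
Lemma kernel_pow_orth (g : R * R -> R) (x0 y0 h : R) : cont g ->
  (forall k a, RInt2 (fun p => g p * cos (phase k p + a)) = 0) ->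
  forall N k a, RInt2 (fun p => g p * kernel x0 y0 h p ^ N * cos (phase k p + a)) = 0.
Proof.
  intros Hg H. induction N as [|N IH]; intros k a.
  - rewrite <- (H k a). apply RInt2_ext; intros p; simpl; ring.
  - set (I := fun k a (p : R * R) => g p * kernel x0 y0 h p ^ N * cos (phase k p + a)).
    assert (HI : forall k a, cont (I k a)).
    { intros k' a'. apply cont_mult; [apply cont_mult|]; auto using cont_cos_phase.
      apply cont_pow, cont_kernel. }
    set (s := kadd k).
    rewrite (RInt2_ext _ (fun p => h / 2 * I k a p + / 4 *
      (1 * (1 * I (s (1, 0)%Z) (a - x0) p + 1 * I (s (-1, 0)%Z) (a + x0) p) +
       1 * (1 * I (s (0, 1)%Z) (a - y0) p + 1 * I (s (0, -1)%Z) (a + y0) p)))).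
    + rewrite !RInt2_lin; auto using cont_lin. unfold I; rewrite !IH. ring.
    + intros p. unfold I. simpl pow.
      set (A := g p * kernel x0 y0 h p ^ N).
      set (th := phase k p + a).
      assert (E : forall u v t, IZR u * fst p + IZR v * snd p + t - a =
         phase (s (u, v)) p + t - th).
      { intros u v t. unfold th, s, kadd, phase; simpl. rewrite !plus_IZR. ring. }
      replace (phase (s (1, 0)%Z) p + (a - x0)) with (th + (fst p - x0))
        by (generalize (E 1%Z 0%Z a); simpl; lra).
      replace (phase (s (-1, 0)%Z) p + (a + x0)) with (th - (fst p - x0))
        by (generalize (E (-1)%Z 0%Z a); simpl; lra).
      replace (phase (s (0, 1)%Z) p + (a - y0)) with (th + (snd p - y0))
        by (generalize (E 0%Z 1%Z a); simpl; lra).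
      replace (phase (s (0, -1)%Z) p + (a + y0)) with (th - (snd p - y0))
        by (generalize (E 0%Z (-1)%Z a); simpl; lra).
      rewrite !cos_plus, !cos_minus.
      replace (g p * (kernel x0 y0 h p * kernel x0 y0 h p ^ N) * cos th)
        with (A * kernel x0 y0 h p * cos th) by (unfold A; ring).
      unfold kernel. rewrite !cos_minus. field.
Qed.

(** The interval lies to the right or to the left of [x0], whichever fits
    into the period. *)
Lemma cos_half_interval (x0 d : R) : 0 <= x0 <= 2 * PI -> 0 < d <= 1 ->
  exists a b, b - a = d /\ 0 <= a /\ a <= b /\ b <= 2 * PI /\
    forall x, a <= x <= b -> 1 - d <= cos (x - x0).
Proof.
  intros Hx Hd. pose proof PI2_3_2.
  assert (Hc : forall x, Rabs (x - x0) <= d -> 1 - d <= cos (x - x0)).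
  { intros x Hxd. pose proof (Rabs_cos1_le (x - x0)) as Hb.
    assert (Hb' : Rabs (cos (x - x0) - 1) <= d) by lra.
    apply Rabs_le_between in Hb'. lra. }
  destruct (Rle_dec x0 PI).
  - exists x0, (x0 + d). repeat split; try lra.
    intros x Hx'. apply Hc, Rabs_le; lra.
  - exists (x0 - d), x0. repeat split; try lra.
    intros x Hx'. apply Hc, Rabs_le; lra.
Qed.

(** Even powers are nonnegative, so the integral may be restricted to a
    rectangle of side [h / 4] at the peak, where the kernel is at least [1 +
    h / 4]. *)
Lemma kernel_mass (x0 y0 h : R) : 0 < h <= 2 ->
  0 <= x0 <= 2 * PI -> 0 <= y0 <= 2 * PI -> forall n : nat,
  (h / 4) ^ 2 * (1 + h / 4) ^ (2 * n) <= RInt2 (fun p => kernel x0 y0 h p ^ (2 * n)).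
Proof.
  intros Hh Hx Hy n.
  destruct (cos_half_interval x0 (h / 4) Hx) as (a & b & Hab & Ha & Hab' & Hb & Hc); [lra|].
  destruct (cos_half_interval y0 (h / 4) Hy) as (a' & b' & Hab2 & Ha2 & Hab2' & Hb2 & Hc2); [lra|].
  replace ((h / 4) ^ 2 * (1 + h / 4) ^ (2 * n)) with
    ((b - a) * ((b' - a') * (1 + h / 4) ^ (2 * n))) by (rewrite Hab, Hab2; simpl; ring).
  apply RInt2_lower; auto.
  - apply cont_pow, cont_kernel.
  - intros p. rewrite pow_mult. apply pow_le, pow2_ge_0.
  - apply pow_le; lra.
  - intros x y H1 H2. apply pow_incr. split; [lra|]. unfold kernel; simpl.
    specialize (Hc x H1); specialize (Hc2 y H2). lra.
Qed.

(** If [g] were positive at the peak, then [g * K ^ n >= c * K ^ n - (M + c)]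
    everywhere, with [c] half the value at the peak: near the peak because [g
    >= c] there, elsewhere because the kernel is bounded by one. The left
    side integrates to zero, while the integral of [K ^ n] is unbounded. *)
Lemma real_uniqueness_le (g : R * R -> R) (M : R) :
  cont g -> (forall p, Rabs (g p) <= M) ->
  (forall x y, g (x + 2 * PI, y) = g (x, y)) ->
  (forall x y, g (x, y + 2 * PI) = g (x, y)) ->
  (forall k a, RInt2 (fun p => g p * cos (phase k p + a)) = 0) ->
  forall x0 y0, 0 <= x0 <= 2 * PI -> 0 <= y0 <= 2 * PI -> g (x0, y0) <= 0.
Proof.
  intros Hg HM P1 P2 H x0 y0 Hx Hy.
  destruct (Rle_lt_dec (g (x0, y0)) 0) as [|Hpos]; [assumption|exfalso].
  set (c := g (x0, y0) / 2).
  assert (Hc : 0 < c) by (unfold c; lra).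
  assert (Hloc : exists d, 0 < d < PI /\ forall x y,
     Rabs (x - x0) < d -> Rabs (y - y0) < d -> c <= g (x, y)).
  { pose proof (cont_2d g x0 y0 Hg (mkposreal c Hc)) as [d Hd]. simpl in Hd.
    exists (Rmin d 1). pose proof PI2_3_2. pose proof (cond_pos d).
    split.
    - split; [apply Rmin_pos; lra|]. eapply Rle_lt_trans; [apply Rmin_r|lra].
    - intros x y A B.
      assert (A' : Rabs (x - x0) < d) by (eapply Rlt_le_trans; [apply A|apply Rmin_l]).
      assert (B' : Rabs (y - y0) < d) by (eapply Rlt_le_trans; [apply B|apply Rmin_l]).
      specialize (Hd x y A' B'). apply Rabs_def2 in Hd. unfold c in *; lra. }
  destruct Hloc as (d & Hd & Hloc).
  (* the kernel exceeds one only where both cosines exceed [cos d] *)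
  set (h := 1 - cos d).
  assert (Hh : 0 < h <= 2).
  { unfold h. pose proof (COS_bound d).
    assert (cos d < cos 0) by (apply cos_decreasing_1; lra).
    rewrite cos_0 in *. lra. }
  set (K := kernel x0 y0 h).
  assert (Hnear : forall p, 1 < K p -> c <= g p).
  { intros [x y] Hp. unfold K, kernel in Hp; simpl in Hp.
    pose proof (COS_bound (x - x0)). pose proof (COS_bound (y - y0)).
    assert (C1 : cos d < cos (x - x0)) by (unfold h in Hp; lra).
    assert (C2 : cos d < cos (y - y0)) by (unfold h in Hp; lra).
    destruct (cos_near d _ Hd C1) as [k Hk]. destruct (cos_near d _ Hd C2) as [l Hl].
    rewrite <- (period_Z (fun x => g (x, y)) (2 * PI) (fun x => P1 x y) k x).
    rewrite <- (period_Z (fun y => g (x + IZR k * (2 * PI), y)) (2 * PI) (fun y => P2 _ y) l y).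
    apply Hloc.
    - replace (x + IZR k * (2 * PI) - x0) with (x - x0 + IZR k * (2 * PI)) by ring; auto.
    - replace (y + IZR l * (2 * PI) - y0) with (y - y0 + IZR l * (2 * PI)) by ring; auto. }
  assert (Hlow : forall n p, c * K p ^ n + - (M + c) * 1 <= g p * K p ^ n).
  { intros n p. pose proof (HM p) as Hb. apply Rabs_le_between in Hb.
    destruct (Rlt_le_dec 1 (K p)) as [H1|H1].
    - specialize (Hnear p H1).
      assert (0 < K p ^ n) by (apply pow_lt; lra).
      assert (c * K p ^ n <= g p * K p ^ n) by (apply Rmult_le_compat_r; lra). lra.
    - assert (H2 : Rabs (K p ^ n) <= 1).
      { rewrite <- RPow_abs. rewrite <- (pow1 n). apply pow_incr.
        split; [apply Rabs_pos|]. apply Rabs_le. split; auto.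
        unfold K, kernel. pose proof (COS_bound (fst p - x0)).
        pose proof (COS_bound (snd p - y0)). lra. }
      apply Rabs_le_between in H2. nra. }
  assert (Hint : forall n, c * RInt2 (fun p => K p ^ n) <= (2 * PI) ^ 2 * (M + c)).
  { intros n.
    assert (Ck : cont (fun p => K p ^ n)) by apply cont_pow, cont_kernel.
    assert (A : RInt2 (fun p => g p * K p ^ n) = 0).
    { rewrite <- (kernel_pow_orth g x0 y0 h Hg H n (0, 0)%Z 0).
      apply RInt2_ext; intros p. unfold phase; simpl.
      replace (0 * fst p + 0 * snd p + 0) with 0 by ring. rewrite cos_0. unfold K. ring. }
    assert (B : RInt2 (fun p => c * K p ^ n + - (M + c) * 1) <= RInt2 (fun p => g p * K p ^ n)).
    { apply RInt2_le; auto using cont_lin, cont_const, cont_mult. }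
    rewrite A, RInt2_lin, RInt2_const in B; auto using cont_const. lra. }
  (* an exponent at which the mass of the kernel exceeds the bound [Hint] *)
  destruct (Pow_x_infinity ((1 + h / 4) ^ 2)) with
     (b := ((2 * PI) ^ 2 * (M + c)) / (c * (h / 4) ^ 2) + 1) as [N HN].
  { rewrite Rabs_pos_eq by apply pow2_ge_0. nra. }
  specialize (HN N (Nat.le_refl N)).
  rewrite <- pow_mult, Rabs_pos_eq in HN by (apply pow_le; lra).
  pose proof (kernel_mass x0 y0 h Hh Hx Hy N) as Hmass. fold K in Hmass.
  specialize (Hint (2 * N)%nat).
  assert (Hq : 0 < c * (h / 4) ^ 2) by (apply Rmult_lt_0_compat; [lra|apply pow_lt; lra]).
  apply Rge_le in HN. apply Rmult_le_compat_l with (r := c * (h / 4) ^ 2) in HN; [|lra].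
  rewrite Rmult_plus_distr_l in HN.
  replace (c * (h / 4) ^ 2 * ((2 * PI) ^ 2 * (M + c) / (c * (h / 4) ^ 2)))
    with ((2 * PI) ^ 2 * (M + c)) in HN by (field; lra).
  apply Rmult_le_compat_l with (r := c) in Hmass; [|lra].
  lra.
Qed.

Lemma real_uniqueness (g : R * R -> R) (M : R) :
  cont g -> (forall p, Rabs (g p) <= M) ->
  (forall x y, g (x + 2 * PI, y) = g (x, y)) ->
  (forall x y, g (x, y + 2 * PI) = g (x, y)) ->
  (forall k a, RInt2 (fun p => g p * cos (phase k p + a)) = 0) ->
  forall p, g p = 0.
Proof.
  intros Hg HM P1 P2 H [x y].
  destruct (reduce_period x) as [k Hk], (reduce_period y) as [l Hl].
  rewrite <- (period_Z (fun x => g (x, y)) (2 * PI) (fun x => P1 x y) k x).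
  rewrite <- (period_Z (fun y => g (x + IZR k * (2 * PI), y)) (2 * PI) (fun y => P2 _ y) l y).
  apply Rle_antisym.
  - now apply (real_uniqueness_le g M).
  - assert (E : forall h, cont h -> cont (fun p => (-1) * h p + 0 * h p)) by auto using cont_lin.
    assert (A : -1 * g (x + IZR k * (2 * PI), y + IZR l * (2 * PI))
       + 0 * g (x + IZR k * (2 * PI), y + IZR l * (2 * PI)) <= 0).
    { apply (real_uniqueness_le (fun p => (-1) * g p + 0 * g p) M); auto.
      - intros p. replace (-1 * g p + 0 * g p) with (- g p) by ring.
        rewrite Rabs_Ropp; auto.
      - intros u v; now rewrite P1.
      - intros u v; now rewrite P2.
      - intros k' a. rewrite (RInt2_ext _ (fun p => (-1) * (g p * cos (phase k' p + a))
          + 0 * (g p * cos (phase k' p + a)))) by (intros p; ring).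
        rewrite RInt2_lin, H; auto using cont_mult, cont_cos_phase. ring. }
    lra.
Qed.

(** The normalization by the area of the torus is left out; it reappears in
    the inversion formula. *)
Definition coef (f : Fn) (k : Z * Z) : C :=
  torus_integral (fun p => f p * expi (kopp k) p)%C.

(** Reflection of the frequency separates the real part of [f] from its
    imaginary part, and each of them is orthogonal to all cosines of a phase. *)
Lemma Fourier_uniqueness (f : Fn) (M : R) :
  continuous_Fn f -> periodic f -> (forall p, Cmod (f p) <= M) ->
  (forall k, coef f k = 0) -> forall p, f p = 0.
Proof.
  intros Hf Hp HM H p.
  destruct (proj1 (continuous_Fn_ReIm f) Hf) as [F1 F2].
  assert (Cc : forall k a, cont (fun p => cos (phase k p + a))) by apply cont_cos_phase.
  set (u := fun k p => cos (phase k p + 0)).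
  set (v := fun k p => cos (phase k p + - (PI / 2))).
  assert (Hu : forall k p, u k p = Re (expi k p)).
  { intros k q; unfold u. rewrite Rplus_0_r. reflexivity. }
  assert (Hv : forall k p, v k p = Im (expi k p)).
  { intros k q; unfold v, expi; simpl. rewrite <- cos_shift.
    rewrite <- cos_neg. f_equal. ring. }
  assert (Cu : forall k, cont (u k)) by (intros; apply Cc).
  assert (Cv : forall k, cont (v k)) by (intros; apply Cc).
  assert (Hou : forall k p, u (kopp k) p = u k p).
  { intros k q. unfold u. rewrite !Rplus_0_r.
    replace (phase (kopp k) q) with (- phase k q) by
      (unfold phase, kopp; simpl; rewrite !opp_IZR; ring). apply cos_neg. }
  assert (Hov : forall k p, v (kopp k) p = - v k p).
  { intros k q. rewrite !Hv. simpl.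
    replace (phase (kopp k) q) with (- phase k q) by
      (unfold phase, kopp; simpl; rewrite !opp_IZR; ring). apply sin_neg. }
  set (a := fun p => Re (f p)) in *. set (b := fun p => Im (f p)) in *.
  assert (Hk : forall k, RInt2 (fun p => a p * u k p) + - RInt2 (fun p => b p * v k p) = 0 /\
                    RInt2 (fun p => a p * v k p) + RInt2 (fun p => b p * u k p) = 0).
  { intros k. pose proof (H (kopp k)) as E. unfold coef in E.
    rewrite kopp_kopp in E.
    rewrite torus_integral_ReIm in E by (apply continuous_Fn_mult; auto using continuous_expi).
    pose proof (f_equal Re E) as E1. pose proof (f_equal Im E) as E2. simpl in E1, E2.
    split.
    - etransitivity; [|exact E1].
      transitivity (RInt2 (fun p => 1 * (a p * u k p) + (-1) * (b p * v k p))).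
      + rewrite RInt2_lin; auto using cont_mult. ring.
      + apply RInt2_ext; intros q. rewrite Hu, Hv. unfold a, b, Re, Im; simpl; ring.
    - etransitivity; [|exact E2].
      transitivity (RInt2 (fun p => 1 * (a p * v k p) + 1 * (b p * u k p))).
      + rewrite RInt2_lin; auto using cont_mult. ring.
      + apply RInt2_ext; intros q. rewrite Hu, Hv. unfold a, b, Re, Im; simpl; ring. }
  assert (Hneg : forall (w : R * R -> R) k, cont w ->
     RInt2 (fun p => w p * u (kopp k) p) = RInt2 (fun p => w p * u k p) /\
     RInt2 (fun p => w p * v (kopp k) p) = - RInt2 (fun p => w p * v k p)).
  { intros w k Hw. split.
    - apply RInt2_ext; intros q; now rewrite Hou.
    - rewrite (RInt2_ext _ (fun p => (-1) * (w p * v k p) + 0 * (w p * v k p))).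
      + rewrite RInt2_lin; auto using cont_mult. ring.
      + intros q; rewrite Hov; ring. }
  assert (Hz : forall w, cont w -> (w = a \/ w = b) -> forall k t,
     RInt2 (fun p => w p * cos (phase k p + t)) = 0).
  { intros w Hw Hab k t.
    destruct (Hk k) as [A1 A2], (Hk (kopp k)) as [B1 B2].
    destruct (Hneg a k F1) as [N1 N2], (Hneg b k F2) as [N3 N4].
    rewrite N1, N4 in B1. rewrite N2, N3 in B2.
    rewrite (RInt2_ext _ (fun p => cos t * (w p * u k p) + (- sin t) * (w p * v k p))).
    - rewrite RInt2_lin; auto using cont_mult.
      destruct Hab as [-> | ->].
      + replace (RInt2 (fun p => a p * u k p)) with 0 by lra.
        replace (RInt2 (fun p => a p * v k p)) with 0 by lra. ring.
      + replace (RInt2 (fun p => b p * u k p)) with 0 by lra.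
        replace (RInt2 (fun p => b p * v k p)) with 0 by lra. ring.
    - intros q. rewrite cos_plus, Hu, Hv. simpl. ring. }
  apply C_ext.
  - apply (real_uniqueness a M); auto.
    + intros q; eapply Rle_trans; [apply Rabs_Re_le|apply HM].
    + intros x y; unfold a; f_equal; apply Hp.
    + intros x y; unfold a; f_equal; apply Hp.
  - apply (real_uniqueness b M); auto.
    + intros q; eapply Rle_trans; [apply Rabs_Im_le|apply HM].
    + intros x y; unfold b; f_equal; apply Hp.
    + intros x y; unfold b; f_equal; apply Hp.
Qed.

(** * Fourier coefficients *)

Lemma continuous_Fn_ext (f g : Fn) :
  (forall p, f p = g p) -> continuous_Fn f -> continuous_Fn g.
Proof. intros H; now replace g with f by now apply functional_extensionality. Qed.

Lemma torus_integral_ext (f g : Fn) :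
  (forall p, f p = g p) -> torus_integral f = torus_integral g.
Proof. intros H; now replace g with f by now apply functional_extensionality. Qed.

Lemma torus_integral_scal (a : C) (f : Fn) : continuous_Fn f ->
  torus_integral (fun p => a * f p)%C = (a * torus_integral f)%C.
Proof.
  intros H. rewrite (torus_integral_ext _ (lin_comb a f 0 f)).
  - rewrite torus_integral_lin by assumption. ring.
  - intros p; unfold lin_comb; ring.
Qed.

Lemma continuous_Fn_scal (a : C) (f : Fn) :
  continuous_Fn f -> continuous_Fn (fun p => a * f p)%C.
Proof.
  intros H. apply (continuous_Fn_ext (lin_comb a f 0 f)).
  - intros p; unfold lin_comb; ring.
  - now apply continuous_Fn_lin.
Qed.

(** A nontrivial character is, up to a nonzero factor, one of its own
    derivatives, and derivatives have integral zero. *)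
Lemma torus_integral_expi (k : Z * Z) : k <> (0, 0)%Z -> torus_integral (expi k) = 0.
Proof.
  intros Hk.
  assert (H : exists b, IZR (prj b k) <> 0).
  { destruct k as [k1 k2]. destruct (Z.eq_dec k1 0) as [->|H1].
    - exists false. simpl. intros E. apply eq_IZR_R0 in E. subst. auto.
    - exists true. simpl. intros E. now apply eq_IZR_R0 in E. }
  destruct H as [b Hb].
  pose proof (torus_integral_partial b (expi k)
    (fun p => Ci * (RtoC (IZR (prj b k)) * expi k p))%C (periodic_expi k)
    (continuous_expi k)) as H.
  rewrite !torus_integral_scal in H; auto using continuous_expi, continuous_Fn_scal.
  specialize (H (continuous_Fn_scal _ _ (continuous_Fn_scal _ _ (continuous_expi k)))
    (has_partial_expi b k)).
  destruct (Ceq_dec (torus_integral (expi k)) 0) as [E|E]; auto.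
  exfalso. revert H. repeat apply Cmult_neq_0; auto using Ci_nz.
  intros E'. apply Hb. now apply RtoC_inj.
Qed.

Lemma torus_integral_expi_0 : torus_integral (expi (0, 0)%Z) = RtoC ((2 * PI) ^ 2).
Proof.
  rewrite torus_integral_ReIm by apply continuous_expi.
  apply C_ext; simpl.
  - rewrite (RInt2_ext _ (fun _ => 1)).
    + rewrite RInt2_const. simpl. ring.
    + intros p. generalize (f_equal Re (expi_0 p)); simpl; auto.
  - rewrite (RInt2_ext _ (fun _ => 0)).
    + rewrite RInt2_const. ring.
    + intros p. generalize (f_equal Im (expi_0 p)); simpl; auto.
Qed.

Lemma continuous_coef (f : Fn) (k : Z * Z) :
  continuous_Fn f -> continuous_Fn (fun p => f p * expi k p)%C.
Proof. intros; apply continuous_Fn_mult; auto using continuous_expi. Qed.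

Lemma coef_lin (f g : Fn) (a b : C) (k : Z * Z) :
  continuous_Fn f -> continuous_Fn g ->
  coef (lin_comb a f b g) k = (a * coef f k + b * coef g k)%C.
Proof.
  intros Hf Hg. unfold coef. rewrite <- torus_integral_lin by now apply continuous_coef.
  apply torus_integral_ext; intros p; unfold lin_comb; ring.
Qed.

Lemma coef_bound (f : Fn) (M : R) (k : Z * Z) :
  continuous_Fn f -> (forall p, Cmod (f p) <= M) ->
  Cmod (coef f k) <= 2 * (2 * PI) ^ 2 * M.
Proof.
  intros Hf HM. apply torus_integral_bound; [now apply continuous_coef|].
  intros p. rewrite Cmod_mult, Cmod_expi, Rmult_1_r. apply HM.
Qed.

Lemma kprj_opp (b : bool) (k : Z * Z) : IZR (prj b (kopp k)) = - IZR (prj b k).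
Proof. destruct b; simpl; apply opp_IZR. Qed.

(** Integration by parts: the derivative of the product of [f] with a
    character has integral zero. *)
Lemma coef_Ddir (b : bool) (f : Fn) (k : Z * Z) : smooth_torus f ->
  coef (Ddir b f) k = (RtoC (IZR (prj b k)) * coef f k)%C.
Proof.
  intros Hf.
  assert (Cf : continuous_Fn f) by now apply smooth_continuous.
  assert (CD : continuous_Fn (Ddir b f)) by now apply smooth_continuous, smooth_Ddir.
  assert (E : forall p, (Ci * (Ddir b f p * expi (kopp k) p)
      + (- Ci * RtoC (IZR (prj b k))) * (f p * expi (kopp k) p))%C
    = (partial b f p * expi (kopp k) p
       + f p * (Ci * (RtoC (IZR (prj b (kopp k))) * expi (kopp k) p)))%C).
  { intros p. rewrite Ddir_partial, kprj_opp, RtoC_opp.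
    replace (Ci * (- Ci * partial b f p * expi (kopp k) p))%C with
      (- (Ci * Ci) * (partial b f p * expi (kopp k) p))%C by ring.
    replace (- (Ci * Ci))%C with (RtoC 1) by (apply C_ext; simpl; ring). ring. }
  assert (H : torus_integral (lin_comb Ci (fun p => Ddir b f p * expi (kopp k) p)
      (- Ci * RtoC (IZR (prj b k))) (fun p => f p * expi (kopp k) p))%C = 0).
  { apply (torus_integral_partial b (fun p => f p * expi (kopp k) p)%C).
    - intros x y. destruct Hf as [Hp _].
      destruct (Hp x y) as [-> ->], (periodic_expi (kopp k) x y) as [-> ->]. auto.
    - now apply continuous_coef.
    - apply continuous_Fn_lin; now apply continuous_coef.
    - intros p. unfold lin_comb. rewrite E. apply has_partial_mult.
      + now apply smooth_has_partial.
      + apply has_partial_expi. }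
  rewrite torus_integral_lin in H by now apply continuous_coef.
  fold (coef (Ddir b f) k) in H. fold (coef f k) in H.
  replace (coef (Ddir b f) k) with (- Ci * (Ci * coef (Ddir b f) k
     + - Ci * RtoC (IZR (prj b k)) * coef f k) + RtoC (IZR (prj b k)) * coef f k)%C.
  - rewrite H. ring.
  - replace (- Ci * (Ci * coef (Ddir b f) k + - Ci * RtoC (IZR (prj b k)) * coef f k))%C
      with (- (Ci * Ci) * (coef (Ddir b f) k - RtoC (IZR (prj b k)) * coef f k))%C by ring.
    replace (- (Ci * Ci))%C with (RtoC 1) by (apply C_ext; simpl; ring). ring.
Qed.

Lemma coef_iter_Ddir (b : bool) (n : nat) (f : Fn) (k : Z * Z) : smooth_torus f ->
  coef (Nat.iter n (Ddir b) f) k = (RtoC (IZR (prj b k) ^ n) * coef f k)%C.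
Proof.
  intros Hf. induction n as [|n IH]; simpl.
  - ring.
  - rewrite coef_Ddir, IH, RtoC_mult by now apply smooth_iter_Ddir. ring.
Qed.

(** The dominant component of [k] is picked out by pure derivatives in its
    direction. *)
Lemma coef_decay (f : Fn) (n : nat) (M : R) (k : Z * Z) : smooth_torus f ->
  (forall p g, order g = n -> Cmod (Dmulti g f p) <= M) ->
  Cmod (coef f k) * knorm k ^ n <= 2 * (2 * PI) ^ 2 * M.
Proof.
  intros Hf HM. destruct (knorm_prj k) as [b Hb].
  replace (Cmod (coef f k) * knorm k ^ n) with (Cmod (coef (Nat.iter n (Ddir b) f) k)).
  - apply coef_bound; [now apply smooth_continuous, smooth_iter_Ddir|].
    intros p. destruct b.
    + apply (HM p (n, 0)%nat). unfold order; simpl; lia.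
    + apply (HM p (0, n)%nat). reflexivity.
  - rewrite coef_iter_Ddir by assumption. rewrite Cmod_mult, Cmod_R, <- RPow_abs, Hb. ring.
Qed.

(** The remainders of the series are uniformly small, hence so are their
    integrals against a bounded function. *)
Lemma embed_trig (q : nat -> Z * Z) (c : nat -> C) (f : Fn) (M : R) :
  rapid q c -> continuous_Fn f -> (forall p, Cmod (f p) <= M) ->
  embed (trig q c) f = CSeries (fun j => c j * coef f (kopp (q j)))%C /\
  abs_summable (fun j => c j * coef f (kopp (q j)))%C.
Proof.
  intros Hc Hf HM. pose proof (rapid_summable _ _ Hc) as Hs.
  assert (HM0 : 0 <= M).
  { eapply Rle_trans; [apply (Cmod_ge_0 (f (0, 0)))|apply HM]. }
  assert (Ht : abs_summable (fun j => c j * coef f (kopp (q j)))%C).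
  { apply (abs_summable_bound _ (fun j => (2 * (2 * PI) ^ 2 * M) * Cmod (c j))).
    - intros j. rewrite Cmod_mult, Rmult_comm.
      apply Rmult_le_compat_r; [apply Cmod_ge_0|]. now apply coef_bound.
    - now apply ex_series_scal_l. }
  split; auto.
  apply (CSeries_telescope _ (fun n => embed (trig q (tail (RtoC 0) n c)) f)
    (fun n => 2 * (2 * PI) ^ 2 * (2 * M) * Series (tail 0 n (fun j => Cmod (c j))))); auto.
  - intros n. unfold embed, coef.
    rewrite <- torus_integral_scal by now apply continuous_coef.
    rewrite (trig_tail_step q c n Hs).
    rewrite (torus_integral_ext _ (lin_comb 1 (fun p => c n * (f p * expi (kopp (kopp (q n))) p))%C
       1 (fun p => trig q (tail (RtoC 0) (S n) c) p * f p)%C)).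
    + rewrite torus_integral_lin; [ring| |].
      * now apply continuous_Fn_scal, continuous_coef.
      * apply continuous_Fn_mult; auto. now apply continuous_trig, rapid_tail.
    + intros p. unfold lin_comb. rewrite kopp_kopp. ring.
  - intros n. unfold embed.
    rewrite Rmult_assoc. apply torus_integral_bound.
    + apply continuous_Fn_mult; auto. now apply continuous_trig, rapid_tail.
    + intros p. rewrite Cmod_mult.
      replace (2 * M * Series (tail 0 n (fun j => Cmod (c j)))) with
        (2 * Series (tail 0 n (fun j => Cmod (c j))) * M) by ring.
      apply Rmult_le_compat; auto using Cmod_ge_0.
      eapply Rle_trans; [apply trig_bound; now apply abs_summable_tail|].
      right. f_equal. apply Series_ext; intros j.
      apply (tail_comp Cmod). apply Cmod_0.
  - replace (Finite 0) with (Rbar_mult (2 * (2 * PI) ^ 2 * (2 * M)) 0)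
      by (simpl; f_equal; ring).
    apply is_lim_seq_scal_l. now apply Series_tail_lim.
Qed.

Lemma CSeries_single (a : nat -> C) (j0 : nat) : abs_summable a ->
  (forall j, j <> j0 -> a j = 0) -> CSeries a = a j0.
Proof.
  intros Ha H. symmetry.
  rewrite <- (CSeries_telescope a (fun n => if Nat.leb n j0 then a j0 else 0)
    (fun n => if Nat.leb n j0 then Cmod (a j0) else 0)); auto.
  - intros n. destruct (Nat.leb_spec n j0), (Nat.leb_spec (S n) j0); try lia.
    + rewrite (H n) by lia. ring.
    + replace n with j0 by lia. ring.
    + rewrite (H n) by lia. ring.
  - intros n. destruct (Nat.leb n j0); [apply Rle_refl|rewrite Cmod_0; apply Rle_refl].
  - apply (is_lim_seq_incr_n _ (S j0)).
    apply (is_lim_seq_ext (fun _ => 0)); [|apply is_lim_seq_const].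
    intros n. destruct (Nat.leb_spec (n + S j0) j0); [lia|reflexivity].
Qed.

Lemma coef_expi (k l : Z * Z) :
  coef (expi k) l = if andb (Z.eqb (fst k) (fst l)) (Z.eqb (snd k) (snd l))
                 then RtoC ((2 * PI) ^ 2) else 0.
Proof.
  unfold coef. rewrite (torus_integral_ext _ (expi (kadd k (kopp l)))).
  2: { intros p; apply expi_add. }
  destruct (Z.eqb_spec (fst k) (fst l)) as [E1|E1]; simpl.
  - destruct (Z.eqb_spec (snd k) (snd l)) as [E2|E2].
    + replace (kadd k (kopp l)) with (0, 0)%Z; [apply torus_integral_expi_0|].
      unfold kadd, kopp; simpl. f_equal; lia.
    + apply torus_integral_expi. unfold kadd, kopp; simpl. intros E; inversion E; lia.
  - apply torus_integral_expi. unfold kadd, kopp; simpl. intros E; inversion E; lia.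
Qed.

Lemma coef_expi_same (k : Z * Z) : coef (expi k) k = RtoC ((2 * PI) ^ 2).
Proof. rewrite coef_expi, !Z.eqb_refl. reflexivity. Qed.

Lemma coef_expi_diff (k l : Z * Z) : k <> l -> coef (expi k) l = 0.
Proof.
  intros H. rewrite coef_expi.
  destruct (Z.eqb_spec (fst k) (fst l)), (Z.eqb_spec (snd k) (snd l)); auto.
  exfalso; apply H. destruct k, l; simpl in *; now subst.
Qed.

Lemma coef_trig (q : nat -> Z * Z) (c : nat -> C) (j0 : nat) :
  rapid q c -> (forall i j, q i = q j -> i = j) ->
  coef (trig q c) (q j0) = (RtoC ((2 * PI) ^ 2) * c j0)%C.
Proof.
  intros Hc Hq.
  destruct (embed_trig q c (expi (kopp (q j0))) 1 Hc) as [E Hs].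
  - apply continuous_expi.
  - intros p; rewrite Cmod_expi; lra.
  - unfold embed in E. unfold coef at 1. rewrite E.
    rewrite (CSeries_single _ j0 Hs).
    + rewrite coef_expi_same. ring.
    + intros j Hj. rewrite coef_expi_diff; [ring|].
      intros Ek. apply Hj, Hq. rewrite <- (kopp_kopp (q j)), <- Ek. now rewrite kopp_kopp.
Qed.

(** * Weight sequences and decay of coefficients *)

(** The integers, and then the lattice, are enumerated by natural numbers so
    that every series over the lattice is an ordinary series. *)
Definition zdec (n : nat) : Z :=
  if Nat.even n then Z.of_nat (Nat.div2 n) else (- Z.of_nat (Nat.div2 n) - 1)%Z.

Definition zenc (z : Z) : nat :=
  if Z.leb 0 z then (2 * Z.to_nat z)%nat else (2 * Z.to_nat (- z - 1) + 1)%nat.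

Lemma zdec_zenc (z : Z) : zdec (zenc z) = z.
Proof.
  unfold zdec, zenc. destruct (Z.leb_spec 0 z).
  - rewrite Nat.even_mul. simpl orb. rewrite Nat.div2_double. lia.
  - rewrite Nat.even_add, Nat.even_mul. simpl.
    replace (Z.to_nat (- z - 1) + (Z.to_nat (- z - 1) + 0) + 1)%nat
      with (S (2 * Z.to_nat (- z - 1))) by lia.
    rewrite Nat.div2_succ_double. lia.
Qed.

Lemma zenc_zdec (n : nat) : zenc (zdec n) = n.
Proof.
  unfold zdec, zenc. pose proof (Nat.div2_odd n) as E.
  rewrite <- Nat.negb_even in E.
  destruct (Nat.even n); simpl in E.
  - destruct (Z.leb_spec 0 (Z.of_nat (Nat.div2 n))); lia.
  - destruct (Z.leb_spec 0 (- Z.of_nat (Nat.div2 n) - 1)); lia.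
Qed.

Lemma zenc_le (z : Z) : INR (zenc z) <= 2 * Rabs (IZR z).
Proof.
  rewrite <- abs_IZR, INR_IZR_INZ, <- mult_IZR. apply IZR_le.
  unfold zenc. destruct (Z.leb_spec 0 z); lia.
Qed.

Definition freq (j : nat) : Z * Z :=
  (zdec (fst (Cantor.of_nat j)), zdec (snd (Cantor.of_nat j))).

Definition freq_inv (k : Z * Z) : nat := Cantor.to_nat (zenc (fst k), zenc (snd k)).

Lemma freq_freq_inv (k : Z * Z) : freq (freq_inv k) = k.
Proof.
  unfold freq, freq_inv. rewrite Cantor.cancel_of_to. simpl.
  rewrite !zdec_zenc. now destruct k.
Qed.

Lemma freq_inv_freq (j : nat) : freq_inv (freq j) = j.
Proof.
  unfold freq, freq_inv; cbn [fst snd]. rewrite !zenc_zdec, <- surjective_pairing.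
  apply Cantor.cancel_to_of.
Qed.

Lemma freq_inj (i j : nat) : freq i = freq j -> i = j.
Proof. intros H. rewrite <- (freq_inv_freq i), H. apply freq_inv_freq. Qed.

(** Only the first [O(R^2)] terms can lie in the ball of radius [R]. *)
Definition spread (q : nat -> Z * Z) : Prop :=
  forall j, INR j + 1 <= 16 * (1 + knorm (q j)) ^ 2.

Lemma spread_freq : spread freq.
Proof.
  intros j.
  pose proof (zenc_le (fst (freq j))) as Ha. pose proof (zenc_le (snd (freq j))) as Hb.
  pose proof (prj_le_knorm true (freq j)) as Hka.
  pose proof (prj_le_knorm false (freq j)) as Hkb.
  unfold prj in Hka, Hkb.
  assert (E : freq_inv (freq j) = j) by apply freq_inv_freq.
  unfold freq_inv in E.
  pose proof (Cantor.to_nat_spec (zenc (fst (freq j))) (zenc (snd (freq j)))) as S.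
  rewrite E in S.
  set (a := zenc (fst (freq j))) in *. set (b := zenc (snd (freq j))) in *.
  assert (S' : INR j * 2 = INR b * 2 + (INR b + INR a) * (INR b + INR a + 1)).
  { apply (f_equal INR) in S. rewrite plus_INR, !mult_INR, !S_INR, !plus_INR in S.
    simpl INR in S. lra. }
  pose proof (pos_INR a). pose proof (pos_INR b).
  assert (H1 : INR a + INR b <= 4 * knorm (freq j)) by lra.
  nra.
Qed.

(** Four powers of the frequency dominate the square of the index, enough for
    summability. *)
Lemma spread_sq (q : nat -> Z * Z) (j : nat) : spread q ->
  (INR j + 1) ^ 2 <= 256 * 16 * (1 + knorm (q j) ^ 4).
Proof.
  intros Hq. set (x := knorm (q j)). pose proof (pos_INR j).
  apply Rle_trans with ((16 * (1 + x) ^ 2) ^ 2).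
  - apply pow_incr. split; [lra|]. apply Hq.
  - replace ((16 * (1 + x) ^ 2) ^ 2) with (256 * ((1 + x) ^ 2) ^ 2) by ring.
    assert ((1 + x) ^ 2 <= 2 * (1 + x ^ 2)) by (pose proof (pow2_ge_0 (1 - x)); nra).
    assert (((1 + x) ^ 2) ^ 2 <= (2 * (1 + x ^ 2)) ^ 2).
    { apply pow_incr. split; [apply pow2_ge_0|assumption]. }
    pose proof (pow2_ge_0 (1 - x ^ 2)). nra.
Qed.

Lemma spread_opp (q : nat -> Z * Z) : spread q -> spread (fun j => kopp (q j)).
Proof. intros H j. rewrite knorm_opp. apply H. Qed.

(** Attaching the factorial to [m n] turns the estimates below into
    statements about a single sequence of moderate growth. *)
Definition weight (m : nat -> R) (n : nat) : R := m n * INR (fact n).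

(** Log-convexity makes the quotients of consecutive terms increase, and the
    first quotient is one. *)
Lemma ws_ge_1 (m : nat -> R) : weight_sequence m -> forall n, 1 <= m n.
Proof.
  intros Hm.
  assert (H : forall n, 1 <= m n /\ m n <= m (S n)).
  { induction n as [|n [IH1 IH2]].
    - rewrite (ws_0 m Hm), (ws_1 m Hm). lra.
    - split; [lra|].
      pose proof (ws_log_convex m Hm (S n) ltac:(lia)) as H.
      replace (S n - 1)%nat with n in H by lia. replace (S n + 1)%nat with (S (S n)) in H by lia.
      pose proof (ws_pos m Hm (S (S n))). pose proof (ws_pos m Hm (S n)).
      assert (m n * m (S (S n)) <= m (S n) * m (S (S n))) by (apply Rmult_le_compat_r; lra).
      nra. }
  intros n; apply H.
Qed.

Lemma weight_ge_1 (m : nat -> R) : weight_sequence m -> forall n, 1 <= weight m n.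
Proof.
  intros Hm n. unfold weight. pose proof (ws_ge_1 m Hm n).
  assert (1 <= INR (fact n)).
  { change 1 with (INR 1). apply le_INR. pose proof (lt_O_fact n); lia. }
  nra.
Qed.

(** Binomial coefficients are at most [2 ^ (j + k)]; the induction is the
    Pascal rule. *)
Lemma fact_add_le (j k : nat) :
  INR (fact (j + k)) <= 2 ^ (j + k) * INR (fact j) * INR (fact k).
Proof.
  remember (j + k)%nat as s eqn:Hs. revert j k Hs.
  induction s as [|s IH]; intros j k Hs.
  - destruct j, k; try lia. simpl; lra.
  - assert (P : forall n, 1 <= INR (fact n)).
    { intros n; change 1 with (INR 1). apply le_INR. pose proof (lt_O_fact n); lia. }
    assert (P2 : 1 <= 2 ^ S s) by (apply pow_R1_Rle; lra).
    destruct j as [|j]; [|destruct k as [|k]].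
    + simpl in Hs; subst k. pose proof (P (S s)).
      replace (INR (fact 0)) with 1 by reflexivity. nra.
    + replace j with s by lia. pose proof (P (S s)).
      replace (INR (fact 0)) with 1 by reflexivity. nra.
    + pose proof (IH j (S k) ltac:(lia)) as I1. pose proof (IH (S j) k ltac:(lia)) as I2.
      assert (F : forall n, INR (fact (S n)) = (INR n + 1) * INR (fact n)).
      { intros n. rewrite fact_simpl, mult_INR, S_INR. reflexivity. }
      rewrite (F s). replace (INR s) with (INR j + INR k + 1)
        by (rewrite <- plus_INR, <- S_INR; f_equal; lia).
      rewrite !F in *. pose proof (pos_INR j). pose proof (pos_INR k).
      apply Rmult_le_compat_l with (r := INR j + 1) in I1; [|lra].
      apply Rmult_le_compat_l with (r := INR k + 1) in I2; [|lra].
      simpl pow. lra.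
Qed.

Lemma weight_moderate (m : nat -> R) : weight_sequence m ->
  exists B, 1 <= B /\ forall j k, weight m (j + k) <= B ^ (j + k) * weight m j * weight m k.
Proof.
  intros Hm. destruct (ws_moderate_growth m Hm) as (H & H1 & HH).
  exists (2 * H). split; [lra|]. intros j k. unfold weight.
  rewrite Rpow_mult_distr.
  replace (2 ^ (j + k) * H ^ (j + k) * (m j * INR (fact j)) * (m k * INR (fact k)))
    with ((H ^ (j + k) * m j * m k) * (2 ^ (j + k) * INR (fact j) * INR (fact k))) by ring.
  apply Rmult_le_compat; auto using fact_add_le, pos_INR.
  left; apply (ws_pos m Hm).
Qed.

(** Membership of the class, read on coefficients; asking for all [n] at once
    amounts to a bound by the infimum over [n], the associated function of
    the weight. *)
Definition decay (m : nat -> R) (q : nat -> Z * Z) (c : nat -> C) : Prop :=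
  exists K A, 0 < K /\ 1 <= A /\
    forall j n, Cmod (c j) * knorm (q j) ^ n <= K * A ^ n * weight m n.

(** Moderate growth lets a decaying family absorb a polynomial factor, which
    makes it summable with all its weights. *)
Lemma decay_summable (m : nat -> R) (q : nat -> Z * Z) (c : nat -> C) :
  weight_sequence m -> spread q -> decay m q c ->
  exists K A, 0 < K /\ 1 <= A /\ forall j n,
    Cmod (c j) * knorm (q j) ^ n <= K * A ^ n * weight m n * / (INR j + 1) ^ 2.
Proof.
  intros Hm Hq (K & A & HK & HA & Hd).
  destruct (weight_moderate m Hm) as (B & HB & HB').
  pose proof (weight_ge_1 m Hm) as W1.
  assert (HBA : 1 <= B * A) by nra.
  exists (256 * 16 * K * (1 + (B * A) ^ 4 * weight m 4)), (B * A).
  pose proof (W1 4%nat) as W4.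
  assert (P4 : 1 <= (B * A) ^ 4) by now apply pow_R1_Rle.
  split; [|split; [exact HBA|]].
  { apply Rmult_lt_0_compat; nra. }
  intros j n. set (x := knorm (q j)). pose proof (knorm_pos (q j)) as Hx. fold x in Hx.
  pose proof (Hd j n) as D0. pose proof (Hd j (n + 4)%nat) as D4. fold x in D0, D4.
  pose proof (HB' n 4%nat) as HW. pose proof (Cmod_ge_0 (c j)) as Hc.
  set (z := Cmod (c j)) in *.
  assert (Hj : 0 < INR j + 1) by (pose proof (pos_INR j); lra).
  pose proof (spread_sq q j Hq) as Hj2. fold x in Hj2.
  apply Rmult_le_reg_r with ((INR j + 1) ^ 2); [now apply pow_lt|].
  rewrite (Rmult_assoc _ (/ (INR j + 1) ^ 2)), Rinv_l, Rmult_1_r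
    by (apply pow_nonzero; lra).
  assert (Hzx : 0 <= z * x ^ n) by (apply Rmult_le_pos; auto using pow_le).
  apply Rle_trans with (256 * 16 * (z * x ^ n + z * x ^ (n + 4))).
  { rewrite pow_add.
    replace (256 * 16 * (z * x ^ n + z * (x ^ n * x ^ 4)))
      with (z * x ^ n * (256 * 16 * (1 + x ^ 4))) by ring.
    now apply Rmult_le_compat_l. }
  assert (An : 0 < A ^ n) by (apply pow_lt; lra).
  assert (A4 : 0 < A ^ (n + 4)) by (apply pow_lt; lra).
  assert (X1 : A ^ n <= (B * A) ^ n) by (apply pow_incr; nra).
  assert (X4 : A ^ (n + 4) * B ^ (n + 4) = (B * A) ^ n * (B * A) ^ 4).
  { rewrite <- pow_add, <- Rpow_mult_distr. f_equal. ring. }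
  assert (D0' : z * x ^ n <= K * (B * A) ^ n * weight m n).
  { eapply Rle_trans; [exact D0|]. pose proof (W1 n).
    apply Rmult_le_compat_r; [lra|]. apply Rmult_le_compat_l; lra. }
  assert (D4' : z * x ^ (n + 4) <= K * (B * A) ^ n * weight m n * ((B * A) ^ 4 * weight m 4)).
  { eapply Rle_trans; [exact D4|].
    apply Rle_trans with (K * A ^ (n + 4) * (B ^ (n + 4) * weight m n * weight m 4)).
    - apply Rmult_le_compat_l; [|exact HW]. apply Rmult_le_pos; lra.
    - right. replace (K * A ^ (n + 4) * (B ^ (n + 4) * weight m n * weight m 4))
        with (K * (A ^ (n + 4) * B ^ (n + 4)) * weight m n * weight m 4) by ring.
      rewrite X4. ring. }
  lra.
Qed.

Lemma rapid_decay (m : nat -> R) (q : nat -> Z * Z) (c : nat -> C) :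
  weight_sequence m -> spread q -> decay m q c -> rapid q c.
Proof.
  intros Hm Hq Hd. destruct (decay_summable m q c Hm Hq Hd) as (K & A & HK & HA & H).
  intros n.
  apply (ex_series_bound _ (fun j => 2 ^ n * (K * A ^ 0 * weight m 0 + K * A ^ n * weight m n)
     * / (INR j + 1) ^ 2)); [|apply ex_series_scal_l, ex_series_inv_sq].
  intros j. pose proof (knorm_pos (q j)) as Hx. pose proof (Cmod_ge_0 (c j)) as Hz.
  set (x := knorm (q j)) in *.
  rewrite Rabs_pos_eq by (apply Rmult_le_pos; [auto|apply pow_le; lra]).
  pose proof (H j 0%nat) as H0. pose proof (H j n) as Hn. fold x in H0, Hn.
  assert (Hp : (1 + x) ^ n <= 2 ^ n * (x ^ 0 + x ^ n)).
  { assert (0 <= x ^ n) by (apply pow_le; lra).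
    assert (0 < 2 ^ n) by (apply pow_lt; lra).
    destruct (Rle_lt_dec x 1).
    - apply Rle_trans with (2 ^ n); [apply pow_incr; lra|]. simpl; nra.
    - apply Rle_trans with ((2 * x) ^ n); [apply pow_incr; lra|].
      rewrite Rpow_mult_distr. simpl; nra. }
  eapply Rle_trans; [apply Rmult_le_compat_l; [apply Hz|apply Hp]|].
  assert (0 < 2 ^ n) by (apply pow_lt; lra). nra.
Qed.

(** * Ultradifferentiable functions and their Fourier series *)

(** The unfolded form of a norm of the step with parameter [h] being at most
    [B]. *)
Definition deriv_bound (m : nat -> R) (h B : R) (f : Fn) : Prop :=
  forall x g, Cmod (Dmulti g f x) <= B * h ^ order g * weight m (order g).

Lemma EM_intro (m : nat -> R) (f : Fn) (h B : R) :
  smooth_torus f -> 0 < B -> 0 < h -> deriv_bound m h B f -> EM m f.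
Proof.
  intros Hf HB Hh H. split; auto. exists B, h. split; [|split]; auto.
  intros x g. rewrite Rmult_assoc. apply H.
Qed.

Lemma EM_elim (m : nat -> R) (f : Fn) : EM m f ->
  smooth_torus f /\ exists h B, 0 < h /\ 0 < B /\ deriv_bound m h B f.
Proof.
  intros [Hf (c & h & Hc & Hh & H)]. split; auto. exists h, c.
  split; [|split]; auto. intros x g. unfold weight. rewrite <- Rmult_assoc. apply H.
Qed.

Lemma weight_pos (m : nat -> R) (n : nat) : weight_sequence m -> 0 < weight m n.
Proof. intros Hm. pose proof (weight_ge_1 m Hm n). lra. Qed.

Lemma deriv_bound_weaken (m : nat -> R) (h h' B B' : R) (f : Fn) :
  weight_sequence m -> 0 < h <= h' -> 0 <= B <= B' ->
  deriv_bound m h B f -> deriv_bound m h' B' f.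
Proof.
  intros Hm Hh HB H x g. eapply Rle_trans; [apply H|].
  pose proof (weight_pos m (order g) Hm).
  assert (0 < h ^ order g) by (apply pow_lt; lra).
  assert (h ^ order g <= h' ^ order g) by (apply pow_incr; lra).
  apply Rmult_le_compat_r; [lra|]. apply Rmult_le_compat; lra.
Qed.

Lemma deriv_bound_lin (m : nat -> R) (h B B' : R) (f g : Fn) (a b : C) :
  smooth_torus f -> smooth_torus g ->
  deriv_bound m h B f -> deriv_bound m h B' g ->
  deriv_bound m h (Cmod a * B + Cmod b * B') (lin_comb a f b g).
Proof.
  intros Sf Sg Hf Hg x o. rewrite Dmulti_lin by assumption. unfold lin_comb.
  eapply Rle_trans; [apply Cmod_triangle|]. rewrite !Cmod_mult.
  specialize (Hf x o); specialize (Hg x o).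
  apply Rmult_le_compat_l with (r := Cmod a) in Hf; [|apply Cmod_ge_0].
  apply Rmult_le_compat_l with (r := Cmod b) in Hg; [|apply Cmod_ge_0].
  lra.
Qed.

(** Two elements need not lie in the same step; the sum of the two parameters
    serves both. *)
Lemma EM_lin (m : nat -> R) (f g : Fn) (a b : C) : weight_sequence m ->
  EM m f -> EM m g -> EM m (lin_comb a f b g).
Proof.
  intros Hm Hf Hg.
  apply EM_elim in Hf; destruct Hf as (Sf & h & B & Hh & HB & Df).
  apply EM_elim in Hg; destruct Hg as (Sg & h' & B' & Hh' & HB' & Dg).
  pose proof (Cmod_ge_0 a). pose proof (Cmod_ge_0 b).
  apply (EM_intro m _ (h + h') (Cmod a * B + Cmod b * B' + 1)).
  - now apply smooth_lin.
  - assert (0 <= Cmod a * B) by (apply Rmult_le_pos; lra).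
    assert (0 <= Cmod b * B') by (apply Rmult_le_pos; lra). lra.
  - lra.
  - apply (deriv_bound_weaken m (h + h') _ (Cmod a * B + Cmod b * B')); auto.
    + lra.
    + assert (0 <= Cmod a * B) by (apply Rmult_le_pos; lra).
      assert (0 <= Cmod b * B') by (apply Rmult_le_pos; lra). lra.
    + apply deriv_bound_lin; auto.
      * apply (deriv_bound_weaken m h _ B); auto; lra.
      * apply (deriv_bound_weaken m h' _ B'); auto; lra.
Qed.

Lemma EM_bounded (m : nat -> R) (f : Fn) :
  EM m f -> exists M, forall p, Cmod (f p) <= M.
Proof.
  intros Hf. apply EM_elim in Hf; destruct Hf as (Sf & h & B & Hh & HB & Df).
  eexists; intros p. apply (Df p (0, 0)%nat).
Qed.

(** ** Characters *)

Lemma has_partial_scal_expi (b : bool) (a : C) (k : Z * Z) (p : R * R) :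
  has_partial b (fun p => a * expi k p)%C p (Ci * (RtoC (IZR (prj b k)) * a * expi k p))%C.
Proof.
  replace (fun p => a * expi k p)%C with (lin_comb a (expi k) 0 (expi k)).
  2: { apply functional_extensionality; intros x; unfold lin_comb; ring. }
  replace (Ci * (RtoC (IZR (prj b k)) * a * expi k p))%C with
    (a * (Ci * (RtoC (IZR (prj b k)) * expi k p)) + 0 * (Ci * (RtoC (IZR (prj b k)) * expi k p)))%C
    by ring.
  apply has_partial_lin; apply has_partial_expi.
Qed.

Lemma Ddir_scal_expi (b : bool) (a : C) (k : Z * Z) :
  Ddir b (fun p => a * expi k p)%C = (fun p => RtoC (IZR (prj b k)) * a * expi k p)%C.
Proof. apply Ddir_eq. intros p. apply has_partial_scal_expi. Qed.

Lemma Ddir_expi (b : bool) (k : Z * Z) :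
  Ddir b (expi k) = (fun p => RtoC (IZR (prj b k)) * expi k p)%C.
Proof. apply Ddir_eq. intros p. apply has_partial_expi. Qed.

Lemma iter_Ddir_scal_expi (b : bool) (n : nat) (a : C) (k : Z * Z) :
  Nat.iter n (Ddir b) (fun p => a * expi k p)%C
  = (fun p => RtoC (IZR (prj b k) ^ n) * a * expi k p)%C.
Proof.
  induction n as [|n IH]; simpl.
  - apply functional_extensionality; intros p. ring.
  - rewrite IH, Ddir_scal_expi. apply functional_extensionality; intros p.
    rewrite RtoC_mult. ring.
Qed.

Lemma smooth_expi (k : Z * Z) : smooth_torus (expi k).
Proof.
  split; [apply periodic_expi|].
  induction k0 as [|n IH]; [apply continuous_expi|].
  apply (Ck_step n _ (fun b => lin_comb (Ci * RtoC (IZR (prj b k))) (expi k) 0 (expi k))).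
  - apply continuous_expi.
  - intros b p. unfold lin_comb.
    replace (Ci * RtoC (IZR (prj b k)) * expi k p + 0 * expi k p)%C
      with (Ci * (RtoC (IZR (prj b k)) * expi k p))%C by ring.
    apply has_partial_expi.
  - intros b. now apply Ck_lin.
Qed.

Lemma Dmulti_expi_bound (k : Z * Z) (g : nat * nat) (x : R * R) :
  Cmod (Dmulti g (expi k) x) <= knorm k ^ order g.
Proof.
  assert (E : expi k = (fun p => 1 * expi k p)%C).
  { apply functional_extensionality; intros p; ring. }
  rewrite E, Dmulti_iter, !iter_Ddir_scal_expi, !Cmod_mult, !Cmod_R, Cmod_expi, Rabs_R1.
  rewrite !Rmult_1_r, <- !RPow_abs. unfold order. rewrite pow_add.
  apply Rmult_le_compat; try (apply pow_le, Rabs_pos);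
    apply pow_incr; split; try apply Rabs_pos.
  - apply (prj_le_knorm true).
  - apply (prj_le_knorm false).
Qed.

Lemma EM_expi (m : nat -> R) (k : Z * Z) : weight_sequence m -> EM m (expi k).
Proof.
  intros Hm. pose proof (knorm_pos k).
  apply (EM_intro m _ (1 + knorm k) 1); try lra; [apply smooth_expi|].
  intros x g. eapply Rle_trans; [apply Dmulti_expi_bound|].
  assert (knorm k ^ order g <= (1 + knorm k) ^ order g) by (apply pow_incr; lra).
  assert (0 < (1 + knorm k) ^ order g) by (apply pow_lt; lra).
  pose proof (weight_ge_1 m Hm (order g)). nra.
Qed.

(** ** Trigonometric series with decaying coefficients *)

(** One parameter [A] serves the series, its terms and its remainders; the
    remainders have small norm in that step because a summable series has
    small tails. *)
Lemma trig_tail_bound (m : nat -> R) (q : nat -> Z * Z) (c : nat -> C) :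
  weight_sequence m -> spread q -> decay m q c ->
  exists K A, 0 < K /\ 1 <= A /\
   (forall j, deriv_bound m A (K * / (INR j + 1) ^ 2) (fun p => c j * expi (q j) p)%C) /\
   forall n, deriv_bound m A (K * Series (tail 0 n (fun j => / (INR j + 1) ^ 2)))
      (trig q (tail (RtoC 0) n c)).
Proof.
  intros Hm Hq Hd. destruct (decay_summable m q c Hm Hq Hd) as (K & A & HK & HA & H).
  exists (2 * K), A. split; [lra|]. split; [lra|]. split.
  - intros j x g.
    replace (fun p => c j * expi (q j) p)%C with (lin_comb (c j) (expi (q j)) 0 (expi (q j))).
    2: { apply functional_extensionality; intros p; unfold lin_comb; ring. }
    rewrite Dmulti_lin by apply smooth_expi. unfold lin_comb.
    rewrite Cmult_0_l, Cplus_0_r, Cmod_mult.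
    eapply Rle_trans; [apply Rmult_le_compat_l; [apply Cmod_ge_0|apply Dmulti_expi_bound]|].
    eapply Rle_trans; [apply H|].
    pose proof (weight_pos m (order g) Hm). pose proof (pos_INR j).
    assert (0 < / (INR j + 1) ^ 2) by (apply Rinv_0_lt_compat, pow_lt; lra).
    assert (0 < A ^ order g) by (apply pow_lt; lra).
    set (v := / (INR j + 1) ^ 2) in *.
    assert (0 <= K * A ^ order g * weight m (order g) * v)
      by (apply Rmult_le_pos; [|lra]; apply Rmult_le_pos; [|lra];
          apply Rmult_le_pos; lra).
    lra.
  - intros n x g.
    set (s := K * A ^ order g * weight m (order g)).
    replace (2 * K * Series (tail 0 n (fun j => / (INR j + 1) ^ 2)) * A ^ order g
       * weight m (order g))
      with (2 * Series (fun j => s * tail 0 n (fun j => / (INR j + 1) ^ 2) j)).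
    2: { rewrite Series_scal_l. unfold s. ring. }
    apply Dmulti_trig_bound.
    + now apply rapid_tail, (rapid_decay m).
    + apply ex_series_scal_l, ex_series_tail, ex_series_inv_sq.
    + intros j. unfold tail. destruct (Nat.ltb j n).
      * rewrite Cmod_0. lra.
      * apply H.
Qed.

Lemma EM_trig (m : nat -> R) (q : nat -> Z * Z) (c : nat -> C) :
  weight_sequence m -> spread q -> decay m q c -> EM m (trig q c).
Proof.
  intros Hm Hq Hd. destruct (trig_tail_bound m q c Hm Hq Hd) as (K & A & HK & HA & _ & H).
  set (S := Series (fun j => / (INR j + 1) ^ 2)).
  assert (HS : 0 <= S).
  { unfold S. rewrite <- (Rmult_0_l (Series (fun j => / (INR j + 1) ^ 2))).
    rewrite <- Series_scal_l. apply Series_le; [|apply ex_series_inv_sq].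
    intros j. pose proof (pos_INR j).
    assert (0 < / (INR j + 1) ^ 2) by (apply Rinv_0_lt_compat, pow_lt; lra). lra. }
  assert (HKS : 0 <= K * S) by (apply Rmult_le_pos; lra).
  apply (EM_intro m _ A (K * S + 1)); try lra.
  - now apply smooth_trig, (rapid_decay m).
  - apply (deriv_bound_weaken m A _ (K * S)); auto; try lra. apply (H 0%nat).
Qed.

Lemma decay_coef (m : nat -> R) (q : nat -> Z * Z) (f : Fn) (B h : R) :
  weight_sequence m -> smooth_torus f -> 0 < B -> 0 < h -> deriv_bound m h B f ->
  forall k n, Cmod (coef f k) * knorm k ^ n
     <= 2 * (2 * PI) ^ 2 * B * h ^ n * weight m n.
Proof.
  intros Hm Sf HB Hh Df k n.
  rewrite !(Rmult_assoc (2 * (2 * PI) ^ 2)). apply coef_decay; auto.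
  intros p g <-. apply Df.
Qed.

Lemma decay_scal (m : nat -> R) (q : nat -> Z * Z) (a : C) (c : nat -> C) :
  weight_sequence m -> decay m q c -> decay m q (fun j => a * c j)%C.
Proof.
  intros Hm (K & A & HK & HA & H).
  pose proof (Cmod_ge_0 a).
  exists ((Cmod a + 1) * K), A. split; [apply Rmult_lt_0_compat; lra|]. split; auto.
  intros j n. rewrite Cmod_mult.
  pose proof (weight_pos m n Hm). assert (0 < A ^ n) by (apply pow_lt; lra).
  specialize (H j n).
  apply Rmult_le_compat_l with (r := Cmod a) in H; auto.
  assert (0 <= K * A ^ n * weight m n)
    by (apply Rmult_le_pos; [|lra]; apply Rmult_le_pos; lra).
  lra.
Qed.

Lemma decay_tail (m : nat -> R) (q : nat -> Z * Z) (c : nat -> C) (i : nat) :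
  decay m q c -> decay m q (tail (RtoC 0) i c).
Proof.
  intros (K & A & HK & HA & H). exists K, A. split; auto. split; auto.
  intros j n. eapply Rle_trans; [|apply H].
  apply Rmult_le_compat_r; [apply pow_le, knorm_pos|].
  unfold tail. destruct (Nat.ltb j i); [rewrite Cmod_0; apply Cmod_ge_0|apply Rle_refl].
Qed.

Lemma EM_coef_decay (m : nat -> R) (q : nat -> Z * Z) (f : Fn) :
  weight_sequence m -> EM m f -> decay m q (fun j => coef f (q j)).
Proof.
  intros Hm Hf. apply EM_elim in Hf; destruct Hf as (Sf & h & B & Hh & HB & Df).
  assert (HP : 0 < 2 * (2 * PI) ^ 2).
  { pose proof two_pi_pos. assert (0 < (2 * PI) ^ 2) by now apply pow_lt. lra. }
  exists (2 * (2 * PI) ^ 2 * B), (1 + h).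
  split; [now apply Rmult_lt_0_compat|]. split; [lra|].
  intros j n. apply (decay_coef m q); auto; try lra.
  apply (deriv_bound_weaken m h _ B); auto; lra.
Qed.

(** The series is continuous and has the same coefficients as [f], so
    uniqueness applies to the difference. *)
Lemma Fourier_inversion (m : nat -> R) (f : Fn) : weight_sequence m -> EM m f ->
  f = trig freq (fun j => RtoC (/ (2 * PI) ^ 2) * coef f (freq j))%C.
Proof.
  intros Hm Hf. set (c := fun j => (RtoC (/ (2 * PI) ^ 2) * coef f (freq j))%C).
  assert (Hd : decay m freq c) by now apply decay_scal, EM_coef_decay.
  assert (Hc : rapid freq c) by (apply (rapid_decay m); auto using spread_freq).
  destruct (EM_bounded m f Hf) as [M HM].
  assert (Sf : smooth_torus f) by apply Hf.
  assert (Sg : smooth_torus (trig freq c)) by now apply smooth_trig.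
  assert (Hz : forall p, lin_comb 1 f (- (1)) (trig freq c) p = 0).
  { apply (Fourier_uniqueness _ (M + 2 * Series (fun j => Cmod (c j)))).
    - apply continuous_Fn_lin; now apply smooth_continuous.
    - apply periodic_lin; [apply Sf|apply Sg].
    - intros p. unfold lin_comb.
      eapply Rle_trans; [apply Cmod_triangle|].
      rewrite !Cmod_mult, Cmod_1, Cmod_m1, !Rmult_1_l.
      apply Rplus_le_compat; auto. now apply trig_bound, (rapid_summable freq).
    - intros k. rewrite coef_lin by now apply smooth_continuous.
      rewrite <- (freq_freq_inv k). rewrite coef_trig; auto using freq_inj.
      unfold c. pose proof two_pi_pos.
      rewrite (Cmult_assoc (RtoC _) (RtoC _)), <- RtoC_mult, Rinv_r by (apply pow_nonzero; lra). ring. }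
  apply functional_extensionality; intros p. specialize (Hz p). unfold lin_comb in Hz.
  apply Ceq_minus. rewrite <- Hz. ring.
Qed.

(** * Ultradistributions *)

Lemma EM_scal (m : nat -> R) (a : C) (f : Fn) : weight_sequence m -> EM m f ->
  EM m (fun p => a * f p)%C.
Proof.
  intros Hm Hf. replace (fun p => a * f p)%C with (lin_comb a f 0 f).
  - now apply EM_lin.
  - apply functional_extensionality; intros p; unfold lin_comb; ring.
Qed.

Lemma linear_scal (m : nat -> R) (u : Functional) (a : C) (f : Fn) :
  linear_EM m u -> EM m f -> u (fun p => a * f p)%C = (a * u f)%C.
Proof.
  intros Hu Hf. replace (fun p => a * f p)%C with (lin_comb a f 0 f).
  - rewrite Hu by assumption. ring.
  - apply functional_extensionality; intros p; unfold lin_comb; ring.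
Qed.

Lemma linear_zero (m : nat -> R) (u : Functional) : weight_sequence m ->
  linear_EM m u -> EM m (fun _ => 0) /\ u (fun _ => 0) = 0.
Proof.
  intros Hm Hu. pose proof (EM_expi m (0, 0)%Z Hm) as He.
  assert (E : (fun _ : R * R => RtoC 0) = (fun p => 0 * expi (0, 0)%Z p)%C).
  { apply functional_extensionality; intros p; ring. }
  rewrite E. split; [now apply EM_scal|].
  rewrite (linear_scal m) by assumption. ring.
Qed.

Lemma norm_Mh_le (m : nat -> R) (h B : R) (f : Fn) : weight_sequence m -> 0 < h ->
  deriv_bound m h B f -> Rbar_le (norm_Mh m h f) B.
Proof.
  intros Hm Hh H. unfold norm_Mh. apply Lub_Rbar_correct.
  intros r (x & g & ->). simpl.
  pose proof (ws_pos m Hm (order g)).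
  assert (0 < INR (fact (order g))) by apply INR_fact_lt_0.
  assert (0 < h ^ order g) by now apply pow_lt.
  apply Rle_div_l.
  - repeat apply Rmult_lt_0_compat; auto.
  - specialize (H x g). unfold weight in H. lra.
Qed.

Lemma norm_Mh_ge (m : nat -> R) (h B : R) (f : Fn) : weight_sequence m -> 0 < h ->
  Rbar_le (norm_Mh m h f) B -> deriv_bound m h B f.
Proof.
  intros Hm Hh H x g.
  pose proof (ws_pos m Hm (order g)).
  assert (0 < INR (fact (order g))) by apply INR_fact_lt_0.
  assert (0 < h ^ order g) by now apply pow_lt.
  assert (Hr : Rbar_le (Cmod (Dmulti g f x) / (h ^ order g * m (order g) * INR (fact (order g)))) B).
  { eapply Rbar_le_trans; [|exact H]. apply (proj1 (Lub_Rbar_correct _)).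
    exists x, g. reflexivity. }
  simpl in Hr. apply Rle_div_l in Hr.
  - unfold weight. lra.
  - repeat apply Rmult_lt_0_compat; auto.
Qed.

(** A continuous functional is bounded on every step: continuity at the origin
    gives a ball of the step on which it is at most one. *)
Lemma continuous_step_bound (m h : nat -> R) (u : Functional) (N : nat) :
  weight_sequence m -> admissible_steps h -> ultradistribution m h u ->
  exists K, 0 < K /\ forall f B, EM m f -> 0 <= B ->
    deriv_bound m (h N) B f -> Cmod (u f) <= K * B.
Proof.
  intros Hm Hh [Hl Hc].
  destruct (linear_zero m u Hm Hl) as [E0 u0].
  assert (HhN : 0 < h N) by apply Hh.
  destruct (Hc (fun z => Cmod z < 1)) as [_ HU].
  { intros z Hz. assert (Hz' : 0 < (1 - Cmod z) / 2) by lra.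
    exists (mkposreal _ Hz'). intros w [W1 W2]. simpl in W1, W2.
    assert (Hw : Cmod (w - z) < 2 * ((1 - Cmod z) / 2)).
    { eapply Rle_lt_trans; [apply Cmod_le_sum|].
      unfold ball in W1, W2; simpl in W1, W2.
      unfold AbsRing_ball, abs, minus, plus, opp in W1, W2; simpl in W1, W2.
      unfold Re, Im; simpl. lra. }
    replace w with (z + (w - z))%C by ring.
    eapply Rle_lt_trans; [apply Cmod_triangle|]. lra. }
  destruct (HU (fun _ => 0)) as (V & (HV1 & HV2 & HV3) & HV).
  { split; auto. rewrite u0, Cmod_0. lra. }
  destruct (HV3 N) as (d & Hd & HdV).
  assert (H1 : forall f, EM m f -> deriv_bound m (h N) (d / 2) f -> Cmod (u f) < 1).
  { intros f Hf HB.
    assert (HVf : V f).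
    { pose proof (norm_Mh_le m (h N) (d / 2) f Hm HhN HB) as Hn.
      apply HdV.
      - split; [apply Hf|]. eapply Rbar_le_lt_trans; [exact Hn|]. easy.
      - eapply Rbar_le_lt_trans; [exact Hn|]. simpl; lra. }
    destruct (HV f HVf) as [_ A].
    replace (fun p => 0 + f p)%C with f in A; [exact A|].
    apply functional_extensionality; intros p; ring. }
  assert (H2 : forall f B, EM m f -> 0 < B -> deriv_bound m (h N) B f ->
    Cmod (u f) <= 2 / d * B).
  { intros f B Hf HB HD.
    (* the scaling that brings [f] into the ball of radius [d / 2] *)
    set (s := d / (2 * B)).
    assert (Hs : 0 < s) by (apply Rdiv_lt_0_compat; lra).
    pose proof (H1 (fun p => RtoC s * f p)%C (EM_scal m s f Hm Hf)) as A.
    rewrite (linear_scal m) in A by assumption.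
    rewrite Cmod_mult, Cmod_R, Rabs_pos_eq in A by lra.
    assert (A' : s * Cmod (u f) < 1).
    { apply A. replace (fun p => RtoC s * f p)%C with (lin_comb (RtoC s) f 0 f).
      2: { apply functional_extensionality; intros p; unfold lin_comb; ring. }
      replace (d / 2) with (Cmod (RtoC s) * B + Cmod 0 * B).
      - apply deriv_bound_lin; auto; apply Hf.
      - rewrite Cmod_R, Cmod_0, Rabs_pos_eq by lra. unfold s. field. lra. }
    apply Rmult_le_reg_l with s; [assumption|].
    replace (s * (2 / d * B)) with 1 by (unfold s; field; lra). lra. }
  exists (2 / d). assert (Hd2 : 0 < 2 / d) by (apply Rdiv_lt_0_compat; lra).
  split; auto. intros f B Hf HB HD.
  (* a positive slack covers the case [B = 0], where no scaling is possible *)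
  apply le_epsilon. intros t Ht.
  replace (2 / d * B + t) with (2 / d * (B + t * d / 2)) by (field; lra).
  apply H2; auto.
  - assert (0 < t * d) by now apply Rmult_lt_0_compat. lra.
  - assert (0 < t * d) by now apply Rmult_lt_0_compat.
    apply (deriv_bound_weaken m (h N) _ B); auto; lra.
Qed.

(** The sublevel sets of the absolute value of a linear functional are
    absolutely convex; the step bounds make them neighbourhoods in each step. *)
Lemma step_bound_continuous (m h : nat -> R) (u : Functional) :
  weight_sequence m -> admissible_steps h -> linear_EM m u ->
  (forall N, exists K, 0 < K /\ forall f B, EM m f -> 0 < B ->
    deriv_bound m (h N) B f -> Cmod (u f) <= K * B) ->
  ultradistribution m h u.
Proof.
  intros Hm Hh Hl H. split; auto. intros W HW. split; [now intros f [Hf _]|].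
  intros f [Hf Wf]. destruct (HW (u f) Wf) as [eps Heps].
  exists (fun g => EM m g /\ Cmod (u g) < eps). split.
  - split; [now intros g [Hg _]|]. split.
    + intros g1 g2 a b [E1 U1] [E2 U2] Hab. split; [now apply EM_lin|].
      rewrite Hl by assumption.
      eapply Rle_lt_trans; [apply Cmod_triangle|]. rewrite !Cmod_mult.
      pose proof (Cmod_ge_0 a). pose proof (Cmod_ge_0 b).
      pose proof (cond_pos eps).
      set (mx := Rmax (Cmod (u g1)) (Cmod (u g2))).
      assert (Cmod (u g1) <= mx) by apply Rmax_l.
      assert (Cmod (u g2) <= mx) by apply Rmax_r.
      assert (mx < eps) by (now apply Rmax_lub_lt).
      pose proof (Cmod_ge_0 (u g1)).
      assert (Cmod a * Cmod (u g1) <= Cmod a * mx) by (apply Rmult_le_compat_l; lra).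
      assert (Cmod b * Cmod (u g2) <= Cmod b * mx) by (apply Rmult_le_compat_l; lra).
      assert ((Cmod a + Cmod b) * mx <= 1 * mx) by (apply Rmult_le_compat_r; lra).
      lra.
    + intros N. destruct (H N) as (K & HK & HKu).
      assert (Hd : 0 < eps / (2 * K)) by (apply Rdiv_lt_0_compat; [apply cond_pos|lra]).
      exists (eps / (2 * K)). split; auto.
      intros g [Sg Ng] Hlt.
      assert (HhN : 0 < h N) by apply Hh.
      assert (DB : deriv_bound m (h N) (eps / (2 * K)) g).
      { apply norm_Mh_ge; auto. now apply Rbar_lt_le. }
      assert (Eg : EM m g) by now apply (EM_intro m g (h N) (eps / (2 * K))).
      split; auto. eapply Rle_lt_trans; [apply (HKu g _ Eg Hd DB)|].
      replace (K * (eps / (2 * K))) with (eps / 2) by (field; lra).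
      pose proof (cond_pos eps). lra.
  - intros g [Eg Ug].
    replace (fun p => f p + g p)%C with (lin_comb 1 f 1 g).
    2: { apply functional_extensionality; intros p; unfold lin_comb; ring. }
    split; [now apply EM_lin|]. apply Heps. rewrite Hl by assumption.
    split.
    + change (Rabs (Re (1 * u f + 1 * u g)%C - Re (u f)) < eps). eapply Rle_lt_trans; [|exact Ug]. eapply Rle_trans; [|apply Rabs_Re_le].
      right; f_equal. unfold Re, Im; simpl; ring.
    + change (Rabs (Im (1 * u f + 1 * u g)%C - Im (u f)) < eps).
      eapply Rle_lt_trans; [|exact Ug]. eapply Rle_trans; [|apply Rabs_Im_le].
      right; f_equal. unfold Re, Im; simpl; ring.
Qed.

(** The remainders of the Fourier series of a test function tend to zero in
    one of the steps, and there [u] is bounded. In particular an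
    ultradistribution is determined by its values on the characters. *)
Lemma ultradistribution_series (m h : nat -> R) (u : Functional) (f : Fn) :
  weight_sequence m -> admissible_steps h -> ultradistribution m h u -> EM m f ->
  u f = CSeries (fun j => RtoC (/ (2 * PI) ^ 2) * coef f (freq j) * u (expi (freq j)))%C.
Proof.
  intros Hm Hh Hu Hf.
  set (c := fun j => (RtoC (/ (2 * PI) ^ 2) * coef f (freq j))%C).
  assert (Hd : decay m freq c) by now apply decay_scal, EM_coef_decay.
  assert (Hc : rapid freq c) by (apply (rapid_decay m); auto using spread_freq).
  destruct (trig_tail_bound m freq c Hm spread_freq Hd) as (K0 & A & HK0 & HA & Ht & HT).
  assert (HN : exists N, A <= h N).
  { destruct Hh as (_ & _ & Hlim). apply is_lim_seq_spec in Hlim.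
    destruct (Hlim A) as [N HN]. exists N. left. now apply HN. }
  destruct HN as [N HN].
  destruct (continuous_step_bound m h u N Hm Hh Hu) as (K & HK & HKu).
  assert (Hv : forall j, 0 <= / (INR j + 1) ^ 2).
  { intros j. pose proof (pos_INR j). left. apply Rinv_0_lt_compat, pow_lt; lra. }
  assert (HS : forall n, 0 <= Series (tail 0 n (fun j => / (INR j + 1) ^ 2))).
  { intros n. apply Rle_trans with (Rabs (Series (tail (A := R) 0 n (fun j => 0)))).
    - apply Rabs_pos.
    - apply Series_bound; [|apply ex_series_tail, ex_series_inv_sq].
      intros j. unfold tail. specialize (Hv j).
      destruct (Nat.ltb j n); rewrite Rabs_R0; lra. }
  assert (Hu' : forall f B, EM m f -> 0 <= B -> deriv_bound m A B f -> Cmod (u f) <= K * B).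
  { intros g B Eg HB Dg. apply HKu; auto.
    apply (deriv_bound_weaken m A _ B); auto; lra. }
  assert (EMt : forall n, EM m (trig freq (tail (RtoC 0) n c))).
  { intros n. apply EM_trig; auto using spread_freq. now apply decay_tail. }
  replace (u f) with (u (trig freq (tail (RtoC 0) 0 c))).
  2: { rewrite (Fourier_inversion m f Hm Hf). reflexivity. }
  apply (CSeries_telescope _ (fun n => u (trig freq (tail (RtoC 0) n c)))
    (fun n => K * K0 * Series (tail 0 n (fun j => / (INR j + 1) ^ 2)))).
  - apply (abs_summable_bound _ (fun j => K * K0 * / (INR j + 1) ^ 2)).
    + intros j. change (Cmod (c j * u (expi (freq j)))%C <= K * K0 * / (INR j + 1) ^ 2).
      rewrite <- (linear_scal m) by (apply Hu || now apply EM_expi).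
      rewrite Rmult_assoc. apply Hu'; auto.
      * now apply EM_scal, EM_expi.
      * specialize (Hv j). apply Rmult_le_pos; lra.
    + apply ex_series_scal_l, ex_series_inv_sq.
  - intros n. rewrite (trig_tail_step freq c n) by now apply (rapid_summable freq).
    rewrite (proj1 Hu); auto using EM_expi. unfold c. ring.
  - intros n. rewrite Rmult_assoc. apply Hu'; auto.
    specialize (HS n). apply Rmult_le_pos; lra.
  - replace (Finite 0) with (Rbar_mult (K * K0) 0) by (simpl; f_equal; ring).
    apply is_lim_seq_scal_l, Series_tail_lim, ex_series_inv_sq.
Qed.

(** * The symbol of the operator *)

(** The operator multiplies the Fourier coefficient at [k] by this number. *)
Definition symbol (alpha : R) (k : Z * Z) : R :=
  IZR (fst k) - alpha * IZR (snd k).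

Lemma P_op_expi (m : nat -> R) (alpha : R) (u : Functional) (k : Z * Z) :
  weight_sequence m -> linear_EM m u ->
  P_op alpha u (expi k) = (- RtoC (symbol alpha k) * u (expi k))%C.
Proof.
  intros Hm Hl. unfold P_op, dual_D1, dual_D2.
  change D1 with (Ddir true); change D2 with (Ddir false).
  rewrite !Ddir_expi, !(linear_scal m) by (assumption || now apply EM_expi).
  unfold symbol. simpl. rewrite RtoC_minus, RtoC_mult. ring.
Qed.

Lemma symbol_nonzero (alpha : R) (k : Z * Z) :
  irrational alpha -> k <> (0, 0)%Z -> symbol alpha k <> 0.
Proof.
  intros Hirr Hk Hs. unfold symbol in Hs. destruct k as [k1 k2]; simpl in Hs.
  destruct (Z.lt_trichotomy k2 0) as [H|[->|H]].
  - apply (Hirr (- k1 # Z.to_pos (- k2))%Q). unfold Q2R; simpl.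
    rewrite Z2Pos.id, !opp_IZR by lia.
    apply IZR_lt in H. apply Rmult_eq_reg_r with (- IZR k2); [|lra].
    rewrite Rmult_assoc, Rinv_l by lra. lra.
  - apply Hk. f_equal. apply eq_IZR. simpl. lra.
  - apply (Hirr (k1 # Z.to_pos k2)%Q). unfold Q2R; simpl.
    rewrite Z2Pos.id by lia.
    apply IZR_lt in H. apply Rmult_eq_reg_r with (IZR k2); [|lra].
    rewrite Rmult_assoc, Rinv_l by lra. lra.
Qed.

Lemma Finite_bound {U : Type} (S : U -> Prop) (F : U -> R) :
  Finite_sets.Finite U S -> exists M, forall x, S x -> F x <= M.
Proof.
  induction 1 as [|S HS [M HM] x Hx].
  - exists 0. intros x [].
  - exists (Rmax M (F x)). intros y [z Hz|z Hz].
    + eapply Rle_trans; [now apply HM|apply Rmax_l].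
    + destruct Hz. apply Rmax_r.
Qed.

Lemma pred_ext {U : Type} (S T : U -> Prop) : (forall x, S x <-> T x) -> S = T.
Proof.
  intros H. apply functional_extensionality; intros x.
  now apply propositional_extensionality.
Qed.

Lemma Finite_in_initial (J : nat) : forall S : Z * Z -> Prop,
  (forall k, S k -> (freq_inv k < J)%nat) -> Finite_sets.Finite (Z * Z) S.
Proof.
  induction J as [|J IH]; intros S HS.
  - replace S with (Ensembles.Empty_set (Z * Z)); [constructor|].
    apply pred_ext; intros k. split; [intros []|].
    intros Hk. specialize (HS k Hk). lia.
  - set (S' := fun k => S k /\ k <> freq J).
    assert (HS' : Finite_sets.Finite (Z * Z) S').
    { apply IH. intros k [Hk Hne]. specialize (HS k Hk).
      assert (freq_inv k <> J); [|lia].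
      intros E. apply Hne. now rewrite <- E, freq_freq_inv. }
    destruct (classic (S (freq J))) as [HJ|HJ].
    + replace S with (Ensembles.Add _ S' (freq J)).
      * constructor; [assumption|]. intros [_ Hne]. now apply Hne.
      * apply pred_ext; intros k. split.
        -- intros [z [Hz _]|z []]; assumption.
        -- intros Hk. destruct (classic (k = freq J)) as [->|Hne].
           ++ right. constructor.
           ++ left. now split.
    + replace S with S'; [assumption|].
      apply pred_ext; intros k. split; [now intros [Hk _]|].
      intros Hk. split; [assumption|]. now intros ->.
Qed.

(** A bounded set of frequencies lies in an initial segment of the
    enumeration. *)
Lemma Finite_of_knorm_bound (S : Z * Z -> Prop) (B : R) :
  (forall k, S k -> knorm k <= B) -> Finite_sets.Finite (Z * Z) S.
Proof.
  intros H. apply (Finite_in_initial (Z.to_nat (up (16 * (1 + B) ^ 2)))).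
  intros k Hk.
  pose proof (spread_freq (freq_inv k)) as Hs. rewrite freq_freq_inv in Hs.
  specialize (H k Hk). pose proof (knorm_pos k).
  assert (H2 : (1 + knorm k) ^ 2 <= (1 + B) ^ 2) by (apply pow_incr; lra).
  destruct (archimed (16 * (1 + B) ^ 2)) as [Hup _].
  assert (Hlt : IZR (Z.of_nat (freq_inv k)) < IZR (up (16 * (1 + B) ^ 2))).
  { rewrite <- INR_IZR_INZ. lra. }
  apply lt_IZR in Hlt. lia.
Qed.

(** * Sufficiency: division by the symbol *)

(** Away from a finite set the symbol is at least the infimum, hence at least
    half of the quantity under the infimum for some index [n0]. Estimating
    the dividend with [n + n0] powers of the frequency and splitting the
    weight by moderate growth leaves the bound with [n] powers; the [n0]
    powers cancel because [eps] is chosen small. *)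
Lemma symbol_division (m : nat -> R) (alpha : R) (a w : Z * Z -> R) (K A : R) :
  weight_sequence m -> irrational alpha -> ~ Liouville_exponential m alpha ->
  (forall k, 0 <= w k) -> 0 < K -> 1 <= A ->
  (forall k, Rabs (symbol alpha k) * w k = a k) ->
  (forall k n, a k * knorm k ^ n <= K * A ^ n * weight m n) ->
  exists K' A', 0 < K' /\ 1 <= A' /\
    forall k n, w k * knorm k ^ n <= K' * A' ^ n * weight m n.
Proof.
  intros Hm Hirr Hnl Hw HK HA Haw Ha.
  destruct (weight_moderate m Hm) as (B & HB & HBw).
  assert (HAB : 1 <= A * B) by nra.
  (* with this value [eps * (1 + y)] is at most [x / (A * B)], as [y <= x] and [1 <= x] *)
  set (eps := / (2 * (A * B))).
  assert (Heps : 0 < eps) by (apply Rinv_0_lt_compat; lra).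
  set (E := fun p : Z * Z => Rbar_lt (Rabs (symbol alpha p)) (liouville_bound m eps (snd p))).
  assert (HE : Finite_sets.Finite (Z * Z) E).
  { apply NNPP. intros HnF. apply Hnl. split; auto. exists eps. split; auto. }
  destruct (Finite_bound E w HE) as [M1 HM1].
  destruct (Finite_bound E knorm HE) as [M2 HM2].
  set (M := 1 + Rabs M1 + Rabs M2 + w (0, 0)%Z).
  pose proof (Rabs_pos M1). pose proof (Rabs_pos M2).
  pose proof (Rle_abs M1). pose proof (Rle_abs M2). pose proof (Hw (0, 0)%Z).
  assert (HM : 1 <= M) by (unfold M; lra).
  exists (M + 2 * K), (M + A * B). split; [lra|]. split; [lra|].
  intros k n. pose proof (weight_ge_1 m Hm n) as W1. pose proof (knorm_pos k) as Hk0.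
  assert (PM : 0 < M ^ n) by (apply pow_lt; lra).
  assert (PAB : 0 < (A * B) ^ n) by (apply pow_lt; lra).
  assert (PM' : M ^ n <= (M + A * B) ^ n) by (apply pow_incr; lra).
  assert (PAB' : (A * B) ^ n <= (M + A * B) ^ n) by (apply pow_incr; lra).
  assert (Hsmall : w k <= M -> knorm k <= M ->
     w k * knorm k ^ n <= (M + 2 * K) * (M + A * B) ^ n * weight m n).
  { intros Hwk Hkk.
    assert (Hp : knorm k ^ n <= M ^ n) by (apply pow_incr; lra).
    assert (Hp0 : 0 <= knorm k ^ n) by (apply pow_le; lra).
    apply Rle_trans with ((M + 2 * K) * (M + A * B) ^ n * 1).
    - rewrite Rmult_1_r. apply Rmult_le_compat; auto; lra.
    - apply Rmult_le_compat_l; [|lra]. apply Rmult_le_pos; lra. }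
  destruct (classic (E k)) as [Ek|Ek].
  { specialize (HM1 k Ek); specialize (HM2 k Ek). apply Hsmall; unfold M; lra. }
  destruct (classic (k = (0, 0)%Z)) as [->|Hk].
  { apply Hsmall; [unfold M; lra|]. unfold knorm; simpl.
    rewrite Rabs_R0, Rmax_left; lra. }
  set (d := Rabs (symbol alpha k)).
  assert (Hd : 0 < d) by (apply Rabs_pos_lt; now apply symbol_nonzero).
  assert (Hx : 1 <= knorm k).
  { destruct k as [k1 k2]. unfold knorm; simpl. rewrite <- !abs_IZR.
    destruct (Z.eq_dec k1 0) as [->|Hk1].
    - eapply Rle_trans; [|apply Rmax_r]. apply IZR_le.
      assert (k2 <> 0%Z) by (intros ->; auto). lia.
    - eapply Rle_trans; [|apply Rmax_l]. apply IZR_le. lia. }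
  set (x := knorm k) in *. set (y := Rabs (IZR (snd k))).
  assert (Hy : 0 <= y <= x) by (split; [apply Rabs_pos|apply (prj_le_knorm false)]).
  (* an index at which the infimum is attained up to a factor two *)
  assert (Hn0 : exists n0, weight m n0 / (eps ^ n0 * (1 + y) ^ n0) <= 2 * d).
  { apply NNPP. intros Hno. apply Ek. unfold E. fold d.
    apply Rbar_lt_le_trans with (2 * d); [simpl; lra|].
    apply Glb_Rbar_correct. intros r [n0 ->]. simpl.
    apply Rnot_lt_le. intros Hlt. apply Hno. exists n0. unfold weight, y. lra. }
  destruct Hn0 as [n0 Hn0].
  assert (Pe : 0 < eps ^ n0 * (1 + y) ^ n0).
  { apply Rmult_lt_0_compat; apply pow_lt; lra. }
  apply (proj1 (Rle_div_l _ _ _ Pe)) in Hn0.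
  rewrite <- Rpow_mult_distr in Hn0.
  assert (Hbase : eps * (1 + y) <= x / (A * B)).
  { unfold eps. apply Rmult_le_reg_l with (2 * (A * B)); [lra|].
    replace (2 * (A * B) * (/ (2 * (A * B)) * (1 + y))) with (1 + y) by (field; lra).
    replace (2 * (A * B) * (x / (A * B))) with (2 * x) by (field; lra). lra. }
  assert (Hbase' : (eps * (1 + y)) ^ n0 * (A * B) ^ n0 <= x ^ n0).
  { rewrite <- Rpow_mult_distr. apply pow_incr. split.
    - apply Rmult_le_pos; [apply Rmult_le_pos|]; lra.
    - apply Rmult_le_compat_r with (r := A * B) in Hbase; [|lra].
      replace (x / (A * B) * (A * B)) with x in Hbase by (field; lra). lra. }
  assert (Px : 0 < x ^ n0) by (apply pow_lt; lra).
  assert (PAB0 : 0 < (A * B) ^ n0) by (apply pow_lt; lra).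
  assert (Hmain : d * (w k * x ^ n) * x ^ n0 <= d * (2 * K * (A * B) ^ n * weight m n) * x ^ n0).
  { replace (d * (w k * x ^ n) * x ^ n0) with (a k * x ^ (n + n0))
      by (rewrite <- Haw, pow_add; fold d; ring).
    eapply Rle_trans; [apply Ha|].
    apply Rle_trans with (K * A ^ (n + n0) * (B ^ (n + n0) * weight m n * weight m n0)).
    { apply Rmult_le_compat_l; [|apply HBw]. apply Rmult_le_pos; [lra|apply pow_le; lra]. }
    replace (K * A ^ (n + n0) * (B ^ (n + n0) * weight m n * weight m n0))
      with (K * (A * B) ^ n * weight m n * ((A * B) ^ n0 * weight m n0))
      by (rewrite !pow_add, !Rpow_mult_distr; ring).
    replace (d * (2 * K * (A * B) ^ n * weight m n) * x ^ n0)
      with (K * (A * B) ^ n * weight m n * (2 * d * x ^ n0)) by ring.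
    apply Rmult_le_compat_l.
    - apply Rmult_le_pos; [apply Rmult_le_pos|]; lra.
    - apply Rle_trans with ((A * B) ^ n0 * (2 * d * (eps * (1 + y)) ^ n0)).
      + apply Rmult_le_compat_l; lra.
      + replace ((A * B) ^ n0 * (2 * d * (eps * (1 + y)) ^ n0))
          with (2 * d * ((eps * (1 + y)) ^ n0 * (A * B) ^ n0)) by ring.
        apply Rmult_le_compat_l; lra. }
  apply Rmult_le_reg_r in Hmain; [|assumption].
  apply Rmult_le_reg_l in Hmain; [|assumption].
  eapply Rle_trans; [exact Hmain|].
  apply Rmult_le_compat_r; [lra|]. apply Rmult_le_compat; lra.
Qed.

(** Dividing the coefficients of the datum by the symbol gives coefficients
    that still decay, and the function they define represents [u] since both
    have the same values on characters. *)
Lemma hypoelliptic_of_not_Liouville (m h : nat -> R) (alpha : R) :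
  weight_sequence m -> admissible_steps h ->
  irrational alpha -> ~ Liouville_exponential m alpha ->
  globally_hypoelliptic m h (P_op alpha).
Proof.
  intros Hm Hh Hirr Hnl u Hu (f & Hf & HPu).
  assert (Hsymb : forall k, Rabs (symbol alpha k) * Cmod (u (expi k)) = Cmod (coef f (kopp k))).
  { intros k. pose proof (HPu (expi k) (EM_expi m k Hm)) as E.
    rewrite (P_op_expi m) in E by (assumption || apply Hu).
    unfold coef. rewrite kopp_kopp. unfold embed in E. rewrite <- E.
    rewrite Cmod_mult, Cmod_opp, Cmod_R. reflexivity. }
  destruct (EM_coef_decay m (fun j => kopp (freq j)) f Hm Hf) as (K & A & HK & HA & Hdec).
  destruct (symbol_division m alpha (fun k => Cmod (coef f (kopp k)))
     (fun k => Cmod (u (expi k))) K A Hm Hirr Hnl) as (K' & A' & HK' & HA' & Hw); auto.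
  { intros k; apply Cmod_ge_0. }
  { intros k n. specialize (Hdec (freq_inv k) n). cbv beta in Hdec.
    rewrite freq_freq_inv, knorm_opp in Hdec. exact Hdec. }
  set (c := fun j => (RtoC (/ (2 * PI) ^ 2) * u (expi (freq j)))%C).
  assert (Hd : decay m (fun j => kopp (freq j)) c).
  { apply decay_scal; auto. exists K', A'. split; [|split]; auto.
    intros j n. rewrite knorm_opp. apply Hw. }
  assert (Hsp : spread (fun j => kopp (freq j))) by apply spread_opp, spread_freq.
  exists (trig (fun j => kopp (freq j)) c). split; [now apply EM_trig|].
  intros phi Hphi. destruct (EM_bounded m phi Hphi) as [M HM].
  destruct (embed_trig (fun j => kopp (freq j)) c phi M) as [-> _]; auto.
  - now apply (rapid_decay m).
  - apply smooth_continuous, Hphi.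
  - rewrite (ultradistribution_series m h u phi) by assumption.
    apply CSeries_ext; intros j. rewrite kopp_kopp. unfold c. ring.
Qed.

(** * Necessity: sums of characters over a set of frequencies *)

Definition indicator (S : Z * Z -> Prop) (k : Z * Z) : C :=
  if excluded_middle_informative (S k) then 1 else 0.

Lemma indicator_in (S : Z * Z -> Prop) (k : Z * Z) : S k -> indicator S k = 1.
Proof. unfold indicator; destruct excluded_middle_informative; tauto. Qed.

Lemma Cmod_indicator (S : Z * Z -> Prop) (k : Z * Z) : Cmod (indicator S k) <= 1.
Proof.
  unfold indicator; destruct excluded_middle_informative;
    rewrite ?Cmod_0, ?Cmod_1; lra.
Qed.

(** As an ultradistribution this is, up to reflection and a constant, the sum
    of the characters over [S]. All its coefficients are zero or one, so it
    is not a function of the class when [S] is infinite. *)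
Definition char_sum (S : Z * Z -> Prop) : Functional :=
  fun phi => CSeries (fun j => indicator S (freq j) * coef phi (freq j))%C.

Lemma EM_coef_summable (m : nat -> R) (f : Fn) : weight_sequence m -> EM m f ->
  rapid freq (fun j => coef f (freq j)).
Proof.
  intros Hm Hf. apply (rapid_decay m); auto using spread_freq. now apply EM_coef_decay.
Qed.

Lemma summable_indicator (S : Z * Z -> Prop) (a : nat -> C) : abs_summable a ->
  abs_summable (fun j => indicator S (freq j) * a j)%C.
Proof.
  apply abs_summable_bound. intros j. rewrite Cmod_mult.
  pose proof (Cmod_indicator S (freq j)). pose proof (Cmod_ge_0 (a j)). nra.
Qed.

(** Four powers of the frequency pay for summability over the enumeration,
    uniformly over the unit ball of a step. *)
Lemma char_sum_ultradistribution (m h : nat -> R) (S : Z * Z -> Prop) :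
  weight_sequence m -> admissible_steps h -> ultradistribution m h (char_sum S).
Proof.
  intros Hm Hh. apply step_bound_continuous; auto.
  - intros f g a b Hf Hg. unfold char_sum.
    rewrite <- CSeries_lin; try (apply summable_indicator, (rapid_summable freq);
       now apply (EM_coef_summable m)).
    apply CSeries_ext; intros j.
    rewrite coef_lin by (apply smooth_continuous; (apply Hf || apply Hg)). ring.
  - intros N. assert (HhN : 0 < h N) by apply Hh.
    set (K0 := 256 * 16 * (2 * (2 * PI) ^ 2 * (weight m 0 + h N ^ 4 * weight m 4))).
    assert (HK0 : 0 < K0).
    { pose proof two_pi_pos. pose proof (weight_pos m 0 Hm). pose proof (weight_pos m 4 Hm).
      assert (0 < (2 * PI) ^ 2) by now apply pow_lt.
      assert (0 < h N ^ 4 * weight m 4) by (apply Rmult_lt_0_compat; [now apply pow_lt|lra]).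
      unfold K0. assert (0 < 2 * (2 * PI) ^ 2 * (weight m 0 + h N ^ 4 * weight m 4)); [|lra].
      apply Rmult_lt_0_compat; lra. }
    set (s := Series (fun j => / (INR j + 1) ^ 2)).
    exists (2 * K0 * s + 1 + Rabs (2 * K0 * s)). split.
    { pose proof (Rle_abs (- (2 * K0 * s))) as Hr. rewrite Rabs_Ropp in Hr. lra. }
    intros f B Hf HB HD.
    assert (Hterm : forall j, Cmod (indicator S (freq j) * coef f (freq j))
        <= K0 * B * / (INR j + 1) ^ 2).
    { intros j. rewrite Cmod_mult.
      pose proof (Cmod_indicator S (freq j)). pose proof (Cmod_ge_0 (coef f (freq j))).
      apply Rle_trans with (Cmod (coef f (freq j))); [nra|].
      pose proof (pos_INR j).
      assert (Hp : 0 < (INR j + 1) ^ 2) by (apply pow_lt; lra).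
      apply Rmult_le_reg_r with ((INR j + 1) ^ 2); [assumption|].
      rewrite (Rmult_assoc _ (/ (INR j + 1) ^ 2)), Rinv_l, Rmult_1_r by lra.
      pose proof (decay_coef m freq f B (h N) Hm (proj1 Hf) HB HhN HD (freq j)) as Hdc.
      pose proof (Hdc 0%nat) as D0. pose proof (Hdc 4%nat) as D4.
      pose proof (spread_sq freq j spread_freq) as Hs.
      apply Rmult_le_compat_l with (r := Cmod (coef f (freq j))) in Hs; auto.
      eapply Rle_trans; [exact Hs|]. rewrite pow_O, Rmult_1_r in D0.
      rewrite pow_O in D0. unfold K0. lra. }
    assert (Hb : Cmod (char_sum S f) <= 2 * Series (fun j => K0 * B * / (INR j + 1) ^ 2)).
    { apply CSeries_bound; auto. apply ex_series_scal_l, ex_series_inv_sq. }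
    rewrite Series_scal_l in Hb. fold s in Hb.
    pose proof (Rabs_pos (2 * K0 * s)). nra.
Qed.

Lemma char_sum_expi (S : Z * Z -> Prop) (k : Z * Z) : S k ->
  char_sum S (expi k) = RtoC ((2 * PI) ^ 2).
Proof.
  intros Hk. unfold char_sum. rewrite (CSeries_single _ (freq_inv k)).
  - rewrite freq_freq_inv, coef_expi_same, indicator_in by assumption. ring.
  - apply summable_indicator.
    apply (ex_series_incr_n _ (Datatypes.S (freq_inv k))).
    apply (ex_series_ext (fun _ => 0 * 0)).
    + intros n. rewrite coef_expi_diff, Cmod_0; [apply Rmult_0_l|].
      intros E. apply (f_equal freq_inv) in E. rewrite freq_inv_freq in E. lia.
    + apply ex_series_scal_l. apply (ex_series_ext (fun j => 0 * / (INR j + 1) ^ 2)).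
      * intros; apply Rmult_0_l.
      * apply ex_series_scal_l, ex_series_inv_sq.
  - intros j Hj. rewrite coef_expi_diff; [ring|].
    intros E. apply Hj. rewrite E. symmetry. apply freq_inv_freq.
Qed.

(** The coefficients of the image are values of the symbol on [S]. Where the
    symbol is at most one, the second component of a frequency controls the
    first, so smallness in terms of that component is decay. *)
Lemma P_char_sum (m : nat -> R) (alpha eps : R) (S : Z * Z -> Prop) :
  weight_sequence m -> 0 < eps ->
  (forall k n, S k ->
     Rabs (symbol alpha k) <= weight m n / (eps ^ n * (1 + Rabs (IZR (snd k))) ^ n)) ->
  functional_in_EM m (P_op alpha (char_sum S)).
Proof.
  intros Hm Heps HS.
  set (c := fun j => (- RtoC (symbol alpha (freq j)) * indicator S (freq j))%C).
  pose proof (Rabs_pos alpha) as Hal.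
  assert (Hq : 0 < (1 + Rabs alpha) / eps) by (apply Rdiv_lt_0_compat; lra).
  assert (Hd : decay m (fun j => kopp (freq j)) c).
  { exists 1, (1 + (1 + Rabs alpha) / eps). split; [lra|]. split; [lra|].
    intros j n. rewrite knorm_opp. set (k := freq j) in *. unfold c; fold k.
    assert (Pn : 0 < (1 + (1 + Rabs alpha) / eps) ^ n) by (apply pow_lt; lra).
    pose proof (weight_pos m n Hm).
    rewrite Cmod_mult, Cmod_opp, Cmod_R.
    unfold indicator. destruct excluded_middle_informative as [Hk|Hk].
    2: { rewrite Cmod_0, Rmult_0_r, Rmult_0_l. apply Rmult_le_pos; lra. }
    rewrite Cmod_1, Rmult_1_r, Rmult_1_l.
    set (d := Rabs (symbol alpha k)). set (y := Rabs (IZR (snd k))).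
    assert (Hy : 0 <= y) by apply Rabs_pos.
    assert (Hx : knorm k <= (1 + Rabs alpha) * (1 + y)).
    { (* index [0] bounds the symbol by one, so [snd k] controls [knorm k] *)
      pose proof (HS k 0%nat Hk) as H0. unfold weight in H0. simpl in H0.
      rewrite (ws_0 m Hm) in H0. fold d in H0.
      replace (1 * 1 / (1 * 1)) with 1 in H0 by field.
      apply Rmax_lub.
      - replace (IZR (fst k)) with (symbol alpha k + alpha * IZR (snd k))
          by (unfold symbol; ring).
        eapply Rle_trans; [apply Rabs_triang|]. rewrite Rabs_mult. fold d y.
        assert (0 <= Rabs alpha * y) by (apply Rmult_le_pos; lra). lra.
      - fold y. nra. }
    pose proof (HS k n Hk) as Hn. fold d y in Hn.
    assert (Py : 0 < (1 + y) ^ n) by (apply pow_lt; lra).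
    assert (Pe : 0 < eps ^ n) by (apply pow_lt; lra).
    pose proof (knorm_pos k).
    assert (Hxn : knorm k ^ n <= ((1 + Rabs alpha) * (1 + y)) ^ n) by (apply pow_incr; lra).
    apply Rle_trans with (weight m n / (eps ^ n * (1 + y) ^ n)
        * ((1 + Rabs alpha) * (1 + y)) ^ n).
    { apply Rmult_le_compat; auto; [apply Rabs_pos|apply pow_le; lra]. }
    replace (weight m n / (eps ^ n * (1 + y) ^ n) * ((1 + Rabs alpha) * (1 + y)) ^ n)
      with (((1 + Rabs alpha) / eps) ^ n * weight m n).
    2: { unfold Rdiv. rewrite !Rpow_mult_distr, pow_inv. field. split; lra. }
    apply Rmult_le_compat_r; [lra|]. apply pow_incr. lra. }
  assert (Hsp : spread (fun j => kopp (freq j))) by apply spread_opp, spread_freq.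
  exists (trig (fun j => kopp (freq j)) c). split; [now apply EM_trig|].
  intros phi Hphi. destruct (EM_bounded m phi Hphi) as [M HM].
  destruct (embed_trig (fun j => kopp (freq j)) c phi M) as [-> _]; auto.
  { now apply (rapid_decay m). }
  { apply smooth_continuous, Hphi. }
  unfold P_op, dual_D1, dual_D2, char_sum.
  change D1 with (Ddir true); change D2 with (Ddir false).
  pose proof (EM_coef_summable m phi Hm Hphi) as Hr.
  assert (Hb : forall b, abs_summable
     (fun j => indicator S (freq j) * coef (Ddir b phi) (freq j))%C).
  { intros b. apply summable_indicator.
    apply (abs_summable_bound _ (fun j => Cmod (mul_freq b freq (fun j => coef phi (freq j)) j))).
    - intros j. rewrite coef_Ddir by apply Hphi. apply Rle_refl.
    - now apply (rapid_summable freq), rapid_mul_freq. }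
  transitivity (- (1) * CSeries (fun j => indicator S (freq j) * coef (Ddir true phi) (freq j))
    + RtoC alpha * CSeries (fun j => indicator S (freq j) * coef (Ddir false phi) (freq j)))%C.
  { ring. }
  rewrite <- CSeries_lin by apply Hb.
  apply CSeries_ext; intros j. rewrite !coef_Ddir by apply Hphi.
  rewrite kopp_kopp. unfold c, symbol, prj. rewrite RtoC_minus, RtoC_mult. ring.
Qed.

(** The sum of the characters over [S] is mapped into the class, so it
    belongs to the class itself; coefficients equal to one at unboundedly
    many frequencies would contradict decay, already with one power of the
    frequency. *)
Lemma hypoelliptic_bounded (m h : nat -> R) (alpha eps : R) (S : Z * Z -> Prop) :
  weight_sequence m -> admissible_steps h -> 0 < eps ->
  globally_hypoelliptic m h (P_op alpha) ->
  (forall k n, S k ->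
     Rabs (symbol alpha k) <= weight m n / (eps ^ n * (1 + Rabs (IZR (snd k))) ^ n)) ->
  exists B, forall k, S k -> knorm k <= B.
Proof.
  intros Hm Hh Heps Hyp HS.
  destruct (Hyp (char_sum S)) as (f & Hf & Hemb).
  - now apply char_sum_ultradistribution.
  - now apply (P_char_sum m alpha eps).
  - destruct (EM_coef_decay m (fun j => kopp (freq j)) f Hm Hf) as (K & A & HK & HA & H).
    exists (K * A ^ 1 * weight m 1 / (2 * PI) ^ 2). intros k Hk.
    pose proof (H (freq_inv k) 1%nat) as Hd. cbv beta in Hd.
    rewrite freq_freq_inv, knorm_opp, pow_1 in Hd.
    pose proof (Hemb (expi k) (EM_expi m k Hm)) as E.
    rewrite char_sum_expi in E by assumption.
    assert (E' : coef f (kopp k) = embed f (expi k)).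
    { unfold coef. rewrite kopp_kopp. reflexivity. }
    pose proof two_pi_pos.
    assert (P2 : 0 < (2 * PI) ^ 2) by now apply pow_lt.
    rewrite E', <- E, Cmod_R, Rabs_pos_eq in Hd by lra.
    apply Rle_div_r; [assumption|]. rewrite pow_1. lra.
Qed.

(** For a rational number the symbol vanishes on all multiples of one
    frequency. *)
Lemma hypoelliptic_irrational (m h : nat -> R) (alpha : R) :
  weight_sequence m -> admissible_steps h ->
  globally_hypoelliptic m h (P_op alpha) -> irrational alpha.
Proof.
  intros Hm Hh Hyp q Hq.
  destruct (hypoelliptic_bounded m h alpha 1 (fun k => symbol alpha k = 0)) as [B HB]; auto.
  - lra.
  - intros k n ->. rewrite Rabs_R0. pose proof (weight_pos m n Hm).
    pose proof (Rabs_pos (IZR (snd k))).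
    left. apply Rdiv_lt_0_compat; [assumption|].
    apply Rmult_lt_0_compat; apply pow_lt; lra.
  - set (n := (1 + Z.abs (up B))%Z).
    assert (Hd : 0 < IZR (Zpos (Qden q))) by (apply IZR_lt; lia).
    assert (Hs : symbol alpha (n * Qnum q, n * Zpos (Qden q))%Z = 0).
    { unfold symbol; simpl fst; simpl snd. rewrite Hq. unfold Q2R.
      rewrite !mult_IZR. field. lra. }
    specialize (HB _ Hs). unfold knorm in HB; simpl fst in HB; simpl snd in HB.
    assert (Hle : Rabs (IZR (n * Zpos (Qden q))) <= B).
    { eapply Rle_trans; [apply Rmax_r|exact HB]. }
    rewrite <- abs_IZR in Hle. destruct (archimed B) as [HB1 _].
    assert (Hlt : IZR (Z.abs (n * Z.pos (Qden q))) < IZR (up B)) by lra.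
    apply lt_IZR in Hlt. unfold n in Hlt. nia.
Qed.

(** The frequencies that make the number Liouville are those on which the
    symbol is small enough for the sum of characters. *)
Lemma hypoelliptic_not_Liouville (m h : nat -> R) (alpha : R) :
  weight_sequence m -> admissible_steps h ->
  globally_hypoelliptic m h (P_op alpha) -> ~ Liouville_exponential m alpha.
Proof.
  intros Hm Hh Hyp (_ & eps & Heps & Hinf). apply Hinf.
  destruct (hypoelliptic_bounded m h alpha eps (fun p : Z * Z =>
        Rbar_lt (Rabs (IZR (fst p) - alpha * IZR (snd p)))
                (liouville_bound m eps (snd p)))) as [B HB]; auto.
  - intros k n Hk.
    assert (Hle : Rbar_le (Rabs (symbol alpha k))
       (weight m n / (eps ^ n * (1 + Rabs (IZR (snd k))) ^ n))); [|exact Hle].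
    eapply Rbar_le_trans; [apply Rbar_lt_le, Hk|].
    apply (proj1 (Glb_Rbar_correct _)). exists n. reflexivity.
  - now apply (Finite_of_knorm_bound _ B).
Qed.

Theorem proposition6p6 (m : nat -> R) (hm : weight_sequence m)
    (h : nat -> R) (hh : admissible_steps h) (alpha : R) :
  globally_hypoelliptic m h (P_op alpha) <->
  (irrational alpha /\ ~ Liouville_exponential m alpha).
Proof.
  split.
  - intros Hyp. split.
    + now apply (hypoelliptic_irrational m h).
    + now apply (hypoelliptic_not_Liouville m h).
  - intros [Hirr Hnl]. now apply hypoelliptic_of_not_Liouville.
Qed.
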